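(* Let $\varphi\in L^2(\mathbb{R})$ and $a>0$, and let $C_\varphi$ and $T_\varphi$ be the analysis operator and the generalized frame operator of the sequence of translates $\mathcal{T}(\varphi,a)=\{\varphi_n\}_{n\in\mathbb{Z}}$, $\varphi_n(x)=\varphi(x-na)$. The following statements hold. (i) $\mathcal{D}(C_\varphi)=\{f\in L^2(\mathbb{R}):[\widehat f,\widehat\varphi]\in L^2(0,1)\}$ and $C_\varphi f=\{\langle[\widehat f,\widehat\varphi],e_{-n}\rangle\}_{n\in\mathbb{Z}}$ for all $f\in\mathcal{D}(C_\varphi)$. The domain $\mathcal{D}(C_\varphi)$ contains all functions in $L^2(\mathbb{R})$ whose Fourier transform is bounded and compactly supported; thus $\mathcal{D}(C_\varphi)$ is dense in $L^2(\mathbb{R})$. (ii) The adjoint $C_\varphi^*$ has domain $$\mathcal{D}(C_\varphi^* )=\Big\{\{c_n\}\in\ell^2(\mathbb{Z}):\int_{-\infty}^{\infty}\Big|\sum_{n\in\mathbb{Z}}c_ne^{-2\pi i na\gamma}\,\widehat\varphi(\gamma)\Big|^2d\gamma<\infty\Big\}$$ and it is given by $\widehat{C_\varphi^*\{c_n\}}(\gamma)=\sum_{n\in\mathbb{Z}}c_ne^{-2\pi i na\gamma}\,\widehat\varphi(\gamma)$ for $\{c_n\}\in\mathcal{D}(C_\varphi^* )$ and a.e. $\gamma\in\mathbb{R}$. (iii) $\mathcal{D}(T_\varphi)$ is the subspace of all $f\in L^2(\mathbb{R})$ such that (a) $[\widehat f,\widehat\varphi]\in L^2(0,1)$; and (b)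 the function $\mathbb{R}\to\mathbb{C}$ given by $\gamma\mapsto\widehat\varphi(\gamma)\sum_{n\in\mathbb{Z}}\widehat f\left(\gamma-\frac na\right)\overline{\widehat\varphi\left(\gamma-\frac na\right)}$ belongs to $L^2(\mathbb{R})$; and $$\widehat{T_\varphi f}(\gamma)=\frac1a\,\widehat\varphi(\gamma)\sum_{n\in\mathbb{Z}}\widehat f\left(\gamma-\frac na\right)\overline{\widehat\varphi\left(\gamma-\frac na\right)}$$ for $f\in\mathcal{D}(T_\varphi)$ and a.e. $\gamma\in\mathbb{R}$.
   Context: Inner products are linear in the first variable. The Fourier transform is $\widehat f(\gamma)=\int_{\mathbb{R}}f(x)e^{-2\pi i x\gamma}\,dx$ for $f\in L^1(\mathbb R)$, extended to a unitary operator on $L^2(\mathbb{R})$. For $n\in\mathbb{Z}$, $e_n(\gamma)=e^{2\pi i n\gamma}$, $\gamma\in(0,1)$. For $f,\varphi\in L^2(\mathbb{R})$ the bracket product is $$[\widehat f,\widehat\varphi](\gamma)=\frac1a\sum_{n\in\mathbb{Z}}\widehat f\left(\frac{\gamma-n}{a}\right)\overline{\widehat\varphi\left(\frac{\gamma-n}{a}\right)},\quad\gamma\in[0,1];$$ the series converges absolutely for a.e. $\gamma$ and defines an element of $L^1(0,1)$. For $\{c_n\}\in\ell^2(\mathbb{Z})$, the expression $\sum_n c_ne^{-2\pi i na\gamma}$ denotes the $1/a$-periodic function of $\gamma$ given by the Fourier series converging in $L^2$ over a period. The analysis operator $C_\varphi$ has domain $\mathcal{D}(C_\varphi)=\{f\in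 L^2(\mathbb{R}):\sum_{n\in\mathbb{Z}}|\langle f,\varphi_n\rangle|^2<\infty\}$ and $C_\varphi f=\{\langle f,\varphi_n\rangle\}_{n\in\mathbb{Z}}\in\ell^2(\mathbb{Z})$. The generalized frame operator $T_\varphi$ is the operator on $\overline{\mathcal{D}(C_\varphi)}$ whose domain is the set of $f\in\mathcal{D}(C_\varphi)$ for which there is $h\in\overline{\mathcal{D}(C_\varphi)}$ with $\sum_{n\in\mathbb{Z}}\langle f,\varphi_n\rangle\langle\varphi_n,g\rangle=\langle h,g\rangle$ for all $g\in\mathcal{D}(C_\varphi)$, and then $T_\varphi f=h$ (unique). *)

(* Defs.v *)
From HB Require Import structures.
From mathcomp Require Import all_boot all_order all_algebra.
From mathcomp Require Import all_classical all_reals all_analysis.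
From mathcomp.real_closed Require Import complex.

Set Implicit Arguments.
Unset Strict Implicit.
Unset Printing Implicit Defensive.

Import Order.TTheory GRing.Theory Num.Theory.
Import numFieldNormedType.Exports.

Local Open Scope classical_set_scope.
Local Open Scope ring_scope.

(* Elements of L^p are represented by functions; equality in L^p is equality
   almost everywhere. *)
Section Complex_functions.
Variable R : realType.
Notation mu := (@lebesgue_measure R).
Implicit Types (A : set R) (f g : R -> R[i]).

Definition cabs (z : R[i]) : R := Normc.normc z.

Definition cmeasurable A f : Prop :=
  measurable_fun A (fun x => complex.Re (f x)) /\
  measurable_fun A (fun x => complex.Im (f x)).

Definition cintegral A f : R[i] :=
  Complex (\int[mu]_(x in A) complex.Re (f x))
          (\int[mu]_(x in A) complex.Im (f x)).

Definition in_L1 A f : Prop :=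
  cmeasurable A f /\ (\int[mu]_(x in A) (cabs (f x))%:E < +oo)%E.

Definition sqnorm A f : \bar R := (\int[mu]_(x in A) (cabs (f x) ^+ 2)%:E)%E.

Definition in_L2 A f : Prop := cmeasurable A f /\ (sqnorm A f < +oo)%E.

Definition L2dot A f g : R[i] := cintegral A (fun x => f x * conjc (g x)).

Definition L2cvg A (u : nat -> R -> R[i]) g : Prop :=
  (fun k => sqnorm A (fun x => u k x - g x)) @ \oo --> 0%E.

Definition L2closure (D : set (R -> R[i])) : set (R -> R[i]) :=
  [set f | in_L2 setT f /\
     forall e : R, 0 < e ->
       exists2 g, D g & (sqnorm setT (fun x => f x - g x)%R < e%:E)%E].

Definition is_subspace (D : set (R -> R[i])) : Prop :=
  D (fun=> 0) /\
  forall (k : R[i]) f g, D f -> D g -> D (fun x => k * f x + g x).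

End Complex_functions.

Section Bilateral_sequences.
Variable R : realType.
Implicit Types c d : int -> R[i].

Definition partial_zsum c (N : nat) : R[i] :=
  \sum_(i < N.*2.+1) c (i%:Z - N%:Z).

(* Limit of the symmetric partial sums; for an absolutely convergent series this
   is the sum over Z, whatever the order of summation. *)
Definition zsum c : R[i] :=
  Complex (limn (fun N => complex.Re (partial_zsum c N)))
          (limn (fun N => complex.Im (partial_zsum c N))).

Definition in_l2 c : Prop :=
  (\esum_(n in [set: int]) (cabs (c n) ^+ 2)%:E < +oo)%E.

Definition l2dot c d : R[i] := zsum (fun n => c n * conjc (d n)).

End Bilateral_sequences.

Section Fourier.
Variable R : realType.
Implicit Types f g : R -> R[i].

Definition cis (t : R) : R[i] := Complex (cos t) (sin t).

Definition expo (n : int) (x : R) : R[i] := cis (2 * pi * n%:~R * x).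

Definition fourier1 f (y : R) : R[i] :=
  cintegral setT (fun x => f x * cis (- (2 * pi * x * y))).

(* Graph of the extension by continuity to L^2(R) of the integral transform on
   the dense subspace of functions that are both in L^1 and in L^2. *)
Definition is_fourier f g : Prop :=
  [/\ in_L2 setT f, in_L2 setT g &
   exists u : nat -> R -> R[i],
     [/\ forall k, in_L1 setT (u k) /\ in_L2 setT (u k),
         L2cvg setT u f & L2cvg setT (fun k => fourier1 (u k)) g]].

Definition fourier f : R -> R[i] := xget (fun=> 0) [set g | is_fourier f g].

(* For c in l^2: a (1/a)-periodic function that is the limit, in L^2 over a
   period, of the partial sums of sum_n c_n exp (-2 pi i n a x). *)
Definition fourier_series (a : R) (c : int -> R[i]) : R -> R[i] :=
  xget (fun=> 0) [set g |
    [/\ periodic g a^-1, in_L2 `[0, a^-1] g &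
        L2cvg `[0, a^-1]
          (fun N x => partial_zsum (fun n => c n * expo (- n) (a * x)) N) g]].

Definition bracket (a : R) f g (x : R) : R[i] :=
  real_complex R a^-1 *
  zsum (fun n => f ((x - n%:~R) / a) * conjc (g ((x - n%:~R) / a))).

End Fourier.

Section Translates.
Variables (R : realType) (phi : R -> R[i]) (a : R).
Implicit Types f g h : R -> R[i].

Definition translate (n : int) (x : R) : R[i] := phi (x - n%:~R * a).

Definition analysis f (n : int) : R[i] := L2dot setT f (translate n).

Definition dom_analysis : set (R -> R[i]) :=
  [set f | in_L2 setT f /\ in_l2 (analysis f)].

(* The adjoint and the generalized frame operator are given by their graphs:
   the second argument is a value of the operator at the first one. *)
Definition is_analysis_adjoint (c : int -> R[i]) h : Prop :=
  [/\ in_l2 c, in_L2 setT h &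
      forall f, dom_analysis f -> l2dot (analysis f) c = L2dot setT f h].

Definition dom_analysis_adjoint : set (int -> R[i]) :=
  [set c | exists h, is_analysis_adjoint c h].

Definition is_frame_operator f h : Prop :=
  [/\ dom_analysis f, L2closure dom_analysis h &
      forall g, dom_analysis g ->
        zsum (fun n => L2dot setT f (translate n) * L2dot setT (translate n) g)
        = L2dot setT h g].

Definition dom_frame_operator : set (R -> R[i]) :=
  [set f | exists h, is_frame_operator f h].

End Translates.

(* Main.v *)
(* Put F = fourier f * conj (fourier phi).  Translating phi by n a multiplies its
   transform by a character, so that <f, phi_n> is the integral of
   F(y) exp(2 pi i n a y) over the line; folding the line onto one period, this is
   the n-th Fourier coefficient of the bracket product, an L^1 function on (0, 1).
   Uniqueness of Fourier coefficients in L^1 and Riesz-Fischer then say that the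
   coefficients are in l^2 exactly when the bracket product is in L^2(0, 1).  By
   Parseval and unfolding, <C f, c> = <fourier f, m_c fourier phi> with
   m_c(y) = sum_n c_n exp(-2 pi i n a y); testing against functions f whose
   transform is bounded with bounded support, all of which lie in D(C), identifies
   the adjoint.  Finally T = C^* C, and m_c is 1/a times the folding of F when
   c = C f.

   Uniqueness in L^1: functions with vanishing Fourier coefficients are stable under
   products with trigonometric polynomials.  If q is an affine image of
   cos(2 pi (x - x0)) with values in [0, 1], then (1 - q^k)^(2^k) tends boundedly
   to the indicator function of the arc q < 1/2, so the integral over every arc is 0.

   Plancherel: for f supported in (-L/2, L/2) the values of the transform at the
   points (s - n) / L are Fourier coefficients of a modulated dilate of f; Parseval
   integrated over s in (0, 1) gives the identity.  General f follow by truncation,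
   and surjectivity from the multiplication formula. *)
Require Import Defs.
From HB Require Import structures.
From mathcomp Require Import all_boot all_order all_algebra.
From mathcomp Require Import all_classical all_reals all_analysis.
From mathcomp.real_closed Require Import complex.
From mathcomp Require Import measurable_realfun zify ring lra.

Set Implicit Arguments.
Unset Strict Implicit.
Unset Printing Implicit Defensive.

Import Order.TTheory GRing.Theory Num.Theory.
Import numFieldNormedType.Exports.

Local Open Scope classical_set_scope.
Local Open Scope ring_scope.

(** The transform is handled through its graph [is_fourier]: [fourier f] is a chosen representative,
    known up to null sets, and isometry, linearity, translation and surjectivity are closure
    properties of the graph, obtained on L^1 and L^2 together and then carried to the limit. Two
    obstacles shape the rest. First, [zsum] is a limit of symmetric partial sums with a default
    value at divergence. A periodization must therefore be measurable even where it diverges, and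
    the bracket product need not be literally periodic, because a translation recentres the partial
    sums. An identity on one period reaches the line only through countably many translates, each
    with its own null set. Second, when the adjoint is identified, the product m_c fourier phi is
    not yet known to be square integrable. The test functions must then truncate this product as
    well as the difference to be annihilated, so that every pairing is an honest integral. *)

Notation Re := (@complex.Re _).
Notation Im := (@complex.Im _).

(** * Complex-valued functions *)

Arguments L2dot : simpl never.
Arguments cintegral : simpl never.
Arguments zsum : simpl never.
Arguments partial_zsum : simpl never.
Arguments cabs : simpl never.
Arguments cis : simpl never.

Section Complex_numbers.
Variable R : realType.
Implicit Types (z w : R[i]) (t : R).

Lemma cabs_sqr z : cabs z ^+ 2 = Re z ^+ 2 + Im z ^+ 2.
Proof. by case: z => x y; rewrite /cabs/= sqr_sqrtr// addr_ge0 ?sqr_ge0. Qed.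

Lemma ReD z w : Re (z + w) = Re z + Re w.
Proof. by case: z w => a b []. Qed.

Lemma ImD z w : Im (z + w) = Im z + Im w.
Proof. by case: z w => a b []. Qed.

Lemma ReB z w : Re (z - w) = Re z - Re w.
Proof. by case: z w => a b []. Qed.

Lemma ImB z w : Im (z - w) = Im z - Im w.
Proof. by case: z w => a b []. Qed.

Lemma cabs_ge0 z : 0 <= cabs z.
Proof. by case: z => x y; rewrite /cabs/= sqrtr_ge0. Qed.

Lemma cabsM z w : cabs (z * w) = cabs z * cabs w.
Proof. exact: Normc.normcM. Qed.

Lemma cabs_conj z : cabs (conjc z) = cabs z.
Proof. by case: z => x y; rewrite /cabs/= sqrrN. Qed.

Lemma cabs0 : cabs (0 : R[i]) = 0.
Proof. exact: Normc.normc0. Qed.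

Lemma cabs_eq0 z : cabs z = 0 -> z = 0.
Proof. exact: Normc.eq0_normc. Qed.

Lemma cabs_cis t : cabs (cis t) = 1.
Proof. by rewrite /cabs/= cos2Dsin2 sqrtr1. Qed.

Lemma normr_Re_le z : `|Re z| <= cabs z.
Proof.
rewrite -(@ler_pXn2r _ 2) ?nnegrE ?cabs_ge0 ?normr_ge0// cabs_sqr.
by rewrite real_normK ?num_real// lerDl sqr_ge0.
Qed.

Lemma normr_Im_le z : `|Im z| <= cabs z.
Proof.
rewrite -(@ler_pXn2r _ 2) ?nnegrE ?cabs_ge0 ?normr_ge0// cabs_sqr.
by rewrite real_normK ?num_real// lerDr sqr_ge0.
Qed.

Lemma cabs_le_ReIm z : cabs z <= `|Re z| + `|Im z|.
Proof.
rewrite -(@ler_pXn2r _ 2) ?nnegrE ?cabs_ge0 ?addr_ge0// cabs_sqr.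
rewrite sqrrD !real_normK ?num_real// -addrA lerD2l lerDr.
by rewrite mulrn_wge0// mulr_ge0.
Qed.

Lemma cabsD_sqr z w : cabs (z + w) ^+ 2 <= 2 * cabs z ^+ 2 + 2 * cabs w ^+ 2.
Proof.
rewrite !cabs_sqr; case: z => a b; case: w => c d /=.
have := sqr_ge0 (a - c); have := sqr_ge0 (b - d); nra.
Qed.

Lemma cabsMV_sqr z w : 2 * (cabs z * cabs w) <= cabs z ^+ 2 + cabs w ^+ 2.
Proof. have := sqr_ge0 (cabs z - cabs w); nra. Qed.

Lemma cabsD z w : cabs (z + w) <= cabs z + cabs w.
Proof.
rewrite -(@ler_pXn2r _ 2) ?nnegrE ?cabs_ge0 ?addr_ge0 ?cabs_ge0//.
rewrite [leRHS]sqrrD !cabs_sqr -[_ *+ 2]mulr_natl.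
(* Cauchy-Schwarz in the plane, from Lagrange's identity: the two squares differ by the square of Re
   z Im w - Im z Re w. *)
have h : Re z * Re w + Im z * Im w <= cabs z * cabs w.
  apply: le_trans (ler_norm _) _.
  rewrite -(@ler_pXn2r _ 2) ?nnegrE ?normr_ge0 ?mulr_ge0 ?cabs_ge0//.
  rewrite exprMn !cabs_sqr real_normK ?num_real//.
  have := sqr_ge0 (Re z * Im w - Im z * Re w); nra.
by case: z w h => a b [c d] /=; nra.
Qed.

Lemma mulc_conj z : z * conjc z = real_complex R (cabs z ^+ 2).
Proof.
rewrite cabs_sqr; case: z => a b; apply/eqP; rewrite eq_complex /=.
by apply/andP; split; apply/eqP; ring.
Qed.

Lemma cisD t u : cis (t + u) = cis t * cis u.
Proof.
by apply/eqP; rewrite eq_complex /= cosD sinD; apply/andP; split; apply/eqP; ring.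
Qed.

Lemma cis0 : cis (0 : R) = 1.
Proof. by rewrite /cis cos0 sin0. Qed.

Lemma cisN t : cis (- t) = conjc (cis t).
Proof. by rewrite /cis cosN sinN. Qed.

Lemma cis_2pi (n : int) : cis (2 * pi * n%:~R) = 1 :> R[i].
Proof.
have h (k : nat) : cis (2 * pi * k%:R) = 1 :> R[i].
  elim: k => [|k ih]; first by rewrite mulr0 cis0.
  rewrite -[k.+1%:R]natr1 mulrDr mulr1 cisD ih mul1r /cis.
  by rewrite (_ : 2 * pi = 0 + pi *+ 2) ?cosD2pi ?sinD2pi ?cos0 ?sin0//
    add0r mulr_natl.
case: n => n; first exact: h.
by rewrite NegzE mulrNz mulrN cisN h conjc1.
Qed.

(** Convergence by components, the form in which [zsum] and [cintegral] are defined; [ccvg_cabs]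
    relates it to the modulus. *)
Definition ccvg (u : nat -> R[i]) z :=
  (Re \o u @ \oo --> Re z) /\ (Im \o u @ \oo --> Im z).

Lemma ccvg_unique u z w : ccvg u z -> ccvg u w -> z = w.
Proof.
move=> [u1 u2] [v1 v2]; apply/eqP; rewrite eq_complex.
by rewrite (cvg_unique _ u1 v1)// (cvg_unique _ u2 v2)// !eqxx.
Qed.

Lemma ccvgM u v z w : ccvg u z -> ccvg v w -> ccvg (fun n => u n * v n) (z * w).
Proof.
move=> [u1 u2] [v1 v2]; split.
  have -> : Re \o (fun n => u n * v n)
      = (Re \o u) \* (Re \o v) \- (Im \o u) \* (Im \o v).
    by apply/funext => n /=; case: (u n) (v n) => a b [].
  rewrite (_ : Re (z * w) = Re z * Re w - Im z * Im w); last by case: z w {u1 u2 v1 v2} => a b [].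
  by apply: cvgB; apply: cvgM.
have -> : Im \o (fun n => u n * v n)
    = (Re \o u) \* (Im \o v) \+ (Im \o u) \* (Re \o v).
  by apply/funext => n /=; case: (u n) (v n) => a b [].
rewrite (_ : Im (z * w) = Re z * Im w + Im z * Re w); last by case: z w {u1 u2 v1 v2} => a b [].
by apply: cvgD; apply: cvgM.
Qed.

Lemma ccvg_cst z : ccvg (fun=> z) z.
Proof. by split; exact: cvg_cst. Qed.

Lemma ccvgD u v z w : ccvg u z -> ccvg v w -> ccvg (fun n => u n + v n) (z + w).
Proof.
move=> [u1 u2] [v1 v2]; split.
  have -> : Re \o (fun n => u n + v n) = (Re \o u) \+ (Re \o v).
    by apply/funext => n /=; case: (u n) (v n) => a b [].
  rewrite (_ : Re (z + w) = Re z + Re w); last by case: z w {u1 u2 v1 v2} => a b [].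
  exact: cvgD.
have -> : Im \o (fun n => u n + v n) = (Im \o u) \+ (Im \o v).
  by apply/funext => n /=; case: (u n) (v n) => a b [].
rewrite (_ : Im (z + w) = Im z + Im w); last by case: z w {u1 u2 v1 v2} => a b [].
exact: cvgD.
Qed.

Lemma cvg_dist0 (u : nat -> R) (l : R) (d : nat -> R) :
  (forall n, `|u n - l| <= d n) -> d @ \oo --> 0 -> u @ \oo --> l.
Proof.
move=> ud d0; apply/(@subr_cvg0 R R^o); apply/(@norm_cvg0P R R^o).
apply: (@squeeze_cvgr _ _ _ _ (fun=> 0) d) => //; last exact: cvg_cst.
by apply: nearW => n; rewrite normr_ge0 ud.
Qed.

Lemma ccvg_cabs u z : (cabs (u n - z) @[n --> \oo] --> 0) <-> ccvg u z.
Proof.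
split=> [u0|[u1 u2]].
  by split; apply: cvg_dist0 u0 => n /=;
    rewrite -?ReB -?ImB ?normr_Re_le ?normr_Im_le.
move/(@subr_cvg0 R R^o) : u1 => /cvg_norm; rewrite normr0 => u1.
move/(@subr_cvg0 R R^o) : u2 => /cvg_norm; rewrite normr0 => u2.
have h : (fun n => `|Re (u n) - Re z| + `|Im (u n) - Im z|) @ \oo --> (0 : R).
  by rewrite -[X in _ --> X](addr0 0); apply: cvgD.
apply: (cvg_dist0 _ h) => n /=.
rewrite subr0 ger0_norm ?cabs_ge0//; apply: le_trans (cabs_le_ReIm _) _.
by rewrite ReB ImB.
Qed.

End Complex_numbers.

(** * Measurability of complex-valued functions and of pointwise limits *)

Section Measurability.
Variable R : realType.
Notation mu := (@lebesgue_measure R).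
Implicit Types (A : set R) (f g : R -> R[i]).

Lemma limn_esup_einf_cvg (u : (\bar R)^nat) (l : \bar R) :
  limn_esup u = l -> limn_einf u = l -> u @ \oo --> l.
Proof.
move=> us ui; apply: (@squeeze_cvge _ _ _ _ (einfs u) _ (esups u)).
- apply: nearW => n; apply/andP; split.
    by apply: ereal_inf_lbound; exists n => /=.
  by apply: ereal_sup_ubound; exists n => /=.
- by rewrite -ui limn_einf_lim; exact: is_cvg_einfs.
- by rewrite -us limn_esup_lim; exact: is_cvg_esups.
Qed.

(* Where the sequence diverges, [limn] takes the constant junk value [point]. *)
Lemma measurable_limn_real A (h : nat -> R -> R) : measurable A ->
  (forall n, measurable_fun A (h n)) ->
  measurable_fun A (fun x : R => limn (fun n => h n x)).
Proof.
move=> mA mh.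
pose s (x : R) : \bar R := limn_esup (fun n => (h n x)%:E).
pose i (x : R) : \bar R := limn_einf (fun n => (h n x)%:E).
have ms : measurable_fun A (fun x => s x).
  by apply: (measurable_fun_limn_esup (f := fun n x => (h n x)%:E)) => n;
    exact/measurable_EFinP.
have mi : measurable_fun A (fun x => i x).
  rewrite (_ : i = (fun x => - limn_esup (fun n => (- h n x)%:E))%E); last first.
    apply/funext => x; rewrite /i -[LHS]oppeK; congr (- _)%E.
    by rewrite -limn_esupN.
  apply: measurableT_comp => //.
  apply: (measurable_fun_limn_esup (f := fun n x => (- h n x)%:E)) => n.
  by apply/measurable_EFinP; apply: measurableT_comp.
have mfs : measurable_fun A (fun x => fine (s x)).
  exact: measurableT_comp.
(* The sequence converges to a real exactly when limsup and liminf agree and are finite. This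
   condition is measurable, so [limn] becomes a measurable case distinction. *)
have E x : limn (fun n => h n x) =
    if (s x == i x) && (s x == (fine (s x))%:E) then fine (s x) else point.
  case: ifPn => [/andP[/eqP si /eqP sfin]|hn].
    apply/cvg_lim => //.
    have := @limn_esup_einf_cvg (fun n => (h n x)%:E) _ sfin.
    by rewrite -/(i x) -si => /(_ sfin) /fine_cvgP[].
  apply: xgetPN => l hl; move/negP: hn; apply.
  have hl' : (h n x)%:E @[n --> \oo] --> l%:E by exact/fine_cvgP/(conj _ hl)/nearW.
  by rewrite /s /i !(cvg_limn_einf_sup hl')/= !eqxx.
rewrite (funext E).
apply: measurable_fun_if => //.
- apply: measurable_and; apply: measurable_fun_eqe => //.
  exact/measurable_EFinP.
- exact: measurable_funS mfs.
Qed.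

Lemma cmeasurableS A B f : measurable B -> A `<=` B ->
  cmeasurable B f -> cmeasurable A f.
Proof. by move=> mB AB [f1 f2]; split; apply: measurable_funS _ AB _. Qed.

Lemma cmeasurable_cst A (z : R[i]) : cmeasurable A (fun=> z).
Proof. by split; exact: measurable_cst. Qed.

Lemma cmeasurableD A f g : cmeasurable A f -> cmeasurable A g ->
  cmeasurable A (fun x => f x + g x).
Proof.
move=> [f1 f2] [g1 g2]; split.
- rewrite (_ : (fun _ => _) = (fun x => Re (f x) + Re (g x))).
    exact: measurable_funD.
  by apply/funext => x; case: (f x) (g x) => a b [].
- rewrite (_ : (fun _ => _) = (fun x => Im (f x) + Im (g x))).
    exact: measurable_funD.
  by apply/funext => x; case: (f x) (g x) => a b [].
Qed.

Lemma cmeasurableM A f g : cmeasurable A f -> cmeasurable A g ->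
  cmeasurable A (fun x => f x * g x).
Proof.
move=> [f1 f2] [g1 g2]; split.
- rewrite (_ : (fun _ => _) = (fun x => Re (f x) * Re (g x) - Im (f x) * Im (g x))).
    by apply: measurable_funB; exact: measurable_funM.
  by apply/funext => x; case: (f x) (g x) => a b [].
- rewrite (_ : (fun _ => _) = (fun x => Re (f x) * Im (g x) + Im (f x) * Re (g x))).
    by apply: measurable_funD; exact: measurable_funM.
  by apply/funext => x; case: (f x) (g x) => a b [].
Qed.

Lemma cmeasurable_conj A f : cmeasurable A f ->
  cmeasurable A (fun x => conjc (f x)).
Proof.
move=> [f1 f2]; split.
- rewrite (_ : (fun _ => _) = (fun x => Re (f x))) //.
  by apply/funext => x; case: (f x).
- rewrite (_ : (fun _ => _) = (fun x => - Im (f x))).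
    exact: measurableT_comp.
  by apply/funext => x; case: (f x).
Qed.

Lemma cmeasurableB A f g : cmeasurable A f -> cmeasurable A g ->
  cmeasurable A (fun x => f x - g x).
Proof.
move=> mf mg; rewrite (_ : (fun _ => _) = (fun x => f x + (- 1) * g x)).
  by apply: cmeasurableD => //; apply: cmeasurableM => //; exact: cmeasurable_cst.
by apply/funext => x; rewrite mulN1r.
Qed.

Lemma cmeasurable_comp A f (h : R -> R) : measurable_fun A h ->
  cmeasurable setT f -> cmeasurable A (fun x => f (h x)).
Proof. by move=> mh [f1 f2]; split; [exact: (measurableT_comp f1 mh)|exact: (measurableT_comp f2 mh)]. Qed.

Lemma measurable_cabs_sqr A f : cmeasurable A f ->
  measurable_fun A (fun x => cabs (f x) ^+ 2).
Proof.
move=> [f1 f2].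
rewrite (_ : (fun _ => _) = (fun x => Re (f x) ^+ 2 + Im (f x) ^+ 2)).
  by apply: measurable_funD; exact: measurable_funX.
by apply/funext => x; rewrite cabs_sqr.
Qed.

Lemma measurable_cabs A f : cmeasurable A f -> measurable_fun A (fun x => cabs (f x)).
Proof.
move=> mf; rewrite (_ : (fun _ => _) = (fun x => Num.sqrt (cabs (f x) ^+ 2))).
  apply: (@measurableT_comp _ _ _ _ _ _ (@Num.sqrt R)); last exact: measurable_cabs_sqr.
  exact: (continuous_measurable_fun (@sqrt_continuous R)).
by apply/funext => x; rewrite sqrtr_sqr ger0_norm// cabs_ge0.
Qed.

Lemma cmeasurable_limn A (u : nat -> R -> R[i]) : measurable A ->
  (forall n, cmeasurable A (u n)) ->
  cmeasurable A (fun x => Complex (limn (fun n => Re (u n x)))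
                                  (limn (fun n => Im (u n x)))).
Proof.
by move=> mA mu; split => /=; apply: measurable_limn_real => // n; case: (mu n).
Qed.

Lemma cmeasurable_cis A (h : R -> R) : measurable_fun A h ->
  cmeasurable A (fun x => cis (h x)).
Proof.
move=> mh; split => /=.
  apply: (@measurableT_comp _ _ _ _ _ _ (@cos R)) => //.
  exact: (continuous_measurable_fun (@continuous_cos R)).
apply: (@measurableT_comp _ _ _ _ _ _ (@sin R)) => //.
exact: (continuous_measurable_fun (@continuous_sin R)).
Qed.

Definition cut A f : R -> R[i] := fun x => if x \in A then f x else 0.

Lemma cutE A f x : A x -> cut A f x = f x.
Proof. by move=> Ax; rewrite /cut mem_set. Qed.

Lemma cutN A f x : ~ A x -> cut A f x = 0.
Proof. by move=> Ax; rewrite /cut memNset. Qed.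

Lemma Re_cut A f : (fun x => Re (cut A f x)) = (fun x => Re (f x)) \_ A.
Proof. by apply/funext => x; rewrite /cut/patch; case: ifP. Qed.

Lemma Im_cut A f : (fun x => Im (cut A f x)) = (fun x => Im (f x)) \_ A.
Proof. by apply/funext => x; rewrite /cut/patch; case: ifP. Qed.

Lemma cmeasurable_cut A f : measurable A -> cmeasurable A f ->
  cmeasurable setT (cut A f).
Proof.
move=> mA [f1 f2]; split; rewrite ?Re_cut ?Im_cut.
  by apply/(measurable_restrict _ mA); rewrite ?setTI.
by apply/(measurable_restrict _ mA); rewrite ?setTI.
Qed.

End Measurability.

Section Almost_everywhere.
Variable R : realType.
Notation mu := (@lebesgue_measure R).

Lemma ae_mono (P Q : R -> Prop) : (forall x, P x -> Q x) ->
  {ae mu, forall x, P x} -> {ae mu, forall x, Q x}.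
Proof. by move=> PQ; apply: (filterS PQ); exact (ae_filter_ringOfSetsType mu). Qed.

Lemma ae_mono2 (P Q S : R -> Prop) : (forall x, P x -> Q x -> S x) ->
  {ae mu, forall x, P x} -> {ae mu, forall x, Q x} -> {ae mu, forall x, S x}.
Proof. by move=> PQ h1 h2; apply: (filterS2 _ PQ h1 h2); exact (ae_filter_ringOfSetsType mu). Qed.

End Almost_everywhere.

(** * Integration of complex-valued functions by components *)

Section Complex_integral.
Variable R : realType.
Notation mu := (@lebesgue_measure R).
Variable A : set R.
Hypothesis mA : measurable A.
Implicit Types (f g : R -> R[i]).

Definition cintegrable f : Prop :=
  mu.-integrable A (EFin \o (fun x => Re (f x))) /\
  mu.-integrable A (EFin \o (fun x => Im (f x))).

Lemma cintegrable_cmeasurable f : cintegrable f -> cmeasurable A f.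
Proof.
by move=> [/measurable_int f1 /measurable_int f2]; split; apply/measurable_EFinP.
Qed.

Lemma cintegrable_le f (h : R -> \bar R) : cmeasurable A f ->
  (forall x, A x -> (cabs (f x))%:E <= h x)%E -> mu.-integrable A h ->
  cintegrable f.
Proof.
move=> [f1 f2] fh ih; split; apply: le_integrable ih => //;
  try exact/measurable_EFinP;
  move=> x Ax /=; apply: (le_trans _ (lee_abs _)); apply: le_trans (fh _ Ax);
  by rewrite lee_fin ?normr_Re_le ?normr_Im_le.
Qed.

Lemma integrable_cabs f : cintegrable f ->
  mu.-integrable A (EFin \o (fun x => cabs (f x))).
Proof.
move=> [i1 i2]; have mf := cintegrable_cmeasurable (conj i1 i2).
have i12 : mu.-integrable A (fun x => `|(Re (f x))%:E| + `|(Im (f x))%:E|)%E.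
  by apply: integrableD => //; exact: integrable_abse.
apply: le_integrable i12 => //.
  by apply/measurable_EFinP; exact: measurable_cabs.
move=> x Ax /=; rewrite lee_fin ger0_norm ?cabs_ge0//.
by apply: le_trans (cabs_le_ReIm _) (ler_norm _).
Qed.

Lemma in_L1P f : in_L1 A f <-> cintegrable f.
Proof.
split=> [[mf foo]|i].
  apply: (@cintegrable_le f (fun x => (cabs (f x))%:E)) => //.
  apply/integrableP; split; first by apply/measurable_EFinP; exact: measurable_cabs.
  apply: le_lt_trans foo; rewrite le_eqVlt; apply/orP; left; apply/eqP; apply: eq_integral => x _ /=.
  by rewrite ger0_norm ?cabs_ge0.
split; first exact: cintegrable_cmeasurable.
have /integrableP[_] := integrable_cabs i; apply: le_lt_trans.
by rewrite le_eqVlt; apply/orP; left; apply/eqP; apply: eq_integral => x _ /=; rewrite ger0_norm ?cabs_ge0.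
Qed.

Lemma cintegrableD f g : cintegrable f -> cintegrable g ->
  cintegrable (fun x => f x + g x).
Proof.
move=> [f1 f2] [g1 g2]; split.
  rewrite (_ : _ \o _ = (EFin \o (fun x => Re (f x))) \+ (EFin \o (fun x => Re (g x))))%E.
    exact: integrableD.
  by apply/funext => x /=; case: (f x) (g x) => a b [].
rewrite (_ : _ \o _ = (EFin \o (fun x => Im (f x))) \+ (EFin \o (fun x => Im (g x))))%E.
  exact: integrableD.
by apply/funext => x /=; case: (f x) (g x) => a b [].
Qed.

Lemma cintegrableM_bounded (k : R -> R[i]) (M : R) f : cmeasurable A k ->
  (forall x, A x -> cabs (k x) <= M) -> cintegrable f ->
  cintegrable (fun x => k x * f x).
Proof.
move=> mk kM i; apply: (@cintegrable_le _ (fun x => M%:E * (cabs (f x))%:E)%E).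
- by apply: cmeasurableM => //; exact: cintegrable_cmeasurable.
- by move=> x Ax; rewrite -EFinM lee_fin cabsM ler_wpM2r ?cabs_ge0 ?kM.
- exact/integrableZl/integrable_cabs.
Qed.

Lemma cintegrableZ (k : R[i]) f : cintegrable f -> cintegrable (fun x => k * f x).
Proof.
apply: (@cintegrableM_bounded (fun=> k) (cabs k)) => //.
Qed.

Lemma cintegrableB f g : cintegrable f -> cintegrable g ->
  cintegrable (fun x => f x - g x).
Proof.
move=> i j; rewrite (_ : (fun _ => _) = (fun x => f x + (-1) * g x)).
  by apply: cintegrableD => //; exact: cintegrableZ.
by apply/funext => x; rewrite mulN1r.
Qed.

Lemma eq_cintegral g f : (forall x, A x -> f x = g x) ->
  cintegral A f = cintegral A g.
Proof.
move=> fg; rewrite /cintegral; congr Complex; apply: eq_Rintegral => x /set_mem Ax;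
  by rewrite fg.
Qed.

Lemma ae_eq_cintegral g f : cmeasurable A f -> cmeasurable A g ->
  {ae mu, forall x, A x -> f x = g x} -> cintegral A f = cintegral A g.
Proof.
move=> [f1 f2] [g1 g2] fg; rewrite /cintegral /Rintegral; congr Complex; congr fine;
  apply: ae_eq_integral => //; try exact/measurable_EFinP;
  by apply: ae_mono fg => x h /h ->.
Qed.

Lemma ae_eq_cintegrable g f : cmeasurable A g ->
  {ae mu, forall x, A x -> f x = g x} -> cintegrable f -> cintegrable g.
Proof.
move=> mg fg i; have mf := cintegrable_cmeasurable i.
apply/in_L1P; move/in_L1P : i => [_ foo]; split => //.
apply: le_lt_trans foo; rewrite le_eqVlt; apply/orP; left; apply/eqP; apply: ae_eq_integral => //.
- by apply/measurable_EFinP; exact: measurable_cabs.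
- by apply/measurable_EFinP; exact: measurable_cabs.
- by apply: ae_mono fg => x h /h ->.
Qed.

Lemma eq_cintegrable g f : (forall x, A x -> f x = g x) ->
  cintegrable f -> cintegrable g.
Proof.
move=> fg [f1 f2]; split; [apply: eq_integrable f1 => //|apply: eq_integrable f2 => //];
  by move=> x /set_mem Ax /=; rewrite fg.
Qed.

Lemma cintegralD f g : cintegrable f -> cintegrable g ->
  cintegral A (fun x => f x + g x) = cintegral A f + cintegral A g.
Proof.
move=> [f1 f2] [g1 g2]; apply/eqP; rewrite eq_complex /=.
rewrite -!RintegralD//; apply/andP; split; apply/eqP; apply: eq_Rintegral => x _;
  by case: (f x) (g x) => a b [].
Qed.

Lemma cintegralZ (k : R[i]) f : cintegrable f ->
  cintegral A (fun x => k * f x) = k * cintegral A f.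
Proof.
move=> [f1 f2]; case: k => u v.
have i1 w : mu.-integrable A (EFin \o (fun x => w * Re (f x))).
  by rewrite (_ : _ \o _ = (fun x => w%:E * (Re (f x))%:E)%E)//; exact: integrableZl.
have i2 w : mu.-integrable A (EFin \o (fun x => w * Im (f x))).
  by rewrite (_ : _ \o _ = (fun x => w%:E * (Im (f x))%:E)%E)//; exact: integrableZl.
apply/eqP; rewrite eq_complex /= -!RintegralZl// -RintegralB// -RintegralD//.
by apply/andP; split; apply/eqP; apply: eq_Rintegral => x _; case: (f x).
Qed.

Lemma cintegralB f g : cintegrable f -> cintegrable g ->
  cintegral A (fun x => f x - g x) = cintegral A f - cintegral A g.
Proof.
move=> i j; rewrite -[- cintegral A g]mulN1r -cintegralZ// -cintegralD//.
  by apply: eq_cintegral => x _; rewrite mulN1r.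
exact: cintegrableZ.
Qed.

Lemma cintegral_conj f : cintegrable f ->
  cintegral A (fun x => conjc (f x)) = conjc (cintegral A f).
Proof.
move=> [f1 f2]; apply/eqP; rewrite eq_complex /=; apply/andP; split; apply/eqP.
  by apply: eq_Rintegral => x _; case: (f x).
rewrite -mulN1r -RintegralZl//.
by apply: eq_Rintegral => x _; case: (f x) => a b /=; rewrite mulN1r.
Qed.

Lemma cintegral_cut f : cintegral setT (cut A f) = cintegral A f.
Proof.
by rewrite /cintegral Re_cut Im_cut -!Rintegral_mkcond.
Qed.

Lemma cdominated_convergence (u : nat -> R -> R[i]) f (h : R -> \bar R) :
  (forall n, cmeasurable A (u n)) -> cmeasurable A f ->
  {ae mu, forall x, A x -> ccvg (fun n => u n x) (f x)} ->
  mu.-integrable A h ->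
  {ae mu, forall x n, A x -> (cabs (u n x))%:E <= h x}%E ->
  cintegrable f /\ ccvg (fun n => cintegral A (u n)) (cintegral A f).
Proof.
move=> mu_ [f1 f2] uf ih uh.
have [iR _ cR] : [/\ mu.-integrable A (EFin \o (fun x => Re (f x))),
    [sequence \int[mu]_(x in A) `|(Re (u n x))%:E - (Re (f x))%:E| ]_n @ \oo --> 0 &
    [sequence \int[mu]_(x in A) (Re (u n x))%:E ]_n @ \oo --> \int[mu]_(x in A) (Re (f x))%:E]%E.
  apply: (@dominated_convergence _ _ _ mu A mA (fun n x => (Re (u n x))%:E) _ h) => //.
  - by move=> n; apply/measurable_EFinP; case: (mu_ n).
  - exact/measurable_EFinP.
  - apply: ae_mono uf => x h' /h' [uR _].
    by apply/fine_cvgP; split => //; exact: nearW.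
  - apply: ae_mono uh => x h' n Ax; apply: le_trans (h' n Ax).
    by rewrite lee_fin normr_Re_le.
have [iI _ cI] : [/\ mu.-integrable A (EFin \o (fun x => Im (f x))),
    [sequence \int[mu]_(x in A) `|(Im (u n x))%:E - (Im (f x))%:E| ]_n @ \oo --> 0 &
    [sequence \int[mu]_(x in A) (Im (u n x))%:E ]_n @ \oo --> \int[mu]_(x in A) (Im (f x))%:E]%E.
  apply: (@dominated_convergence _ _ _ mu A mA (fun n x => (Im (u n x))%:E) _ h) => //.
  - by move=> n; apply/measurable_EFinP; case: (mu_ n).
  - exact/measurable_EFinP.
  - apply: ae_mono uf => x h' /h' [_ uI].
    by apply/fine_cvgP; split => //; exact: nearW.
  - apply: ae_mono uh => x h' n Ax; apply: le_trans (h' n Ax).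
    by rewrite lee_fin normr_Im_le.
split=> //; split => /=.
- apply: fine_cvg; rewrite fineK; first exact: cR.
  exact: integrable_fin_num.
- apply: fine_cvg; rewrite fineK; first exact: cI.
  exact: integrable_fin_num.
Qed.

End Complex_integral.

Lemma cintegrableS (R : realType) (A B : set R) (f : R -> R[i]) :
  measurable A -> measurable B -> A `<=` B -> cintegrable B f -> cintegrable A f.
Proof.
by move=> mA mB AB [f1 f2]; split; [apply: integrableS f1|apply: integrableS f2].
Qed.

Lemma cintegrable_cut (R : realType) (A : set R) (f : R -> R[i]) :
  measurable A -> cintegrable setT (cut A f) <-> cintegrable A f.
Proof.
move=> mA; rewrite /cintegrable Re_cut Im_cut.
have E (r : R -> R) : EFin \o (r \_ A) = (EFin \o r) \_ A.
  by apply/funext => x; rewrite /= /patch; case: ifP.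
have RP := @integrable_mkcond _ _ _ (@lebesgue_measure R) A (EFin \o (fun x => (Re (f x)))) mA.
have IP := @integrable_mkcond _ _ _ (@lebesgue_measure R) A (EFin \o (fun x => (Im (f x)))) mA.
by rewrite !E; split => -[f1 f2]; split; [exact: (RP.2 f1)|exact: (IP.2 f2)|exact: (RP.1 f1)|exact: (IP.1 f2)].
Qed.

(** * The space L^2 *)

Section L2_theory.
Variable R : realType.
Notation mu := (@lebesgue_measure R).
Variable A : set R.
Hypothesis mA : measurable A.
Implicit Types (f g h : R -> R[i]).

Lemma integrableRD (r s : R -> R) : mu.-integrable A (EFin \o r) ->
  mu.-integrable A (EFin \o s) -> mu.-integrable A (EFin \o (fun x => r x + s x)).
Proof. by move=> ir is_; exact: (@integrableD _ _ _ mu A mA _ _ ir is_). Qed.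

Lemma integrableRZ (k : R) (r : R -> R) : mu.-integrable A (EFin \o r) ->
  mu.-integrable A (EFin \o (fun x => k * r x)).
Proof. by move=> ir; exact: (@integrableZl _ _ _ mu A mA k _ ir). Qed.

Lemma sqnorm_ge0 f : (0 <= sqnorm A f)%E.
Proof. by apply: integral_ge0 => x _; rewrite lee_fin sqr_ge0. Qed.

Lemma eq_sqnorm g f : (forall x, A x -> f x = g x) -> sqnorm A f = sqnorm A g.
Proof. by move=> fg; apply: eq_integral => x /set_mem Ax; rewrite fg. Qed.

Lemma ae_eq_sqnorm g f : cmeasurable A f -> cmeasurable A g ->
  {ae mu, forall x, A x -> f x = g x} -> sqnorm A f = sqnorm A g.
Proof.
move=> mf mg fg; apply: ae_eq_integral => //.
- by apply/measurable_EFinP; exact: measurable_cabs_sqr.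
- by apply/measurable_EFinP; exact: measurable_cabs_sqr.
- by apply: ae_mono fg => x h /h ->.
Qed.

Lemma ge0_sqnorm_le f g : cmeasurable A f -> cmeasurable A g ->
  (forall x, A x -> cabs (f x) <= cabs (g x)) -> (sqnorm A f <= sqnorm A g)%E.
Proof.
move=> mf mg fg; apply: ge0_le_integral => //.
- by move=> x _; rewrite lee_fin sqr_ge0.
- by apply/measurable_EFinP; exact: measurable_cabs_sqr.
- by apply/measurable_EFinP; exact: measurable_cabs_sqr.
- by move=> x Ax; rewrite lee_fin ler_pXn2r ?nnegrE ?cabs_ge0 ?fg.
Qed.

Lemma sqnorm_eq0 f : cmeasurable A f -> sqnorm A f = 0%E ->
  {ae mu, forall x, A x -> f x = 0}.
Proof.
move=> mf f0.
have mf2 : measurable_fun A (fun x => (cabs (f x) ^+ 2)%:E).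
  by apply/measurable_EFinP; exact: measurable_cabs_sqr.
have := (ae_eq_integral_abs mu mA mf2).1.
rewrite (_ : integral _ _ _ = 0%E); last first.
  rewrite -[RHS]f0; apply: eq_integral => x _ /=.
  by rewrite ger0_norm// sqr_ge0.
move=> /(_ erefl); apply: ae_mono => x h /h /= [] /eqP.
by rewrite expf_eq0 /= => /eqP /cabs_eq0.
Qed.

Lemma in_L2_integrable f : in_L2 A f ->
  mu.-integrable A (EFin \o (fun x => cabs (f x) ^+ 2)).
Proof.
move=> [mf foo]; apply/integrableP; split.
  by apply/measurable_EFinP; exact: measurable_cabs_sqr.
rewrite (_ : integral _ _ _ = sqnorm A f)//; apply: eq_integral => x _ /=.
by rewrite ger0_norm// sqr_ge0.
Qed.

Lemma in_L2_le f (h : R -> R) : cmeasurable A f ->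
  (forall x, A x -> cabs (f x) ^+ 2 <= h x) -> mu.-integrable A (EFin \o h) ->
  in_L2 A f.
Proof.
move=> mf fh /integrableP[mh hoo]; split => //; apply: le_lt_trans hoo.
apply: ge0_le_integral => //.
- by move=> x _; rewrite lee_fin sqr_ge0.
- by apply/measurable_EFinP; exact: measurable_cabs_sqr.
- exact: measurableT_comp.
- by move=> x Ax; rewrite lee_fin; apply: le_trans (fh x Ax) (ler_norm _).
Qed.

Lemma in_L2D f g : in_L2 A f -> in_L2 A g -> in_L2 A (fun x => f x + g x).
Proof.
move=> f2 g2; apply: (@in_L2_le _ (fun x => 2 * cabs (f x) ^+ 2 + 2 * cabs (g x) ^+ 2)).
- by case: f2 g2 => mf _ [mg _]; exact: cmeasurableD.
- by move=> x Ax; exact: cabsD_sqr.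
- by apply: integrableRD; apply: integrableRZ; exact: in_L2_integrable.
Qed.

Lemma in_L2M_bounded (k : R -> R[i]) (M : R) f : cmeasurable A k ->
  (forall x, A x -> cabs (k x) <= M) -> in_L2 A f ->
  in_L2 A (fun x => k x * f x).
Proof.
move=> mk kM f2; apply: (@in_L2_le _ (fun x => M ^+ 2 * cabs (f x) ^+ 2)).
- by case: f2 => mf _; exact: cmeasurableM.
- move=> x Ax; rewrite cabsM exprMn ler_wpM2r ?sqr_ge0//.
  have kMx := kM _ Ax.
  by rewrite ler_pXn2r ?nnegrE ?cabs_ge0// (le_trans _ kMx)// cabs_ge0.
- by apply: integrableRZ; exact: in_L2_integrable.
Qed.

Lemma in_L2Z (k : R[i]) f : in_L2 A f -> in_L2 A (fun x => k * f x).
Proof. by apply: (@in_L2M_bounded (fun=> k) (cabs k)) => //; exact: cmeasurable_cst. Qed.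

Lemma in_L2B f g : in_L2 A f -> in_L2 A g -> in_L2 A (fun x => f x - g x).
Proof.
move=> f2 g2; rewrite (_ : (fun _ => _) = (fun x => f x + (-1) * g x)).
  by apply: in_L2D => //; exact: in_L2Z.
by apply/funext => x; rewrite mulN1r.
Qed.

Lemma in_L20 : in_L2 A (fun=> 0).
Proof.
split; first exact: cmeasurable_cst.
rewrite (_ : sqnorm _ _ = 0%E) ?ltry//; apply: integral0_eq => x _.
by rewrite cabs0 expr0n.
Qed.

Lemma in_L2_conj f : in_L2 A f -> in_L2 A (fun x => conjc (f x)).
Proof.
move=> f2; apply: (@in_L2_le _ (fun x => cabs (f x) ^+ 2)).
- by case: f2 => mf _; exact: cmeasurable_conj.
- by move=> x Ax; rewrite cabs_conj.
- exact: in_L2_integrable.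
Qed.

Lemma ae_eq_in_L2 g f : cmeasurable A g -> {ae mu, forall x, A x -> f x = g x} ->
  in_L2 A f -> in_L2 A g.
Proof. by move=> mg fg [mf foo]; split => //; rewrite -(ae_eq_sqnorm mf mg fg). Qed.

Lemma cintegrable_dot f g : in_L2 A f -> in_L2 A g ->
  cintegrable A (fun x => f x * conjc (g x)).
Proof.
move=> f2 g2.
apply: (@cintegrable_le _ _ mA _ (EFin \o (fun x => cabs (f x) ^+ 2 + cabs (g x) ^+ 2))).
- by case: f2 g2 => mf _ [mg _]; apply: cmeasurableM => //; exact: cmeasurable_conj.
- move=> x Ax; rewrite lee_fin cabsM cabs_conj; apply: le_trans (cabsMV_sqr _ _).
  by rewrite ler_peMl ?mulr_ge0 ?cabs_ge0// ler1n.
- by apply: integrableRD; exact: in_L2_integrable.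
Qed.

(** The squared norm as a real number. Since [fine] sends an infinite value to 0, it is meaningful
    only when [sqnorm] is finite. *)
Definition nrm2 f : R := fine (sqnorm A f).

Lemma nrm2E f : in_L2 A f -> sqnorm A f = (nrm2 f)%:E.
Proof. by move=> [_ foo]; rewrite fineK// ge0_fin_numE ?sqnorm_ge0. Qed.

Lemma nrm2_ge0 f : 0 <= nrm2 f.
Proof. by rewrite fine_ge0 ?sqnorm_ge0. Qed.

Lemma L2dotxx f : L2dot A f f = real_complex R (nrm2 f).
Proof.
apply/eqP; rewrite eq_complex /=; apply/andP; split; apply/eqP.
  by apply: eq_Rintegral => x _; rewrite mulc_conj.
rewrite (@eq_Rintegral _ _ _ mu A (fun=> 0)); last by move=> x _; rewrite mulc_conj.
by rewrite (@Rintegral_cst _ _ _ mu A mA) mul0r.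
Qed.

Lemma L2dotDl f g h : in_L2 A f -> in_L2 A g -> in_L2 A h ->
  L2dot A (fun x => f x + g x) h = L2dot A f h + L2dot A g h.
Proof.
move=> f2 g2 h2; rewrite /L2dot -cintegralD//; try exact: cintegrable_dot.
by apply: eq_cintegral => x _; rewrite mulrDl.
Qed.

Lemma L2dotZl (k : R[i]) f h : in_L2 A f -> in_L2 A h ->
  L2dot A (fun x => k * f x) h = k * L2dot A f h.
Proof.
move=> f2 h2; rewrite /L2dot -cintegralZ//; last exact: cintegrable_dot.
by apply: eq_cintegral => x _; rewrite mulrA.
Qed.

Lemma L2dot_conj f g : in_L2 A f -> in_L2 A g -> L2dot A g f = conjc (L2dot A f g).
Proof.
move=> f2 g2; rewrite /L2dot -cintegral_conj//; last exact: cintegrable_dot.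
apply: eq_cintegral => x _.
by case: (f x) (g x) => a b [c d] /=; congr Complex; ring.
Qed.

Lemma L2dotBl f g h : in_L2 A f -> in_L2 A g -> in_L2 A h ->
  L2dot A (fun x => f x - g x) h = L2dot A f h - L2dot A g h.
Proof.
move=> f2 g2 h2; rewrite -[- L2dot A g h]mulN1r -L2dotZl// -L2dotDl//; last exact: in_L2Z.
by apply: eq_cintegral => x _; rewrite mulN1r.
Qed.

Lemma L2dotDr f g h : in_L2 A f -> in_L2 A g -> in_L2 A h ->
  L2dot A h (fun x => f x + g x) = L2dot A h f + L2dot A h g.
Proof.
move=> f2 g2 h2; rewrite (@L2dot_conj (fun x => f x + g x) h)//; last exact: in_L2D.
rewrite L2dotDl// (@L2dot_conj f h)// (@L2dot_conj g h)//.
by case: (L2dot A f h) (L2dot A g h) => a b [c d] /=; rewrite opprD.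
Qed.

Lemma L2dotZr (k : R[i]) f h : in_L2 A f -> in_L2 A h ->
  L2dot A h (fun x => k * f x) = conjc k * L2dot A h f.
Proof.
move=> f2 h2; rewrite (@L2dot_conj (fun x => k * f x) h)//; last exact: in_L2Z.
rewrite L2dotZl// (@L2dot_conj f h)//.
by case: (L2dot A f h) k => a b [c d] /=; congr Complex; ring.
Qed.

Lemma nrm2D f g : in_L2 A f -> in_L2 A g ->
  nrm2 (fun x => f x + g x) = nrm2 f + nrm2 g + 2 * Re (L2dot A f g).
Proof.
move=> f2 g2; have fg2 := in_L2D f2 g2.
have : real_complex R (nrm2 (fun x => f x + g x)) =
    real_complex R (nrm2 f) + real_complex R (nrm2 g) + (L2dot A f g + conjc (L2dot A f g)).
  rewrite -!L2dotxx L2dotDl// !L2dotDr// -L2dot_conj//; ring.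
case: (L2dot A f g) => a b /eqP; rewrite eq_complex /= => /andP[/eqP -> _]; ring.
Qed.

Lemma nrm2Z (k : R[i]) f : in_L2 A f -> nrm2 (fun x => k * f x) = cabs k ^+ 2 * nrm2 f.
Proof.
move=> f2; have kf2 := in_L2Z k f2.
have : real_complex R (nrm2 (fun x => k * f x)) =
    real_complex R (cabs k ^+ 2) * real_complex R (nrm2 f).
  by rewrite -!L2dotxx L2dotZl// L2dotZr// mulrA mulc_conj.
by move=> /eqP; rewrite eq_complex /= => /andP[/eqP -> _]; ring.
Qed.

(** Discriminant argument: the real quadratic t -> ||t f + g||^2 is nonnegative. A real parameter t
    sees only the real part of the product. *)
Lemma sqr_Re_L2dot_le f g : in_L2 A f -> in_L2 A g ->
  Re (L2dot A f g) ^+ 2 <= nrm2 f * nrm2 g.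
Proof.
move=> f2 g2; set r := Re _.
have h (t : R) : 0 <= t ^+ 2 * nrm2 f + nrm2 g + 2 * (t * r).
  have tf2 := in_L2Z (real_complex R t) f2.
  have := nrm2_ge0 (fun x => real_complex R t * f x + g x).
  rewrite nrm2D// nrm2Z// L2dotZl// cabs_sqr [Re (real_complex R t)]/= [Im (real_complex R t)]/= expr0n addr0.
  suff -> : Re (real_complex R t * L2dot A f g) = t * r by [].
  by rewrite /r; case: (L2dot A f g) => a b /=; ring.
have [f0|f0] := eqVneq (nrm2 f) 0.
  rewrite f0 mul0r; have [->|r0] := eqVneq r 0; first by rewrite expr0n.
  (* When f has norm 0 the quadratic is affine in t, and this t would give it the value -1. *)
  have := h (- (nrm2 g + 1) / (2 * r)); rewrite f0 mulr0 add0r.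
  rewrite (_ : 2 * _ = - (nrm2 g + 1)); last by field.
  lra.
have fp : 0 < nrm2 f by rewrite lt_def f0 nrm2_ge0.
(* The minimum of the quadratic. *)
have := h (- r / nrm2 f).
rewrite (_ : _ + _ = nrm2 g - r ^+ 2 / nrm2 f); last by field.
by rewrite subr_ge0 ler_pdivrMr// mulrC.
Qed.

Lemma normr_Re_L2dot_le f g : in_L2 A f -> in_L2 A g ->
  `|Re (L2dot A f g)| <= Num.sqrt (nrm2 f) * Num.sqrt (nrm2 g).
Proof.
move=> f2 g2; rewrite -sqrtrM ?nrm2_ge0// -sqrtr_sqr.
by rewrite ler_wsqrtr// sqr_Re_L2dot_le.
Qed.

(** A factor i in the second argument multiplies the product by -i, so facts about real parts also
    serve for imaginary parts. *)
Lemma Im_L2dot f g : in_L2 A f -> in_L2 A g ->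
  Im (L2dot A f g) = Re (L2dot A f (fun x => Complex 0 1 * g x)).
Proof.
move=> f2 g2; rewrite L2dotZr//.
by case: (L2dot A f g) => a b /=; ring.
Qed.

Lemma L2cvgP (u : nat -> R -> R[i]) g : (forall k, in_L2 A (u k)) -> in_L2 A g ->
  L2cvg A u g <-> (fun k => nrm2 (fun x => u k x - g x)) @ \oo --> 0.
Proof.
move=> u2 g2; rewrite /L2cvg; split=> [|h].
  by move=> /fine_cvgP[].
rewrite (_ : (fun _ => _) = (fun k => (nrm2 (fun x => u k x - g x))%:E)).
  by apply/fine_cvgP; split => //; exact: nearW.
by apply/funext => k; rewrite -nrm2E//; exact: in_L2B.
Qed.

Lemma Re_L2dot_cvg (u : nat -> R -> R[i]) g h :
  (forall k, in_L2 A (u k)) -> in_L2 A g -> in_L2 A h -> L2cvg A u g ->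
  (fun k => Re (L2dot A (u k) h)) @ \oo --> Re (L2dot A g h).
Proof.
move=> u2 g2 h2 /(L2cvgP u2 g2) ug.
pose d k := nrm2 (fun x => u k x - g x).
apply: (@cvg_dist0 _ _ _ (fun k => Num.sqrt (d k) * Num.sqrt (nrm2 h))) => [k|].
  apply: le_trans (normr_Re_L2dot_le (in_L2B (u2 k) g2) h2).
  by rewrite L2dotBl// ReB.
rewrite -[X in _ --> X](mul0r (Num.sqrt (nrm2 h))); apply: cvgM; last exact: cvg_cst.
rewrite -sqrtr0; apply: continuous_cvg ug; exact: sqrt_continuous.
Qed.

Lemma L2dot_cvg (u : nat -> R -> R[i]) g h :
  (forall k, in_L2 A (u k)) -> in_L2 A g -> in_L2 A h -> L2cvg A u g ->
  ccvg (fun k => L2dot A (u k) h) (L2dot A g h).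
Proof.
move=> u2 g2 h2 ug; split; first exact: Re_L2dot_cvg.
rewrite Im_L2dot// (_ : _ \o _ = fun k => Re (L2dot A (u k) (fun x => Complex 0 1 * h x))).
  by apply: Re_L2dot_cvg => //; exact: in_L2Z.
by apply/funext => k; rewrite /comp Im_L2dot.
Qed.

(** Splitting u_k as (u_k - g) + g leaves, besides a term that tends to 0, only a product with the
    fixed function g, which is continuous. *)
Lemma nrm2_cvg (u : nat -> R -> R[i]) g :
  (forall k, in_L2 A (u k)) -> in_L2 A g -> L2cvg A u g ->
  (fun k => nrm2 (u k)) @ \oo --> nrm2 g.
Proof.
move=> u2 g2 ug; have ug0 := (L2cvgP u2 g2).1 ug.
have E k : nrm2 (u k) =
    nrm2 (fun x => u k x - g x) + (2 * Re (L2dot A (u k) g) - nrm2 g).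
  have b2 := in_L2B (u2 k) g2.
  have -> : u k = (fun x => (u k x - g x) + g x) by apply/funext => x; rewrite subrK.
  rewrite [LHS](nrm2D b2 g2) (L2dotDl b2 g2 g2) L2dotxx.
  rewrite (_ : (fun x => u k x - g x + g x - g x) = (fun x => u k x - g x)); last first.
    by apply/funext => x; rewrite addrK.
  case: (L2dot A _ g) => a b /=; ring.
rewrite (funext E) -[X in _ --> X](add0r (nrm2 g)); apply: cvgD => //.
rewrite [X in _ --> X](_ : nrm2 g = 2 * nrm2 g - nrm2 g); last by ring.
apply: cvgB; last exact: cvg_cst.
apply: cvgM; first exact: cvg_cst.
by have := Re_L2dot_cvg u2 g2 g2 ug; rewrite L2dotxx.
Qed.

(** Lower semicontinuity of the norm under pointwise convergence. It turns a bound on u_m - u_k, for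
    all large k, into a bound on the distance from u_m to the limit. *)
Lemma fatou_sqnorm (v : nat -> R -> R[i]) f (e : \bar R) :
  (forall n, cmeasurable A (v n)) -> cmeasurable A f ->
  {ae mu, forall x, A x -> ccvg (fun n => v n x) (f x)} ->
  (\forall n \near \oo, (sqnorm A (v n) <= e)%E) -> (sqnorm A f <= e)%E.
Proof.
move=> mv mf vf ve.
have mv2 n : measurable_fun A (fun x => (cabs (v n x) ^+ 2)%:E).
  by apply/measurable_EFinP; exact: measurable_cabs_sqr.
rewrite (_ : sqnorm A f =
    \int[mu]_(x in A) limn_einf (fun n => (cabs (v n x) ^+ 2)%:E))%E; last first.
  apply: ae_eq_integral => //.
  - by apply/measurable_EFinP; exact: measurable_cabs_sqr.
  - rewrite (_ : (fun _ => _) =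
      (fun x => - limn_esup (fun n => (- cabs (v n x) ^+ 2)%:E))%E); last first.
      apply/funext => x; rewrite -[LHS]oppeK; congr (- _)%E.
      by rewrite -limn_esupN.
    apply: measurableT_comp => //.
    apply: (measurable_fun_limn_esup (f := fun n x => (- cabs (v n x) ^+ 2)%:E)) => n.
    by apply/measurable_EFinP; apply: measurableT_comp => //; exact: measurable_cabs_sqr.
  - apply: ae_mono vf => x h Ax; have [h1 h2] := h Ax; apply/esym.
    suff /cvg_limn_einf_sup[->] : (cabs (v n x) ^+ 2)%:E @[n --> \oo] --> (cabs (f x) ^+ 2)%:E by [].
    apply/fine_cvgP; split; first exact: nearW.
    rewrite cabs_sqr (_ : _ \o _ = (fun n => Re (v n x) ^+ 2 + Im (v n x) ^+ 2)); last first.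
      by apply/funext => n /=; rewrite cabs_sqr.
    by apply: cvgD; apply: cvgM.
apply: le_trans (fatou mu mA mv2 _) _.
  by move=> n x _; rewrite lee_fin sqr_ge0.
rewrite limn_einf_lim; apply: lime_le; first exact: is_cvg_einfs.
apply: nearW => n; case: ve => N _ ve.
apply: le_trans (ve (maxn n N) _); last by rewrite /= leq_maxr.
by apply: ereal_inf_lbound; exists (maxn n N) => //=; rewrite leq_maxl.
Qed.

Lemma L2cvg_dominated (u : nat -> R -> R[i]) f :
  (forall n, cmeasurable A (u n)) -> in_L2 A f ->
  (forall x, A x -> ccvg (fun n => u n x) (f x)) ->
  (forall n x, A x -> cabs (u n x) <= cabs (f x)) -> L2cvg A u f.
Proof.
move=> mu_ f2 uf ubf; have mf := f2.1.
have m1 n : measurable_fun A (fun x => (cabs (u n x - f x) ^+ 2)%:E).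
  by apply/measurable_EFinP; apply: measurable_cabs_sqr; exact: cmeasurableB.
have m0 : measurable_fun A (fun=> 0%E : \bar R) by exact: measurable_cst.
have c0 : {ae mu, forall x, A x ->
    (cabs (u n x - f x) ^+ 2)%:E @[n --> \oo] --> (0%E : \bar R)}.
  apply: aeW => x Ax; apply/fine_cvgP; split; first exact: nearW.
  rewrite /= -[X in _ --> X](mulr0 (0 : R)).
  by apply: cvgM; apply/ccvg_cabs; exact: uf.
(* The dominating function comes from |u_n - f|^2 <= 2 |u_n|^2 + 2 |f|^2 <= 4 |f|^2. *)
have i4 : mu.-integrable A (EFin \o (fun x => 4 * cabs (f x) ^+ 2)).
  by apply: integrableRZ; exact: in_L2_integrable.
have d4 : {ae mu, forall x n, A x ->
    (`|(cabs (u n x - f x) ^+ 2)%:E| <= (EFin \o (fun x => 4 * cabs (f x) ^+ 2)%R) x)%E}.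
  apply: aeW => x n Ax; rewrite gee0_abs ?lee_fin ?sqr_ge0//.
  apply: le_trans (cabsD_sqr (u n x) (- f x)) _; rewrite [cabs (- f x)]normcN -/(cabs (f x)).
  have : cabs (u n x) ^+ 2 <= cabs (f x) ^+ 2.
    by rewrite ler_pXn2r ?nnegrE ?cabs_ge0 ?ubf.
  by lra.
have [_ _] := @dominated_convergence _ _ _ mu A mA _ _ _ m1 m0 c0 i4 d4.
by rewrite integral0.
Qed.

End L2_theory.

(** * Completeness of L^2 *)

Section Completeness.
Variable R : realType.
Notation mu := (@lebesgue_measure R).

Lemma sum_half_le (n : nat) : \sum_(0 <= j < n) (2^-1 : R) ^+ j <= 2.
Proof.
suff -> : \sum_(0 <= j < n) (2^-1 : R) ^+ j = 2 - 2 * 2^-1 ^+ n.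
  by rewrite lerBlDr lerDl mulr_ge0 ?exprn_ge0 ?invr_ge0.
elim: n => [|n ih]; first by rewrite big_nil expr0; ring.
by rewrite big_nat_recr//= ih exprS; field.
Qed.

(* AM-GM: [|d| <= 1/p + p d^2] with [p = 2^j]. *)
Lemma cvg_weighted_increments (v : nat -> R) (M : R) :
  (forall n, \sum_(0 <= j < n) 2 ^+ j * (v j.+1 - v j) ^+ 2 <= M) -> cvgn v.
Proof.
move=> vM; pose d j := v j.+1 - v j.
have E : v = (fun n => series d n + v 0%N).
  apply/funext; elim => [|n ih]; first by rewrite /series /= big_nil add0r.
  by rewrite /series /= big_nat_recr//= addrAC -/(series d n) -ih /d subrKC.
rewrite E; apply: is_cvgD; last exact: is_cvg_cst.
apply: normed_cvg; apply: nondecreasing_is_cvgn.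
  by apply/nondecreasing_seqP => n; rewrite /series /= [leRHS]big_nat_recr//= lerDl.
exists (2 + M) => _ [n _ <-]; rewrite /series /=.
apply: le_trans (lerD (sum_half_le n) (vM n)); rewrite -big_split /=.
apply: ler_sum => j _; rewrite -/(d j) exprVn; set p := 2 ^+ j.
have p0 : 0 < p by rewrite exprn_gt0.
have : 0 <= p * (`|d j| - p^-1) ^+ 2 by rewrite mulr_ge0 ?sqr_ge0 ?ltW.
rewrite sqrrB real_normK ?num_real// mulrDr mulrBr.
rewrite (_ : p * (`|d j| * p^-1 *+ 2) = 2 * `|d j|); last first.
  by rewrite -mulr_natl; field; rewrite gt_eqF.
rewrite (_ : p * p^-1 ^+ 2 = p^-1); last by field; rewrite gt_eqF.
have := normr_ge0 (d j); lra.
Qed.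

(** Along a subsequence whose consecutive squared distances are at most 4^-j, the sum of the 2^j
    |d_j|^2 has a finite integral, hence is finite almost everywhere; there the subsequence
    converges. Fatou's lemma gives convergence of the whole sequence in norm. *)
Theorem L2_complete (A : set R) (u : nat -> R -> R[i]) : measurable A ->
  (forall n, in_L2 A (u n)) ->
  (forall e : R, 0 < e -> exists K : nat, forall m n, (K <= m)%N -> (K <= n)%N ->
    nrm2 A (fun x => u m x - u n x) < e) ->
  exists2 g, in_L2 A g & L2cvg A u g.
Proof.
move=> mA u2 cauchy.
have /choice[K HK] : forall j : nat, exists K : nat, forall m n, (K <= m)%N ->
    (K <= n)%N -> nrm2 A (fun x => u m x - u n x) < (4^-1 : R) ^+ j.
  by move=> j; apply: cauchy; rewrite exprn_gt0 ?invr_gt0.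
(* The chosen ranks K need not increase. Their cumulative sums do, and adding j also gives k j >=
   j. *)
pose s j := (\sum_(0 <= i < j.+1) K i)%N; pose k j := (j + s j)%N.
have Kk j : (K j <= k j)%N by rewrite /k /s big_nat_recr//= addnA leq_addl.
have kS j : (k j <= k j.+1)%N.
  by apply: leq_add; rewrite // /s [leqRHS]big_nat_recr//= leq_addr.
have jk j : (j <= k j)%N by rewrite leq_addr.
pose d j x := u (k j.+1) x - u (k j) x.
have d2 j : in_L2 A (d j) by exact: in_L2B.
have nd j : nrm2 A (d j) <= (4^-1) ^+ j.
  by apply/ltW/HK => //; exact: leq_trans (Kk j) (kS j).
pose w j x := (2 ^+ j * cabs (d j x) ^+ 2)%:E : \bar R.
have mw j : measurable_fun A (w j).
  apply/measurable_EFinP; apply: measurable_funM; first exact: measurable_cst.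
  by apply: measurable_cabs_sqr; case: (d2 j).
have w0 j x : A x -> (0 <= w j x)%E.
  move=> _; rewrite /w lee_fin; apply: mulr_ge0; [exact: exprn_ge0|exact: sqr_ge0].
pose H x := (\sum_(j <oo) w j x)%E.
have mH : measurable_fun A (fun x => H x).
  by apply: (@ge0_emeasurable_sum _ _ _ A w xpredT) => [j x Ax _|j _]; [exact: w0|exact: mw].
have H0 x : A x -> (0 <= H x)%E by move=> Ax; apply: nneseries_ge0 => j _ _; exact: w0.
(* The j-th term has integral at most 2^j 4^-j = 2^-j. *)
have iH : mu.-integrable A (fun x => H x).
  apply/integrableP; split => //.
  rewrite (_ : integral _ _ _ = \int[mu]_(x in A) H x)%E; last first.
    by apply: eq_integral => x /set_mem Ax; rewrite gee0_abs// H0.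
  rewrite /H integral_nneseries//.
  apply: (@le_lt_trans _ _ 2%:E); last exact: ltry.
  apply: lime_le.
    by apply: is_cvg_nneseries => j _ _; apply: integral_ge0 => x; exact: w0.
  apply: nearW => n.
  apply: (@le_trans _ _ (\sum_(0 <= j < n) ((2^-1 : R) ^+ j)%:E)%E).
    apply: lee_sum => j _.
    rewrite (_ : integral _ _ _ = \int[mu]_(x in A) ((2 ^+ j)%:E * (cabs (d j x) ^+ 2)%:E))%E//.
    have m1 : measurable_fun A (fun x => (cabs (d j x) ^+ 2)%:E).
      by apply/measurable_EFinP; exact: (measurable_cabs_sqr (d2 j).1).
    have p1 x : A x -> (0 <= (cabs (d j x) ^+ 2)%:E)%E by move=> _; rewrite lee_fin sqr_ge0.
    have p2 : (0 <= (2 ^+ j : R)%:E)%E by rewrite lee_fin exprn_ge0.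
    rewrite (@ge0_integralZl _ _ _ mu A mA _ m1 _ p1 p2).
    rewrite -/(sqnorm A (d j)) nrm2E// -EFinM lee_fin.
    have -> : (2^-1 : R) ^+ j = 2 ^+ j * 4^-1 ^+ j by rewrite -exprMn; congr (_ ^+ _); field.
    by rewrite ler_wpM2l ?exprn_ge0.
  by rewrite sumEFin lee_fin sum_half_le.
pose g x : R[i] := Complex (limn (fun n => Re (u (k n) x))) (limn (fun n => Im (u (k n) x))).
have mg : cmeasurable A g by apply: cmeasurable_limn => // n; case: (u2 (k n)).
have ug : {ae mu, forall x, A x -> ccvg (fun n => u (k n) x) (g x)}.
  apply: ae_mono (@integrable_ae _ _ _ mu A mA _ iH) => x Hx Ax.
  have Hfin := Hx Ax.
  have Hle n : \sum_(0 <= j < n) 2 ^+ j * cabs (d j x) ^+ 2 <= fine (H x).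
    rewrite -lee_fin fineK// -sumEFin.
    by apply: nneseries_lim_ge => j _ _; exact: w0.
  have cRe : cvgn (fun n => Re (u (k n) x)).
    apply: (@cvg_weighted_increments _ (fine (H x))) => n.
    apply: le_trans (Hle n); apply: ler_sum => j _.
    by rewrite ler_wpM2l ?exprn_ge0// -ReB -/(d j x) cabs_sqr lerDl sqr_ge0.
  have cIm : cvgn (fun n => Im (u (k n) x)).
    apply: (@cvg_weighted_increments _ (fine (H x))) => n.
    apply: le_trans (Hle n); apply: ler_sum => j _.
    by rewrite ler_wpM2l ?exprn_ge0// -ImB -/(d j x) cabs_sqr lerDr sqr_ge0.
  by split.
have fat (e : R) : 0 < e -> exists N : nat, forall m, (N <= m)%N ->
    (sqnorm A (fun x => (u m x - g x)%R) <= e%:E)%E.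
  move=> e0; have [N hN] := cauchy e e0; exists N => m Nm.
  apply: (@fatou_sqnorm _ _ mA (fun n x => u m x - u (k n) x)).
  - by move=> n; apply: cmeasurableB; [case: (u2 m)|case: (u2 (k n))].
  - by apply: cmeasurableB => //; case: (u2 m).
  - apply: ae_mono ug => x h Ax.
    have := ccvgD (ccvg_cst (u m x)) (ccvgM (ccvg_cst (-1)) (h Ax)).
    rewrite mulN1r; congr (ccvg _ _).
    by apply/funext => n; rewrite mulN1r.
  - exists N => // n Nn; rewrite nrm2E//; last exact: in_L2B.
    by rewrite lee_fin ltW// hN// (leq_trans Nn).
have g2 : in_L2 A g.
  have [N hN] := fat 1 ltr01.
  have hh : in_L2 A (fun x => u N x - g x).
    split; first by apply: cmeasurableB => //; case: (u2 N).
    by apply: le_lt_trans (hN N (leqnn N)) _; exact: ltry.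
  have := in_L2B mA (u2 N) hh; congr (in_L2 _ _).
  by apply/funext => x; rewrite subKr.
exists g => //; apply/(L2cvgP mA u2 g2).
apply/cvgrPdist_le => e e0; have [N hN] := fat e e0.
exists N => // m Nm /=; rewrite sub0r normrN ger0_norm ?nrm2_ge0//.
by rewrite -lee_fin -nrm2E ?hN//; exact: in_L2B.
Qed.

End Completeness.

Section Cut.
Variable R : realType.
Implicit Types (A B : set R) (f g : R -> R[i]).

Lemma sqnorm_cut A f : sqnorm setT (cut A f) = sqnorm A f.
Proof.
rewrite /sqnorm [RHS]integral_mkcond; apply: eq_integral => x _.
by rewrite /cut /patch; case: ifP => // _; rewrite cabs0 expr0n.
Qed.

Lemma in_L2_cut A f : measurable A -> in_L2 A f -> in_L2 setT (cut A f).
Proof. by move=> mA [mf foo]; split; [exact: cmeasurable_cut|rewrite sqnorm_cut]. Qed.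

Lemma sqnorm_subset A B f : measurable A -> measurable B -> A `<=` B ->
  cmeasurable B f -> (sqnorm A f <= sqnorm B f)%E.
Proof.
move=> mA mB AB mf; apply: ge0_subset_integral => //.
  by apply/measurable_EFinP; exact: measurable_cabs_sqr.
by move=> x _; rewrite lee_fin sqr_ge0.
Qed.

Lemma in_L2S A B f : measurable A -> measurable B -> A `<=` B ->
  in_L2 B f -> in_L2 A f.
Proof.
move=> mA mB AB [mf foo]; split; first exact: cmeasurableS mB AB mf.
by apply: le_lt_trans foo; exact: sqnorm_subset.
Qed.

Lemma in_L2_cintegrable A f : measurable A -> (@lebesgue_measure R A < +oo)%E ->
  in_L2 A f -> cintegrable A f.
Proof.
move=> mA mAoo f2.
apply: (@cintegrable_le _ _ mA _ (EFin \o (fun x => cabs (f x) ^+ 2 + 1))).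
- by case: f2.
- by move=> x _; rewrite lee_fin; have := sqr_ge0 (cabs (f x) - 1); have := cabs_ge0 (f x); nra.
- apply: integrableRD => //; first exact: in_L2_integrable.
  apply/integrableP; split; first exact: measurable_cst.
  rewrite /= (@integral_cst _ _ _ (@lebesgue_measure R) A mA).
  by rewrite normr1 mul1e.
Qed.

End Cut.

(** * Changes of variables and periodization *)

Section Affine_change_of_variable.
Variable R : realType.
Notation mu := (@lebesgue_measure R).

Definition affine (k c : R) (x : measurableTypeR R) : measurableTypeR R := k * (x : R) + c.

Lemma measurable_affine (k c : R) : measurable_fun [set: R] (fun x : R => k * x + c).
Proof.
by apply: measurable_funD; [apply: measurable_funM|]; rewrite //; exact: measurable_cst.
Qed.

(** The image measure, scaled by k, gives every interval ]a, b] its length, and Lebesgue measure is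
    the only measure that does. *)
Lemma lebesgue_measure_affine (k c : R) (A : set R) : 0 < k -> measurable A ->
  mu (affine k c @^-1` A) = ((k^-1)%:E * mu A)%E.
Proof.
move=> k0 mA; have k0' := ltW k0.
have mphi : measurable_fun [set: measurableTypeR R] (affine k c) := measurable_affine k c.
pose P := measure_function_pushforward__canonical__measure_function_Measure mu mphi.
suff h : mu A = mscale (NngNum k0') P A.
  by rewrite h /mscale /= muleA -EFinM mulVf ?mul1e// gt_eqF.
refine (@lebesgue_measure_unique R (mscale (NngNum k0') P) _ A mA) => /= _ [[a b]] _ <-.
rewrite /mscale /= /pushforward.
have -> : affine k c @^-1` `]a, b] = `](a - c) / k, (b - c) / k]%classic.
  apply/seteqP; split=> x /=; rewrite !in_itv/= /affine ltr_pdivrMr// ler_pdivlMr// ltrBlDr lerBrDr mulrC;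
  by [].
rewrite !lebesgue_measure_itv/= !lte_fin ltr_pM2r ?invr_gt0// ltrD2r.
case: ifPn => _; last by rewrite mule0.
by rewrite -!EFinB -EFinM; congr (_%:E); field; rewrite gt_eqF.
Qed.

Lemma ge0_integral_affine (k c : R) (A : set R) (f : R -> \bar R) : 0 < k ->
  measurable A -> measurable_fun A f -> (forall x, A x -> 0 <= f x)%E ->
  (\int[mu]_(x in affine k c @^-1` A) f (k * x + c)%R = (k^-1)%:E * \int[mu]_(x in A) f x)%E.
Proof.
move=> k0 mA mf f0.
have k0' : 0 <= k^-1 by rewrite invr_ge0 ltW.
have mphi : measurable_fun [set: measurableTypeR R] (affine k c) := measurable_affine k c.
pose P := measure_function_pushforward__canonical__measure_function_Measure mu mphi.
have h1 := @ge0_integral_pushforward _ _ _ (measurableTypeR R) R (affine k c)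
  mphi mu A f mA mf.
have h2 := @ge0_integral_mscale _ _ _ mu A mA (NngNum k0') f mf f0.
rewrite -h2 -h1; last by move=> x /set_mem; exact: f0.
apply/esym.
refine (@eq_measure_integral _ (measurableTypeR R) R A P (mscale (NngNum k0') mu) f _) => B mB BA.
by apply/esym; exact: lebesgue_measure_affine.
Qed.

Lemma preimage_affine_setT (k c : R) : affine k c @^-1` setT = setT.
Proof. by rewrite preimage_setT. Qed.

Lemma ge0_integralT_affine (k c : R) (f : R -> \bar R) : 0 < k ->
  measurable_fun setT f -> (forall x, 0 <= f x)%E ->
  (\int[mu]_x f (k * x + c)%R = (k^-1)%:E * \int[mu]_x f x)%E.
Proof. by move=> k0 mf f0; rewrite -(@ge0_integral_affine k c setT). Qed.

Lemma Rintegral_affine (k c : R) (f : R -> R) : 0 < k ->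
  mu.-integrable setT (EFin \o f) ->
  mu.-integrable setT (EFin \o (fun x => f (k * x + c))) /\
  \int[mu]_x f (k * x + c) = k^-1 * \int[mu]_x f x.
Proof.
move=> k0 /[dup] fi /integrableP[mf foo].
split.
  apply/integrableP; split.
    by apply: (measurableT_comp mf); exact: measurable_affine.
  rewrite /= (@ge0_integralT_affine k c (fun x => `|(f x)%:E|)%E k0) => //.
    rewrite lte_mul_pinfty ?lee_fin ?invr_ge0 ?ltW//.
  exact: measurableT_comp.
have fp := integrable_funepos measurableT fi.
have fn := integrable_funeneg measurableT fi.
rewrite /Rintegral integralE [in RHS]integralE.
rewrite (_ : (\int[mu]_x ((fun x0 => (f (k * x0 + c))%:E)^\+ x) =
   (k^-1)%:E * \int[mu]_x ((EFin \o f)^\+ x))%E); last first.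
  by rewrite -(@ge0_integralT_affine k c)//; [apply: eq_integral => x _; rewrite /= ?funeposE ?funenegE|exact: (measurable_int mu)].
rewrite (_ : (\int[mu]_x ((fun x0 => (f (k * x0 + c))%:E)^\- x) =
   (k^-1)%:E * \int[mu]_x ((EFin \o f)^\- x))%E); last first.
  by rewrite -(@ge0_integralT_affine k c)//; [apply: eq_integral => x _; rewrite /= ?funeposE ?funenegE|exact: (measurable_int mu)].
have h1 : (\int[mu]_x ((EFin \o f)^\+ x))%E \is a fin_num by exact: integrable_fin_num.
have h2 : (\int[mu]_x ((EFin \o f)^\- x))%E \is a fin_num by exact: integrable_fin_num.
rewrite -muleBr//; last exact: fin_num_adde_defr.
by rewrite fineM// fin_numB h1 h2.
Qed.

Lemma cintegral_affine (k c : R) (f : R -> R[i]) : 0 < k -> cintegrable setT f ->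
  cintegrable setT (fun x => f (k * x + c)) /\
  cintegral setT (fun x => f (k * x + c)) = real_complex R k^-1 * cintegral setT f.
Proof.
move=> k0 [f1 f2].
have [i1 e1] := Rintegral_affine c k0 f1; have [i2 e2] := Rintegral_affine c k0 f2.
split=> //; rewrite /cintegral e1 e2.
by apply/eqP; rewrite eq_complex /= !mul0r subr0 addr0 !eqxx.
Qed.

Lemma cmeasurable_affine (k c : R) (f : R -> R[i]) : cmeasurable setT f ->
  cmeasurable setT (fun x => f (k * x + c)).
Proof. by apply: cmeasurable_comp; exact: measurable_affine. Qed.

Lemma sqnorm_affine (k c : R) (A : set R) (f : R -> R[i]) : 0 < k -> measurable A ->
  cmeasurable A f ->
  sqnorm (affine k c @^-1` A) (fun x => f (k * x + c)) = ((k^-1)%:E * sqnorm A f)%E.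
Proof.
move=> k0 mA mf.
rewrite /sqnorm -(@ge0_integral_affine k c A (fun x => (cabs (f x) ^+ 2)%:E))//.
  by apply/measurable_EFinP; exact: measurable_cabs_sqr.
by move=> x _; rewrite lee_fin sqr_ge0.
Qed.

Lemma in_L2_affine (k c : R) (f : R -> R[i]) : 0 < k -> in_L2 setT f ->
  in_L2 setT (fun x => f (k * x + c)).
Proof.
move=> k0 [mf foo]; split; first exact: cmeasurable_affine.
rewrite -(preimage_affine_setT k c) sqnorm_affine//.
by rewrite lte_mul_pinfty ?lee_fin ?invr_ge0 ?ltW.
Qed.

End Affine_change_of_variable.

(** * Symmetric partial sums over the integers *)

Section Symmetric_sums.

(** The body of [partial_zsum] over an arbitrary additive group, so that one recursion, [psumS],
    serves both complex sums and their real majorants; the two are convertible. *)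
Definition psum (V : zmodType) (c : int -> V) (N : nat) : V :=
  \sum_(i < N.*2.+1) c (i%:Z - N%:Z).

Lemma psum0 (V : zmodType) (c : int -> V) : psum c 0 = c 0.
Proof. by rewrite /psum big_ord1. Qed.

Lemma psumS (V : zmodType) (c : int -> V) N :
  psum c N.+1 = psum c N + (c N.+1%:Z + c (- N.+1%:Z)).
Proof.
rewrite /psum doubleS big_ord_recl big_ord_recr /= [LHS]addrC -[LHS]addrA; congr (_ + (_ + _)).
- by apply: eq_bigr => i _; congr (c _); rewrite /bump /=; lia.
- by congr (c _); rewrite /bump /=; lia.
- by congr (c _); rewrite /=; lia.
Qed.

Lemma eq_psum (V : zmodType) (c d : int -> V) N : c =1 d -> psum c N = psum d N.
Proof. by move=> cd; apply: eq_bigr => i _. Qed.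

Lemma psumD (V : zmodType) (c d : int -> V) N :
  psum (fun n => c n + d n) N = psum c N + psum d N.
Proof. exact: big_split. Qed.

Lemma psumZ (V : pzRingType) (k : V) (c : int -> V) N :
  psum (fun n => k * c n) N = k * psum c N.
Proof. by rewrite /psum big_distrr. Qed.

Lemma psum_morph (V W : zmodType) (h : V -> W) (c : int -> V) N :
  {morph h : x y / x + y} -> h (psum c N) = psum (h \o c) N.
Proof.
by move=> hD; elim: N => [|N ih]; rewrite ?psum0// !psumS !hD ih.
Qed.

(** [Negz i] is -(i + 1), hence N terms on the negative side against N + 1 on the other. *)
Lemma psum_posz_negz (V : zmodType) (c : int -> V) N :
  psum c N = \sum_(0 <= i < N.+1) c i%:Z + \sum_(0 <= i < N) c (Negz i).
Proof.
elim: N => [|N ih]; first by rewrite psum0 big_nat1 big_nil addr0.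
by rewrite psumS ih [in RHS]big_nat_recr//= [X in _ = _ + X]big_nat_recr//= NegzE addrACA.
Qed.

Variable R : realType.
Implicit Types (c : int -> R[i]) (r : int -> R).

Lemma psum_ge0 r N : (forall n, 0 <= r n) -> 0 <= psum r N.
Proof. by move=> r0; apply: sumr_ge0. Qed.

Lemma psum_nondecreasing r : (forall n, 0 <= r n) -> nondecreasing_seq (psum r).
Proof.
by move=> r0; apply/nondecreasing_seqP => N; rewrite psumS lerDl addr_ge0.
Qed.

Lemma Re_partial_zsum c N : Re (partial_zsum c N) = psum (fun n => Re (c n)) N.
Proof. exact: (psum_morph _ _ (@ReD R)). Qed.

Lemma Im_partial_zsum c N : Im (partial_zsum c N) = psum (fun n => Im (c n)) N.
Proof. exact: (psum_morph _ _ (@ImD R)). Qed.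

Lemma zsum_ccvg c z : ccvg (partial_zsum c) z -> zsum c = z.
Proof.
by case: z => a b [/= h1 h2]; rewrite /zsum; congr Complex; apply/cvg_lim.
Qed.

(** Comparison of telescoping series. It is applied with w the symmetric sums of absolute values,
    whose increments contain two terms at a time, as those of v do. *)
Lemma cvgn_bounded_increments (v w : nat -> R) (M : R) :
  (forall n, `|v n.+1 - v n| <= w n.+1 - w n) -> (forall n, w n <= M) -> cvgn v.
Proof.
move=> vw wM; pose d j := v j.+1 - v j.
have E : v = (fun n => series d n + v 0%N).
  apply/funext; elim => [|n ih]; first by rewrite /series /= big_nil add0r.
  by rewrite /series /= big_nat_recr//= addrAC -/(series d n) -ih /d subrKC.
rewrite E; apply: is_cvgD; last exact: is_cvg_cst.
apply: normed_cvg; apply: nondecreasing_is_cvgn.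
  by apply/nondecreasing_seqP => n; rewrite /series /= [leRHS]big_nat_recr//= lerDl.
exists (M - w 0%N) => _ [n _ <-]; rewrite /series /=.
apply: (@le_trans _ _ (w n - w 0%N)); last by rewrite lerD2r.
elim: n => [|n ih]; first by rewrite /series /= big_geq// subrr.
by rewrite /series /= big_nat_recr//=; apply: le_trans (lerD ih (vw n)) _; rewrite addrC subrKA.
Qed.

Lemma ccvg_absolute c (M : R) :
  (forall N, psum (fun n => cabs (c n)) N <= M) -> ccvg (partial_zsum c) (zsum c).
Proof.
move=> cM; split.
  apply: (@cvgn_bounded_increments _ (psum (fun n => cabs (c n))) M) => // N.
  rewrite /comp !Re_partial_zsum !psumS !(addrC (psum _ _)) !addrK.
  by apply: le_trans (ler_normD _ _) _; apply: lerD; exact: normr_Re_le.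
apply: (@cvgn_bounded_increments _ (psum (fun n => cabs (c n))) M) => // N.
rewrite /comp !Im_partial_zsum !psumS !(addrC (psum _ _)) !addrK.
by apply: le_trans (ler_normD _ _) _; apply: lerD; exact: normr_Im_le.
Qed.

Lemma esum_int (e : int -> \bar R) : (forall n, 0 <= e n)%E ->
  (\esum_(n in [set: int]) e n =
   \sum_(0 <= i <oo) e i%:Z + \sum_(0 <= i <oo) e (Negz i))%E.
Proof.
move=> e0; rewrite (esumID (range Posz))//; congr (_ + _)%E.
  rewrite setTI nneseries_esumT// (@reindex_esum _ _ _ setT _ Posz)//.
  split; [by move=> x _; exists x|by move=> x y _ _ []|].
  by move=> x [y _ <-]; exists y.
rewrite setTI nneseries_esumT// (@reindex_esum _ _ _ setT _ Negz)//.
split; [by move=> x _ [y _]|by move=> x y _ _ []|].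
move=> [n|n] /= h; last by exists n.
by exfalso; apply: h; exists n.
Qed.

(** Squares are nonnegative, so the unordered sum splits over the constructors [Posz] and [Negz],
    and each half stays below any bound on the symmetric sums. *)
Lemma in_l2P c : in_l2 c <->
  exists M : R, forall N, psum (fun n => cabs (c n) ^+ 2) N <= M.
Proof.
pose e n := (cabs (c n) ^+ 2)%:E : \bar R.
have e0 n : (0 <= e n)%E by rewrite lee_fin sqr_ge0.
rewrite /in_l2 (esum_int e0); split=> [foo|[M cM]].
  set S := (X in (X < _)%E) in foo.
  have S0 : (0 <= S)%E by apply: adde_ge0; apply: nneseries_ge0.
  exists (fine S) => N; rewrite -lee_fin fineK ?ge0_fin_numE//.
  rewrite psum_posz_negz EFinD -!sumEFin; apply: leeD.
    by apply: (@nneseries_lim_ge _ (fun i : nat => e i%:Z)).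
  by apply: (@nneseries_lim_ge _ (fun i : nat => e (Negz i))).
have c0 n : 0 <= cabs (c n) ^+ 2 by rewrite sqr_ge0.
have p1 : (\sum_(0 <= i <oo) e i%:Z <= M%:E)%E.
  apply: lime_le; first exact: is_cvg_nneseries.
  apply: nearW => n; rewrite sumEFin lee_fin; apply: le_trans (cM n).
  by rewrite psum_posz_negz big_nat_recr//= -addrA lerDl addr_ge0// sumr_ge0.
have p2 : (\sum_(0 <= i <oo) e (Negz i) <= M%:E)%E.
  apply: lime_le; first exact: is_cvg_nneseries.
  apply: nearW => n; rewrite sumEFin lee_fin; apply: le_trans (cM n).
  by rewrite psum_posz_negz lerDr sumr_ge0.
by apply: le_lt_trans (leeD p1 p2) _; rewrite -EFinD ltry.
Qed.

End Symmetric_sums.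

(** * Tiling the line by translates of [0, 1) *)

Section Unfolding.
Variable R : realType.
Notation I0 := (`[0%R, 1%R[%classic : set R).
Notation mu := (@lebesgue_measure R).
Implicit Types (G : R -> R) (F : R -> R[i]).

Lemma itv_shift (c u v : R) :
  affine 1 c @^-1` `[u, v[ = `[u - c, v - c[%classic.
Proof.
apply/seteqP; split=> x /=; rewrite !in_itv/= /affine mul1r lerBlDr ltrBrDr; by [].
Qed.

Lemma itv_setU (u v w : R) : u <= v -> v <= w ->
  `[u, w[%classic = (`[u, v[ `|` `[v, w[)%classic.
Proof. by move=> uv vw; apply: itv_bndbnd_setU; rewrite bnd_simp. Qed.

Lemma itv_disj (u v w : R) : [disjoint `[u, v[%classic & `[v, w[%classic].
Proof.
apply/disj_setPS => x [/=]; rewrite !in_itv/= => /andP[_ xv] /andP[vx _].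
by move: (lt_le_trans xv vx); rewrite ltxx.
Qed.

Lemma ge0_integral_shift G (n : int) : measurable_fun setT G -> (forall x, 0 <= G x) ->
  (\int[mu]_(x in `[0%R, 1%R[) (G (x - n%:~R))%:E =
   \int[mu]_(x in `[(- n%:~R)%R, (- n%:~R + 1)%R[) (G x)%:E)%E.
Proof.
move=> mG G0.
have := @ge0_integral_affine R 1 (- n%:~R) `[- n%:~R, - n%:~R + 1[ (EFin \o G) ltr01.
rewrite itv_shift opprK addNr addrAC addNr add0r invr1 mul1e => <-//.
- by apply: eq_integral => x _; rewrite mul1r.
- by apply/measurable_EFinP; exact: measurable_funTS.
- by move=> x _; rewrite lee_fin.
Qed.

(** The translates of [0, 1) by -N, ..., N tile [-N, N + 1), without overlap because they are
    half-open; the induction step adds one tile at each end. *)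
Lemma ge0_integral_psum G (N : nat) : measurable_fun setT G -> (forall x, 0 <= G x) ->
  (\int[mu]_(x in `[0%R, 1%R[) (psum (fun n => G (x - n%:~R)) N)%:E =
   \int[mu]_(x in `[(- N%:R)%R, N.+1%:R%R[) (G x)%:E)%E.
Proof.
move=> mG G0.
have mGn (n : int) : measurable_fun I0 (fun x => (G (x - n%:~R))%:E).
  apply/measurable_EFinP; apply: measurable_funTS; apply: (measurableT_comp mG).
  by apply: measurable_funB => //; exact: measurable_cst.
have mp (N' : nat) : measurable_fun I0
    (fun x => (psum (fun n => G (x - n%:~R)) N')%:E).
  apply/measurable_EFinP; apply: measurable_sum => i.
  by apply/measurable_EFinP; exact: mGn.
have mE (u v : R) : measurable_fun (`[u, v[ : set R) (fun x => (G x)%:E).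
  by apply/measurable_EFinP; exact: measurable_funTS.
elim: N => [|N ih].
  under eq_integral do rewrite psum0.
  by rewrite ge0_integral_shift// oppr0 add0r.
under eq_integral do rewrite psumS EFinD EFinD.
have mI : measurable I0 by exact: measurable_itv.
have p0 (N' : nat) x : I0 x ->
    (0 <= (psum (fun n => G (x - n%:~R)) N')%:E)%E.
  by move=> _; rewrite lee_fin psum_ge0.
have q0 (n : int) x : I0 x -> (0 <= (G (x - n%:~R))%:E)%E.
  by move=> _; rewrite lee_fin.
have r0 (n m : int) x : I0 x ->
    (0 <= (G (x - n%:~R))%:E + (G (x - m%:~R))%:E)%E.
  by move=> Ax; apply: adde_ge0; exact: q0.
have mr (n m : int) : measurable_fun I0
    (fun x => (G (x - n%:~R))%:E + (G (x - m%:~R))%:E)%E.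
  by apply: emeasurable_funD; exact: mGn.
rewrite (@ge0_integralD _ _ _ mu _ mI _ _ (p0 N) (mp N) (r0 _ _) (mr _ _)).
rewrite (@ge0_integralD _ _ _ mu _ mI _ _ (q0 _) (mGn _) (q0 _) (mGn _)).
rewrite ih !ge0_integral_shift//.
have sU (u v w : R) : u <= v -> v <= w ->
    (\int[mu]_(x in `[u, w[) (G x)%:E =
     \int[mu]_(x in `[u, v[) (G x)%:E + \int[mu]_(x in `[v, w[) (G x)%:E)%E.
  move=> uv vw; rewrite (itv_setU uv vw); apply: ge0_integral_setU => //.
  - by apply/measurable_EFinP; exact: measurable_funTS.
  - by move=> x _; rewrite lee_fin.
  - exact: itv_disj.
have le0 : - N%:R <= N.+1%:R :> R by rewrite (@le_trans _ _ 0)// oppr_le0.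
have le1 : - N.+1%:R <= - N%:R :> R by rewrite lerN2 ler_nat.
have le2 : N.+1%:R <= N.+2%:R :> R by rewrite ler_nat.
rewrite [in RHS](sU _ _ _ le1 (le_trans le0 le2)) [in RHS](sU _ _ _ le0 le2).
have e1 : - (N.+1%:Z)%:~R + 1 = - N%:R :> R by rewrite -[(N.+1%:Z)%:~R]/(N.+1%:R) -natr1; ring.
have e2 : - (- N.+1%:Z)%:~R = N.+1%:R :> R by rewrite mulrNz opprK.
by rewrite addeCA e1 e2 natr1.
Qed.

Lemma ge0_integral_unfold G : measurable_fun setT G -> (forall x, 0 <= G x) ->
  (fun N => \int[mu]_(x in `[0%R, 1%R[) (psum (fun n => G (x - n%:~R)) N)%:E)%E
     @ \oo --> (\int[mu]_x (G x)%:E)%E.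
Proof.
move=> mG G0; under eq_cvg do rewrite ge0_integral_psum//.
pose A (N : nat) : set R := `[(- N%:R)%R, N.+1%:R%R[%classic.
rewrite (_ : setT = \bigcup_N A N); last first.
  apply/seteqP; split=> // x _; exists (Num.truncn `|x|).+1 => //=.
  have := truncnS_gt `|x|; rewrite ltr_norml => /andP[h1 h2].
  rewrite /A /= in_itv/=.
  by rewrite ltW//= (lt_le_trans h2)// ler_nat.
apply: (@ge0_nondecreasing_set_cvg_integral _ (measurableTypeR R) R A (EFin \o G) mu).
- move=> n m nm; apply/subsetPset => x; rewrite /A /= !in_itv/= => /andP[h1 h2].
  by rewrite (le_trans _ h1) ?lerN2 ?ler_nat//= (lt_le_trans h2)// ler_nat ltnS.
- by move=> i; exact: measurable_itv.
- by move=> i; apply/measurable_EFinP; exact: measurable_funTS.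
- by move=> i x _; rewrite lee_fin.
Qed.

Definition periodize F (x : R) : R[i] := zsum (fun n => F (x - n%:~R)).

Lemma cmeasurable_partial_zsum A F N : measurable A -> cmeasurable setT F ->
  cmeasurable A (fun x => partial_zsum (fun n => F (x - n%:~R)) N).
Proof.
move=> mA mF.
have mt (n : int) : cmeasurable A (fun x => F (x - n%:~R)).
  apply: cmeasurable_comp => //.
  by apply: measurable_funB => //; exact: measurable_cst.
elim: N => [|N ih].
  by rewrite (_ : (fun _ => _) = (fun x => F (x - 0%:~R)))//; apply/funext => x; exact: psum0.
rewrite (_ : (fun _ => _) = (fun x => partial_zsum (fun n => F (x - n%:~R)) N +
  (F (x - N.+1%:~R) + F (x - (- N.+1%:Z)%:~R)))).
  by do 2 apply: cmeasurableD => //; exact: mt.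
by apply/funext => x; exact: psumS.
Qed.

Lemma cmeasurable_periodize A F : measurable A -> cmeasurable setT F -> cmeasurable A (periodize F).
Proof.
move=> mA mF; apply: (@cmeasurable_limn _ _ (fun N x => partial_zsum (fun n => F (x - n%:~R)) N)) => // N.
exact: cmeasurable_partial_zsum.
Qed.

End Unfolding.

Section Complex_unfolding.
Variable R : realType.
Notation I0 := (`[0%R, 1%R[%classic : set R).
Notation mu := (@lebesgue_measure R).
Implicit Types (F m : R -> R[i]).

Lemma cabs_partial_zsum (c : int -> R[i]) N :
  cabs (partial_zsum c N) <= psum (fun n => cabs (c n)) N.
Proof.
rewrite -[partial_zsum c N]/(psum c N); elim: N => [|N ih]; first by rewrite !psum0.
rewrite !psumS; apply: le_trans (cabsD _ _) _.
by apply: lerD => //; exact: cabsD.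
Qed.

Lemma cintegral_shift F (n : int) : cintegrable setT F ->
  cintegral `[0, 1[ (fun x => F (x - n%:~R)) =
  cintegral `[- n%:~R, - n%:~R + 1[ F.
Proof.
move=> iF; rewrite -[RHS]cintegral_cut.
have iC : cintegrable setT (cut `[- n%:~R, - n%:~R + 1[ F).
  by apply/cintegrable_cut => //; apply: cintegrableS iF.
have [_] := cintegral_affine (- n%:~R) ltr01 iC.
rewrite invr1 mul1r => <-; rewrite -cintegral_cut; apply: eq_cintegral => x _.
rewrite /cut mul1r; congr (if _ then _ else _).
apply/idP/idP => /set_mem h; apply/mem_set; move: h;
  by rewrite /= !in_itv/= lerBrDr addNr ltrBlDr addrAC addNr add0r.
Qed.

Lemma cintegral_itv_split F (u v w : R) : cintegrable setT F -> u <= v -> v <= w ->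
  cintegral `[u, w[ F = cintegral `[u, v[ F + cintegral `[v, w[ F.
Proof.
move=> iF uv vw; rewrite -[LHS]cintegral_cut -[X in X + _]cintegral_cut -[X in _ + X]cintegral_cut.
have iC (s t : R) : cintegrable setT (cut `[s, t[ F).
  by apply/cintegrable_cut => //; apply: cintegrableS iF.
rewrite -cintegralD//; apply: eq_cintegral => x _.
have [xu|xu] := boolP (u <= x); have [xw|xw] := boolP (x < w); last first.
- rewrite !cutN ?addr0//= in_itv/= => /andP[h1 h2].
  + by move: xw; rewrite h2.
  + by move: xu; rewrite h1.
  + by move: xw; rewrite (lt_le_trans h2).
- rewrite !cutN ?addr0//= in_itv/= => /andP[h1 h2].
  + by move: xu; rewrite (le_trans uv).
  + by move: xu; rewrite h1.
  + by move: xu; rewrite h1.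
- rewrite !cutN ?addr0//= in_itv/= => /andP[h1 h2].
  + by move: xw; rewrite h2.
  + by move: xw; rewrite (lt_le_trans h2).
  + by move: xw; rewrite h2.
have [xv|xv] := ltP x v.
- rewrite [cut `[v, w[ F x]cutN ?addr0 ?cutE//= ?in_itv/= ?xu ?xw ?xv//.
  by rewrite leNgt xv.
- rewrite [cut `[u, v[ F x]cutN ?add0r ?cutE//= ?in_itv/= ?xu ?xw ?xv//.
  by rewrite ltNge xv andbF.
Qed.

Lemma cintegral_partial_zsum F N : cintegrable setT F ->
  cintegral `[0, 1[ (fun x => partial_zsum (fun n => F (x - n%:~R)) N) =
  cintegral `[- N%:R, N.+1%:R[ F.
Proof.
move=> iF.
have mI : measurable I0 by exact: measurable_itv.
have iS (n : int) : cintegrable `[0, 1[ (fun x => F (x - n%:~R)).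
  apply: (@cintegrableS _ _ setT) => //.
  have [h _] := cintegral_affine (- n%:~R) ltr01 iF.
  by apply: eq_cintegrable h => // x _; rewrite mul1r.
have iP : cintegrable `[0, 1[ (fun x => partial_zsum (fun n => F (x - n%:~R)) N) /\
  cintegral `[0, 1[ (fun x => partial_zsum (fun n => F (x - n%:~R)) N) =
  cintegral `[- N%:R, N.+1%:R[ F; last by case: iP.
elim: N => [|N [ih1 ih2]].
  have E x : partial_zsum (fun n => F (x - n%:~R)) 0 = F (x - 0%:~R) by exact: psum0.
  rewrite (funext E); split; first exact: iS.
  by rewrite cintegral_shift// oppr0 add0r.
have E x : partial_zsum (fun n => F (x - n%:~R)) N.+1 =
  partial_zsum (fun n => F (x - n%:~R)) N +
  (F (x - N.+1%:~R) + F (x - (- N.+1%:Z)%:~R)) by exact: psumS.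
rewrite (funext E); split; first by do 2 apply: cintegrableD => //.
rewrite !cintegralD//; last exact: cintegrableD.
rewrite ih2 !cintegral_shift//.
have e1 : - (N.+1%:Z)%:~R + 1 = - N%:R :> R by rewrite -[(N.+1%:Z)%:~R]/(N.+1%:R) -natr1; ring.
have e2 : - (- N.+1%:Z)%:~R = N.+1%:R :> R by rewrite mulrNz opprK.
have le0 : - N%:R <= N.+1%:R :> R by rewrite (@le_trans _ _ 0)// oppr_le0.
have le1 : - N.+1%:R <= - N%:R :> R by rewrite lerN2 ler_nat.
have le2 : N.+1%:R <= N.+2%:R :> R by rewrite ler_nat.
rewrite [in RHS](cintegral_itv_split iF le1 (le_trans le0 le2)).
rewrite [in RHS](cintegral_itv_split iF le0 le2).
by rewrite addrCA e1 e2 natr1.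
Qed.

Lemma itv_sym_exhaust (x : R) : \forall N \near \oo, (`[- N%:R, N.+1%:R[%classic : set R) x.
Proof.
exists (Num.truncn `|x|).+1 => // N /= hN.
have := truncnS_gt `|x|; rewrite ltr_norml => /andP[h1 h2].
rewrite in_itv/= ltW/=.
  by rewrite (lt_le_trans h2)// ler_nat (leq_trans hN).
by apply: le_lt_trans h1; rewrite lerN2 ler_nat.
Qed.

Lemma cvg_near_eq (u : nat -> R) (l : R) : (\forall N \near \oo, u N = l) -> u @ \oo --> l.
Proof.
move=> h; apply: cvg_trans (@cvg_cst _ l _ \oo _); apply: near_eq_cvg.
by apply: filterS h => N ->.
Qed.

Lemma ccvg_near_eq (u : nat -> R[i]) z : (\forall N \near \oo, u N = z) -> ccvg u z.
Proof. by move=> h; split; apply: cvg_near_eq; apply: filterS h => N /= ->. Qed.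

(** The folded series of |F| increases to a function whose integral is that of |F| over the line.
    Being finite almost everywhere, it gives absolute convergence, and it dominates the partial sums
    when the integral and the series are exchanged. *)
Theorem periodizeP F : cintegrable setT F ->
  [/\ {ae mu, forall x, I0 x ->
        ccvg (partial_zsum (fun n => F (x - n%:~R))) (periodize F x)},
      cintegrable `[0, 1[ (periodize F) &
      cintegral `[0, 1[ (periodize F) = cintegral setT F].
Proof.
move=> iF; have mF := cintegrable_cmeasurable iF.
have mI : measurable I0 by exact: measurable_itv.
pose G x := cabs (F x).
have mG : measurable_fun setT G by exact: measurable_cabs.
have G0 x : 0 <= G x by exact: cabs_ge0.
pose s N x := (psum (fun n => G (x - n%:~R)) N)%:E : \bar R.
have ms N : measurable_fun I0 (fun x => s N x).
  apply/measurable_EFinP; apply: measurable_sum => i.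
  apply: measurable_funTS; apply: (measurableT_comp mG).
  by apply: measurable_funB => //; exact: measurable_cst.
have s0 N x : I0 x -> (0 <= s N x)%E.
  by move=> _; rewrite lee_fin psum_ge0.
have sm x : I0 x -> nondecreasing_seq (fun N => s N x).
  by move=> _ N M NM; rewrite lee_fin; apply: psum_nondecreasing.
pose h x := limn (fun N => s N x).
have sh N x : I0 x -> (s N x <= h x)%E.
  move=> Ax; apply: lime_ge; first exact: ereal_nondecreasing_is_cvgn (sm x Ax).
  by exists N => // M NM; exact: sm.
have h0 x : I0 x -> (0 <= h x)%E.
  by move=> Ax; apply: le_trans (sh 0%N x Ax); exact: s0.
have mh : measurable_fun I0 (fun x => h x).
  apply: (emeasurable_fun_cvg (fun N x => s N x)) => // x Ax.
  exact: ereal_nondecreasing_is_cvgn (sm x Ax).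
have ih : mu.-integrable `[0%R, 1%R[ (fun x => h x).
  apply/integrableP; split => //.
  rewrite (_ : integral _ _ _ = \int[mu]_(x in `[0%R, 1%R[) h x)%E; last first.
    by apply: eq_integral => x /set_mem Ax; rewrite gee0_abs// h0.
  rewrite (@monotone_convergence _ _ _ mu _ mI s ms s0 sm).
  rewrite (cvg_lim _ (ge0_integral_unfold mG G0))//.
  have /integrableP[_] := integrable_cabs measurableT iF; apply: le_lt_trans.
  rewrite le_eqVlt; apply/orP; left; apply/eqP; apply: eq_integral => x _ /=.
  by rewrite ger0_norm ?cabs_ge0.
have cvgP : {ae mu, forall x, I0 x ->
    ccvg (partial_zsum (fun n => F (x - n%:~R))) (periodize F x)}.
  apply: ae_mono (@integrable_ae _ _ _ mu _ mI _ ih) => x hx Ax.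
  apply: (@ccvg_absolute _ _ (fine (h x))) => N.
  by rewrite -lee_fin fineK ?hx//; exact: sh.
have dom : {ae mu, forall x n, I0 x ->
    ((cabs (partial_zsum (fun k => F (x - k%:~R)%R) n))%:E <= h x)%E}.
  apply: aeW => x n Ax; apply: le_trans (sh n x Ax).
  by rewrite lee_fin; exact: cabs_partial_zsum.
have [ip cp] := @cdominated_convergence _ _ mI
  (fun N x => partial_zsum (fun n => F (x - n%:~R)) N) (periodize F) h
  (fun N => cmeasurable_partial_zsum N mI mF) (cmeasurable_periodize mI mF) cvgP ih dom.
(* The same integrals have a second limit: by the tiling they are the integrals of F over [-N, N +
   1). *)
split => //; apply: ccvg_unique cp _.
have -> : (fun N => cintegral `[0, 1[ (fun x => partial_zsum (fun n => F (x - n%:~R)) N))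
   = (fun N => cintegral setT (cut `[- N%:R, N.+1%:R[ F)).
  by apply/funext => N; rewrite cintegral_partial_zsum// cintegral_cut.
have [] := @cdominated_convergence _ setT measurableT
  (fun N => cut `[- N%:R, N.+1%:R[ F) F (EFin \o G); last by [].
- by move=> N; apply: cmeasurable_cut => //; apply: cmeasurableS mF.
- by [].
- apply: aeW => x _; apply: ccvg_near_eq; apply: filterS (itv_sym_exhaust x) => N.
  exact: cutE.
- exact: integrable_cabs.
- apply: aeW => x N _; rewrite /G /cut; case: ifP => //= _.
  by rewrite cabs0 lee_fin cabs_ge0.
Qed.

Lemma periodizeM F m (x : R) : (forall n : int, m (x - n%:~R) = m x) ->
  ccvg (partial_zsum (fun n => F (x - n%:~R))) (periodize F x) ->
  periodize (fun y => F y * m y) x = periodize F x * m x.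
Proof.
move=> mx cF; apply: zsum_ccvg.
have -> : partial_zsum (fun n => F (x - n%:~R) * m (x - n%:~R)) =
    (fun N => partial_zsum (fun n => F (x - n%:~R)) N * m x).
  apply/funext => N; rewrite /partial_zsum big_distrl /=.
  by apply: eq_bigr => i _; rewrite mx.
by apply: ccvgM => //; exact: ccvg_cst.
Qed.

(** A periodic m factors out of the folded sum wherever this sum converges. The tiling lives on [0,
    1) and the coefficients on (0, 1); the point 0 is a null set. *)
Theorem cintegral_unfold F m : cintegrable setT F -> cmeasurable setT m ->
  (forall x (n : int), m (x - n%:~R) = m x) -> cintegrable setT (fun x => F x * m x) ->
  cintegrable `]0, 1[ (fun x => periodize F x * m x) /\
  cintegral `]0, 1[ (fun x => periodize F x * m x) = cintegral setT (fun x => F x * m x).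
Proof.
move=> iF mm mper iFm.
have mI : measurable I0 by exact: measurable_itv.
have [cF _ _] := periodizeP iF; have [_ i1 <-] := periodizeP iFm.
have mP : cmeasurable `[0, 1[ (fun x => periodize F x * m x).
  apply: cmeasurableM; last by apply: cmeasurableS mm.
  by apply: cmeasurable_periodize => //; exact: cintegrable_cmeasurable iF.
have E : {ae mu, forall x, I0 x ->
    periodize (fun x => F x * m x) x = periodize F x * m x}.
  by apply: ae_mono cF => x h Ax; apply: periodizeM; [exact: mper|exact: h].
have i2 := ae_eq_cintegrable mI mP E i1.
have s01 : (`]0%R, 1%R[%classic : set R) `<=` `[0%R, 1%R[%classic.
  by move=> x /=; rewrite !in_itv/= => /andP[/ltW -> ->].
have i3 : cintegrable `]0, 1[ (fun x => periodize F x * m x) by exact: cintegrableS i2.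
split => //.
rewrite (ae_eq_cintegral mI (cintegrable_cmeasurable i1) mP E).
by case: i3 => h1 h2; rewrite /cintegral !Rintegral_itv_obnd_cbnd.
Qed.

End Complex_unfolding.

(** * Fourier series on the unit interval *)

Section Null_on_intervals.
Variable R : realType.
Notation mu := (@lebesgue_measure R).

(** Dynkin's argument: open rays are stable under intersection and generate the Borel sets, and the
    sets over which g integrates to 0 are stable under complements, thanks to the integral over the
    line, and under countable disjoint unions. *)
Lemma ae0_of_rays (g : R -> R) : mu.-integrable setT (EFin \o g) ->
  (\int[mu]_x (g x)%:E = 0)%E ->
  (forall s : R, \int[mu]_(x in `]s, +oo[) (g x)%:E = 0)%E ->
  {ae mu, forall x, g x = 0}.
Proof.
move=> ig gT gs.
have mg : measurable_fun setT (EFin \o g) := measurable_int _ ig.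
have key (S : set (measurableTypeR R)) : measurable S ->
    (\int[mu]_(x in S) (g x)%:E = 0)%E.
  move=> mS.
  apply: (@dynkin_induction _ (measurableTypeR R) (@RGenOInfty.G R)
    (fun S => (\int[mu]_(x in S) (g x)%:E = 0)%E)) => //.
  - exact: RGenOInfty.measurableE.
  - move=> _ _ [x ->] [y ->]; exists (Num.max x y).
    apply/seteqP; split=> z /=; rewrite !in_itv/= !andbT gt_max.
      by move=> [-> ->].
    by move=> /andP[-> ->].
  - by move=> _ [s ->]; exact: gs.
  - move=> S' mS' S0.
    have := @integral_setU _ (measurableTypeR R) R mu S' (~` S') (EFin \o g) mS' (measurableC mS').
    rewrite setUv => /(_ mg); rewrite gT S0 add0e => <- //.
    by apply/disj_setPS; rewrite setICr.
  - move=> F mF tF F0.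
    rewrite (@integral_bigcup _ (measurableTypeR R) R mu F (EFin \o g) tF mF).
      by apply: eseries0 => i _ _; exact: F0.
    apply: (@integrableS _ (measurableTypeR R) R mu setT) => //.
    exact: bigcupT_measurable.
  - by move: mS; rewrite RGenOInfty.measurableE.
have := @integral_ae_eq _ (measurableTypeR R) R mu setT measurableT (cst 0%E) (EFin \o g) ig
  (@measurable_cst _ _ _ _ _ _).
have H E : E `<=` setT -> measurable E ->
    (\int[mu]_(x in E) (EFin \o g) x = \int[mu]_(x in E) cst 0 x)%E.
  by move=> _ mE; rewrite integral0; exact: key.
by move=> /(_ H); apply: ae_mono => x /(_ Logic.I) [].
Qed.

End Null_on_intervals.

(** * Uniqueness of Fourier coefficients in L^1 *)

Section Trigonometric_uniqueness.
Variable R : realType.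
Notation I01 := (`]0%R, 1%R[%classic : set R).
Implicit Types (f h : R -> R[i]).

Lemma measurable_I01 : measurable I01.
Proof. exact: measurable_itv. Qed.
Let mI := measurable_I01.

Lemma cmeasurable_expo A (n : int) : cmeasurable A (@expo R n).
Proof.
by apply: cmeasurable_cis; apply: measurable_funM => //; exact: measurable_cst.
Qed.

Lemma cabs_expo (n : int) (x : R) : cabs (expo n x) = 1.
Proof. exact: cabs_cis. Qed.

Lemma expoD (m n : int) (x : R) : expo (m + n) x = expo m x * expo n x.
Proof. by rewrite /expo -cisD; congr cis; rewrite intrD; ring. Qed.

Lemma expoN (n : int) (x : R) : expo (- n) x = conjc (expo n x).
Proof. by rewrite /expo -cisN; congr cis; rewrite mulrNz; ring. Qed.

Lemma expo0 (x : R) : expo 0 x = 1.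
Proof. by rewrite /expo mulr0 mul0r cis0. Qed.

Lemma expo_int_shift (n k : int) (x : R) : expo n (x - k%:~R) = expo n x.
Proof.
rewrite /expo (_ : _ * (x - _) = 2 * pi * n%:~R * x - 2 * pi * (n * k)%:~R).
  by rewrite cisD cisN cis_2pi conjc1 mulr1.
by rewrite intrM; ring.
Qed.

Definition coef_free f : Prop :=
  cintegrable I01 f /\ forall n, cintegral I01 (fun x => f x * expo n x) = 0.

(** A stability property takes the place of membership in the trigonometric polynomials: it passes
    to sums, products and powers without any account of degrees or coefficients. *)
Definition multiplier h : Prop :=
  [/\ cmeasurable I01 h, exists M : R, forall x, cabs (h x) <= M &
      forall f, coef_free f -> coef_free (fun x => f x * h x)].

Lemma cintegrableMr h f (M : R) : cmeasurable I01 h -> (forall x, cabs (h x) <= M) ->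
  cintegrable I01 f -> cintegrable I01 (fun x => f x * h x).
Proof.
move=> mh hM iF; have := @cintegrableM_bounded _ _ mI h M f mh (fun x _ => hM x) iF.
by apply: eq_cintegrable => // x _; rewrite mulrC.
Qed.

Lemma multiplier_expo (w : R[i]) (m : int) : multiplier (fun x => w * expo m x).
Proof.
have mh : cmeasurable I01 (fun x => w * expo m x).
  by apply: cmeasurableM; [exact: cmeasurable_cst|exact: cmeasurable_expo].
have hM x : cabs (w * expo m x) <= cabs w by rewrite cabsM cabs_expo mulr1.
split=> //; first by exists (cabs w).
move=> f [iF f0]; split; first exact: cintegrableMr hM iF.
move=> n; rewrite (@eq_cintegral _ _ (fun x => w * (f x * expo (m + n) x))).
  rewrite cintegralZ ?f0 ?mulr0//.
  apply: (@cintegrableMr _ _ 1) => // [|x]; first exact: cmeasurable_expo.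
  by rewrite cabs_expo.
by move=> x _; rewrite expoD; ring.
Qed.

Lemma multiplierD h k : multiplier h -> multiplier k -> multiplier (fun x => h x + k x).
Proof.
move=> [mh [M hM] hZ] [mk [N kN] kZ].
have bnd x : cabs (h x + k x) <= M + N by apply: le_trans (cabsD _ _) (lerD (hM x) (kN x)).
split; [exact: cmeasurableD|by exists (M + N)|].
move=> f Zf; have [i1 z1] := hZ f Zf; have [i2 z2] := kZ f Zf.
split; first by apply: cintegrableMr bnd Zf.1; exact: cmeasurableD.
have iE (g : R -> R[i]) n : cintegrable I01 g -> cintegrable I01 (fun x => g x * expo n x).
  move=> ig; apply: (@cintegrableMr _ _ 1) => // [|x]; first exact: cmeasurable_expo.
  by rewrite cabs_expo.
move=> n; rewrite (@eq_cintegral _ _ (fun x => f x * h x * expo n x + f x * k x * expo n x)).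
  by rewrite cintegralD ?z1 ?z2 ?addr0//; exact: iE.
by move=> x _; ring.
Qed.

Lemma multiplierM h k : multiplier h -> multiplier k -> multiplier (fun x => h x * k x).
Proof.
move=> [mh [M hM] hZ] [mk [N kN] kZ]; split; first exact: cmeasurableM.
  exists (M * N) => x; rewrite cabsM; apply: ler_pM; rewrite ?cabs_ge0 ?hM ?kN//.
move=> f Zf; have := kZ _ (hZ _ Zf); congr coef_free.
by apply/funext => x; rewrite mulrA.
Qed.

Lemma multiplier_cst (w : R[i]) : multiplier (fun=> w).
Proof.
have := multiplier_expo w 0; congr multiplier.
by apply/funext => x; rewrite expo0 mulr1.
Qed.

Lemma multiplierX h N : multiplier h -> multiplier (fun x => h x ^+ N).
Proof.
move=> hh; elim: N => [|N ih]; first exact: multiplier_cst.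
rewrite (_ : (fun _ => _) = (fun x => h x * h x ^+ N)); first exact: multiplierM.
by apply/funext => x; rewrite exprS.
Qed.

Lemma multiplier_cos (x0 : R) :
  multiplier (fun x => real_complex R (cos (2 * pi * (x - x0)))).
Proof.
have := multiplierD (multiplier_expo (2^-1 * cis (- (2 * pi * x0))) 1)
                    (multiplier_expo (2^-1 * cis (2 * pi * x0)) (-1)).
congr multiplier; apply/funext => x.
have e1 : 2^-1 * cis (- (2 * pi * x0)) * expo 1 x = 2^-1 * cis (2 * pi * (x - x0)).
  by rewrite -mulrA -cisD; congr (_ * cis _); ring.
have e2 : 2^-1 * cis (2 * pi * x0) * expo (-1) x = 2^-1 * conjc (cis (2 * pi * (x - x0))).
  rewrite -mulrA -cisD -cisN; congr (_ * cis _).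
  by rewrite (_ : (-1)%:~R = -1)//; ring.
rewrite e1 e2 -mulrDr addcJ mulrA mulVf ?mul1r//.
Qed.

(** Bernoulli's inequality. This form controls [step_poly] where it tends to 1, the next one where
    it tends to 0. *)
Lemma onem_expr_ge (y : R) N : 0 <= y <= 1 -> 1 - N%:R * y <= (1 - y) ^+ N.
Proof.
move=> /andP[y0 y1]; elim: N => [|N ih]; first by rewrite mul0r subr0.
rewrite exprS -[N.+1%:R]natr1.
have : (1 - y) * (1 - N%:R * y) <= (1 - y) * (1 - y) ^+ N by rewrite ler_wpM2l// subr_ge0.
apply: le_trans; have : 0 <= N%:R * y * y by rewrite !mulr_ge0.
by nra.
Qed.

Lemma onep_expr_ge (y : R) N : 0 <= y -> 1 + N%:R * y <= (1 + y) ^+ N.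
Proof.
move=> y0; elim: N => [|N ih]; first by rewrite mul0r addr0.
rewrite exprS -[N.+1%:R]natr1.
have : (1 + y) * (1 + N%:R * y) <= (1 + y) * (1 + y) ^+ N by rewrite ler_wpM2l// addr_ge0.
apply: le_trans; have : 0 <= N%:R * y * y by rewrite !mulr_ge0.
by nra.
Qed.

(** The polynomial used in elementary proofs of the Stone-Weierstrass theorem: its behaviour is
    decided by (2 q)^k, which tends to 0 or to infinity according to the side of 1/2 on which q
    lies. *)
Definition step_poly (k : nat) (q : R) : R := (1 - q ^+ k) ^+ (2 ^ k).

Lemma step_poly_itv k (q : R) : 0 <= q <= 1 -> 0 <= step_poly k q <= 1.
Proof.
move=> /andP[q0 q1].
have h1 : q ^+ k <= 1 by rewrite exprn_ile1.
have h0 : 0 <= q ^+ k by rewrite exprn_ge0.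
by rewrite /step_poly exprn_ge0 ?subr_ge0//= exprn_ile1 ?subr_ge0// gerBl.
Qed.

Lemma step_poly_cvg1 (q : R) : 0 <= q < 2^-1 -> (fun k => step_poly k q) @ \oo --> (1 : R).
Proof.
move=> /andP[q0 q2].
have q1 : q <= 1 by rewrite ltW// (lt_le_trans q2)// invf_le1// ler1n.
have zc : (fun k => (2 * q) ^+ k) @ \oo --> (0 : R).
  by apply: cvg_expr; rewrite ger0_norm ?mulr_ge0//; lra.
apply: cvg_dist0 zc => k; have /andP[s0 s1] := @step_poly_itv k q (introT andP (conj q0 q1)).
rewrite distrC ger0_norm ?subr_ge0// lerBlDr -lerBlDl.
rewrite exprMn -natrX; apply: onem_expr_ge.
by rewrite exprn_ge0//= exprn_ile1.
Qed.

(** With y = q^k, (1 - y)(1 + y) <= 1 bounds the value by the inverse of (1 + y)^(2^k), which is at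
    least 2^k y = (2 q)^k. *)
Lemma step_poly_cvg0 (q : R) : 2^-1 < q <= 1 -> (fun k => step_poly k q) @ \oo --> (0 : R).
Proof.
move=> /andP[q2 q1]; have q0 : 0 < q by rewrite (lt_trans _ q2).
have zp : 0 < 2 * q by rewrite mulr_gt0.
have zc : (fun k => (2 * q)^-1 ^+ k) @ \oo --> (0 : R).
  apply: cvg_expr; rewrite ger0_norm ?invr_ge0 ?ltW// invf_lt1//.
  by lra.
apply: cvg_dist0 zc => k.
have /andP[s0 s1] := @step_poly_itv k q (introT andP (conj (ltW q0) q1)).
rewrite subr0 ger0_norm// exprVn -[leRHS]mul1r ler_pdivlMr ?exprn_gt0//.
set y := q ^+ k; have y0 : 0 <= y by rewrite exprn_ge0// ltW.
have y1 : y <= 1 by rewrite exprn_ile1// ltW.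
have h : (1 - y) ^+ (2 ^ k) * (1 + y) ^+ (2 ^ k) <= 1.
  rewrite -exprMn exprn_ile1//; first by rewrite mulr_ge0 ?subr_ge0// addr_ge0.
  have := sqr_ge0 y; nra.
apply: le_trans h; rewrite ler_wpM2l//.
apply: le_trans (onep_expr_ge _ y0).
by rewrite exprMn -natrX lerDr.
Qed.

End Trigonometric_uniqueness.

Section Uniqueness_of_coefficients.
Variable R : realType.
Notation mu := (@lebesgue_measure R).
Notation I01 := (`]0%R, 1%R[%classic : set R).
Implicit Types (f h : R -> R[i]).
Let mI := @measurable_I01 R.

Lemma ae_neq (s : R) : {ae mu, forall x, x <> s}.
Proof.
exists [set s]; split; first exact: measurable_set1.
  exact: lebesgue_measure_set1.
by move=> x /=; rewrite /setC /= => /contrapT.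
Qed.

(* On [0, 1] the arc of centre [(s + t) / 2] and half-width [(t - s) / 2] is
   exactly the interval between [s] and [t]. *)
Lemma cos_arc (s t x : R) : 0 <= s -> s < t -> t <= 1 -> 0 < x < 1 ->
  let c := cos (2 * pi * (x - (s + t) / 2)) in
  let d := cos (2 * pi * ((t - s) / 2)) in
  (s < x < t -> d < c) /\ (x < s \/ t < x -> c < d).
Proof.
move=> s0 st t1 /andP[x0 x1] c d.
pose u := `|x - (s + t) / 2|; pose r := (t - s) / 2.
have pp : 0 < (2 * pi : R) by rewrite mulr_gt0// pi_gt0.
have cE : c = cos (2 * pi * u).
  rewrite /c /u; case: ger0P => // _.
  by rewrite -[LHS]cosN; congr cos; ring.
have r0 : 0 < r by rewrite /r; lra.
have r2 : r <= 2^-1 by rewrite /r; lra.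
have in0 (y : R) : 0 <= y <= 2^-1 -> 2 * pi * y \in `[0, pi].
  move=> /andP[y0 y1]; rewrite in_itv/=.
  have h1 : 0 <= pi * (2^-1 - y) by rewrite mulr_ge0 ?pi_ge0// subr_ge0.
  have h2 : 0 <= pi * y by rewrite mulr_ge0 ?pi_ge0.
  by apply/andP; split; lra.
have u0 : 0 <= u by rewrite /u normr_ge0.
have ur1 : u < 1 - r by rewrite /u /r ltr_norml; apply/andP; split; lra.
split=> [/andP[sx xt]|xst].
  have ur : u < r by rewrite /u /r ltr_norml; apply/andP; split; lra.
  rewrite cE /d -/r ltr_cos ?in0//; last by lra.
    by rewrite ltr_pM2l.
  by apply/andP; split; lra.
have ur : r < u.
  by rewrite /u /r; case: xst => h; [rewrite ltr0_norm|rewrite gtr0_norm]; lra.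
have [uh|uh] := lerP u 2^-1.
  rewrite cE /d -/r ltr_cos ?in0//; last by apply/andP; split; lra.
    by rewrite ltr_pM2l.
  by apply/andP; split; lra.
(* Beyond the half-period the cosine increases again. The distance is then measured the other way
   round the circle, as 1 - u, which [ur1] keeps above r. *)
have -> : c = cos (2 * pi * (1 - u)).
  rewrite cE -[RHS]cosN -[RHS]cosD2pi; congr cos.
  by rewrite -[pi *+ 2]mulr_natl; ring.
rewrite /d -/r ltr_cos ?in0//; try by apply/andP; split; lra.
by rewrite ltr_pM2l//; lra.
Qed.

Lemma coef_free_itv f (s t : R) : coef_free f -> 0 <= s -> s < t -> t <= 1 ->
  cintegral `]s, t[ f = 0.
Proof.
move=> Zf s0 st t1; have iF := Zf.1.
(* The cosine centred at the midpoint of s and t exceeds its endpoint value exactly inside the arc,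
   where therefore q < 1/2. Division by 4 brings a difference of cosines from [-2, 2] into
   [-1/2, 1/2]. *)
pose q (x : R) : R := (cos (2 * pi * ((t - s) / 2)) - cos (2 * pi * (x - (s + t) / 2))) / 4 + 2^-1.
pose h k x := real_complex R (step_poly k (q x)).
have q01 x : 0 <= q x <= 1.
  rewrite /q; have := cos_le1 (2 * pi * ((t - s) / 2)); have := cos_geN1 (2 * pi * ((t - s) / 2)).
  have := cos_le1 (2 * pi * (x - (s + t) / 2)); have := cos_geN1 (2 * pi * (x - (s + t) / 2)).
  by lra.
have mq : multiplier (fun x => real_complex R (q x)).
  have := multiplierD (multiplier_cst (real_complex R (cos (2 * pi * ((t - s) / 2)) / 4 + 2^-1)))
    (multiplierM (multiplier_cst (real_complex R (- 4^-1))) (multiplier_cos ((s + t) / 2))).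
  congr multiplier; apply/funext => x; rewrite -rmorphM -rmorphD; congr (real_complex R _).
  by rewrite /q; ring.
have mh k : multiplier (h k).
  have := multiplierX (2 ^ k) (multiplierD (multiplier_cst 1)
    (multiplierM (multiplier_cst (-1)) (multiplierX k mq))).
  congr multiplier; apply/funext => x.
  by rewrite /h /step_poly rmorphXn rmorphB rmorphXn rmorph1 mulN1r.
have h1 k x : cabs (h k x) <= 1.
  have /andP[h0 h1] := @step_poly_itv _ k _ (q01 x).
  rewrite -(@ler_pXn2r _ 2) ?nnegrE ?cabs_ge0// cabs_sqr /= expr0n addr0.
  by rewrite expr1n exprn_ile1.
have fh0 k : cintegral I01 (fun x => f x * h k x) = 0.
  have [_ _ /(_ _ Zf)[_ /(_ 0)]] := mh k; move=> <-; apply: eq_cintegral => x _.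
  by rewrite expo0 mulr1.
have mf := cintegrable_cmeasurable iF.
have sub : (`]s, t[%classic : set R) `<=` I01.
  move=> x /=; rewrite !in_itv/= => /andP[h2 h3].
  by rewrite (le_lt_trans s0)//= (lt_le_trans h3).
have cutI : cut I01 (cut `]s, t[ f) = cut `]s, t[ f.
  apply/funext => x; rewrite /cut; case: ifPn => // xI; case: ifPn => // /set_mem xs.
  by move: xI; rewrite mem_set//; exact: sub.
have m2 : cmeasurable I01 (cut `]s, t[ f).
  have mst : cmeasurable setT (cut `]s, t[ f).
    by apply: cmeasurable_cut => //; exact: cmeasurableS sub mf.
  exact: (cmeasurableS measurableT).
have [] := @cdominated_convergence _ I01 mI (fun k x => f x * h k x)
  (cut `]s, t[ f) (EFin \o (fun x => cabs (f x))).
- by move=> k; apply: cmeasurableM => //; case: (mh k).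
- by [].
(* At s and t the value of q is 1/2 and the powers tend to neither 0 nor 1; both points are
   discarded. *)
- apply: ae_mono2 (ae_neq s) (ae_neq t) => x xs xt Ix.
  have Ix' : 0 < x < 1 by move: Ix; rewrite /= in_itv.
  have [c1 c2] := cos_arc s0 st t1 Ix'.
  have [xin|xout] := boolP (s < x < t).
    rewrite cutE//= ?in_itv//= -[X in ccvg _ X]mulr1.
    apply: ccvgM; first exact: ccvg_cst.
    split => /=; last exact: cvg_cst.
    apply: step_poly_cvg1; have /andP[-> _] := q01 x.
    by rewrite /q; have := c1 xin; lra.
  rewrite cutN//= ?in_itv/=; last exact/negP.
  rewrite -(mulr0 (f x)); apply: ccvgM; first exact: ccvg_cst.
  split => /=; last exact: cvg_cst.
  apply: step_poly_cvg0; have /andP[_ ->] := q01 x; rewrite andbT.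
  suff /c2 : x < s \/ t < x by rewrite /q; lra.
  move: xout; rewrite negb_and -!leNgt => /orP[h2|h2]; [left|right].
    by rewrite lt_neqAle h2 andbT; apply/eqP.
  by rewrite lt_neqAle h2 andbT; apply/eqP => e; apply: xt.
- exact: integrable_cabs.
- apply: aeW => x k _; rewrite lee_fin cabsM -[leRHS]mulr1.
  by rewrite ler_wpM2l ?cabs_ge0.
move=> _; rewrite -cintegral_cut cutI cintegral_cut => c.
apply: ccvg_unique c _; rewrite (_ : (fun _ => _) = fun=> 0); first exact: ccvg_cst.
by apply/funext => k; exact: fh0.
Qed.

(** Extended by 0, g integrates to 0 over every ray: a ray from s meets (0, 1) in the interval from
    max(s, 0) to 1, possibly empty. *)
Lemma ae0_of_itv (g : R -> R) : mu.-integrable I01 (EFin \o g) ->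
  (forall s t : R, 0 <= s -> s < t -> t <= 1 -> \int[mu]_(x in `]s, t[) g x = 0) ->
  {ae mu, forall x, I01 x -> g x = 0}.
Proof.
move=> ig g0.
have gi s t : 0 <= s -> s < t -> t <= 1 -> (\int[mu]_(x in `]s, t[) (g x)%:E = 0)%E.
  move=> s0 st t1; have := g0 s t s0 st t1; rewrite /Rintegral => h.
  rewrite -[LHS]fineK ?h//; apply: integrable_fin_num => //.
  apply: integrableS ig => //.
  move=> x /=; rewrite !in_itv/= => /andP[h2 h3].
  by rewrite (le_lt_trans s0)//= (lt_le_trans h3).
have igc : mu.-integrable setT (EFin \o (g \_ I01)).
  have := (@integrable_mkcond _ _ _ mu I01 (EFin \o g) mI).1 ig.
  congr (integrable _ _ _); apply/funext => x; rewrite /= /patch; case: ifP => //.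
have := @ae0_of_rays _ (g \_ I01) igc.
have E (A : set R) : measurable A -> (\int[mu]_(x in A) ((g \_ I01) x)%:E = \int[mu]_(x in A `&` I01) (g x)%:E)%E.
  move=> mA; rewrite integral_mkcondr; apply: eq_integral => x _.
  by rewrite /patch; case: ifP.
rewrite E// setTI gi// => /(_ erefl) => H.
suff HH s : (\int[mu]_(x in `]s, +oo[) ((g \_ I01) x)%:E = 0)%E.
  by apply: ae_mono (H HH) => x; rewrite /patch => h Ix; move: h; rewrite mem_set.
rewrite E//.
rewrite (_ : _ `&` _ = `]Num.max s 0, 1[%classic); last first.
  apply/seteqP; split=> x /=; rewrite !in_itv/= andbT gt_max.
    by move=> [-> /andP[-> ->]].
  by move=> /andP[/andP[-> ->] ->].
have [m1|m1] := ltP (Num.max s 0) 1.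
  by apply: gi => //; rewrite le_max lexx orbT.
rewrite set_itv_ge ?integral_set0// bnd_simp -leNgt//.
Qed.

Theorem coef_free_ae0 f : coef_free f -> {ae mu, forall x, I01 x -> f x = 0}.
Proof.
move=> Zf; have [i1 i2] := Zf.1.
have h1 : {ae mu, forall x, I01 x -> Re (f x) = 0}.
  apply: ae0_of_itv => // s t s0 st t1.
  by have [] := coef_free_itv Zf s0 st t1.
have h2 : {ae mu, forall x, I01 x -> Im (f x) = 0}.
  apply: ae0_of_itv => // s t s0 st t1.
  by have [] := coef_free_itv Zf s0 st t1.
apply: ae_mono2 h1 h2 => x e1 e2 Ix.
by apply/eqP; rewrite eq_complex /= e1// e2// !eqxx.
Qed.

End Uniqueness_of_coefficients.

(** The position of m relative to the two indices that a symmetric sum gains from N to N + 1. *)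
Lemma absz_case (m : int) (N : nat) :
  [\/ [/\ (`|m| <= N)%N, (`|m| <= N.+1)%N, N.+1%:Z <> m & - N.+1%:Z <> m],
      N.+1%:Z = m, - N.+1%:Z = m |
      [/\ (N.+1 < `|m|)%N, N.+1%:Z <> m & - N.+1%:Z <> m]].
Proof.
have [h|h] := leqP `|m| N; first by constructor 1; split; lia.
have [e|e] := eqVneq N.+1%:Z m; first by constructor 2.
have [e'|e'] := eqVneq (- N.+1%:Z) m; first by constructor 3.
by constructor 4; split; lia.
Qed.

(** * Orthonormality, Riesz-Fischer and Parseval on (0, 1) *)

Section Fourier_series.
Variable R : realType.
Notation mu := (@lebesgue_measure R).
Notation I01 := (`]0%R, 1%R[%classic : set R).
Implicit Types (f g : R -> R[i]) (c : int -> R[i]).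
Let mI := @measurable_I01 R.

Lemma lebesgue_measure_I01 : mu I01 = 1%E.
Proof. by rewrite lebesgue_measure_itv/= lte_fin ltr01 oppr0 adde0. Qed.

(** The hypotheses make w a nonzero multiple of 2 pi, so the antiderivatives take equal values at 0
    and 1. *)
Lemma integral_expo_re (w : R) : w != 0 -> sin w = 0 -> cos w = 1 ->
  \int[mu]_(x in I01) cos (w * x) = 0 /\ \int[mu]_(x in I01) sin (w * x) = 0.
Proof.
move=> w0 sw cw.
have dlin (x : R) : is_derive x 1 (fun x => w * x) w.
  by have := @is_deriveZ _ _ _ id w x 1 1 _; rewrite scaler1; apply.
have ds (x : R) : is_derive x 1 (fun x => w^-1 * sin (w * x)) (cos (w * x)).
  have := is_derive1_comp (is_derive_sin (w * x)) (dlin x).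
  move=> /(@is_deriveZ _ _ _ _ w^-1); congr (is_derive _ _ _ _).
  by rewrite /GRing.scale /= mulrC -mulrA divff// mulr1.
have dc (x : R) : is_derive x 1 (fun x => - w^-1 * cos (w * x)) (sin (w * x)).
  have := is_derive1_comp (is_derive_cos (w * x)) (dlin x).
  move=> /(@is_deriveZ _ _ _ _ (- w^-1)); congr (is_derive _ _ _ _).
  by rewrite /GRing.scale /=; field.
have cont (F f : R -> R) : (forall x : R, is_derive x 1 F (f x)) -> continuous F.
  by move=> h x; apply/differentiable_continuous/derivable1_diffP; case: (h x).
have c1 (h : R -> R) : continuous h -> continuous (fun x : R => h (w * x)).
  move=> hc x; apply: (@continuous_comp _ _ _ (fun x => w * x) h); last exact: hc.
  exact: (cont _ _ dlin).
have ftc (F f : R -> R) : (forall x : R, is_derive x 1 F (f x)) -> continuous f ->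
    \int[mu]_(x in I01) f x = F 1 - F 0.
  move=> dF cf; rewrite /Rintegral.
  have mf : measurable_fun setT f by exact: continuous_measurable_fun.
  rewrite integral_itv_obnd_cbnd; last by apply/measurable_EFinP; exact: measurable_funTS.
  rewrite integral_itv_bndo_bndc; last by apply/measurable_EFinP; exact: measurable_funTS.
  rewrite (@continuous_FTC2 _ f F 0 1)//.
  - exact: continuous_subspaceT.
  - split.
    + by move=> x _; case: (dF x).
    + by apply: cvg_at_right_filter; exact: (cont _ _ dF).
    + by apply: cvg_at_left_filter; exact: (cont _ _ dF).
  - by move=> x _; rewrite derive1E; case: (dF x).
split.
  rewrite (ftc _ _ ds); last exact/c1/continuous_cos.
  by rewrite mulr1 mulr0 sw sin0 mulr0 subrr.
rewrite (ftc _ _ dc); last exact/c1/continuous_sin.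
by rewrite mulr1 mulr0 cw cos0 subrr.
Qed.

Lemma cintegral_expo (k : int) : cintegral I01 (@expo R k) = (k == 0)%:R.
Proof.
have [->|k0] := eqVneq k 0.
  rewrite (eq_cintegral (g := fun=> 1)); last by move=> x _; exact: expo0.
  rewrite /cintegral !(@Rintegral_cst _ _ _ mu I01 mI) mul0r mul1r.
  by rewrite /= lebesgue_measure_I01.
have w0 : (2 * pi * k%:~R : R) != 0.
  by rewrite !mulf_neq0// ?intr_eq0// gt_eqF// pi_gt0.
have := @cis_2pi R k; rewrite /cis => /eqP; rewrite eq_complex /= => /andP[/eqP h1 /eqP h2].
by have [e1 e2] := integral_expo_re w0 h2 h1; rewrite /cintegral /= e1 e2.
Qed.

Lemma in_L2_expo (n : int) : in_L2 I01 (@expo R n).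
Proof.
split; first exact: cmeasurable_expo.
rewrite /sqnorm (_ : integral _ _ _ = 1%E) ?ltry//.
rewrite -[RHS]lebesgue_measure_I01 -[RHS]mul1e -(@integral_cst _ _ _ mu I01 mI).
by apply: eq_integral => x _; rewrite cabs_expo expr1n.
Qed.

(** The sign is that of the theorem: index n stands for the frequency -n, both here and in
    [trig_sum]. *)
Definition coef f (n : int) : R[i] := L2dot I01 f (expo (- n)).

Definition trig_sum c (N : nat) (x : R) : R[i] :=
  partial_zsum (fun n => c n * expo (- n) x) N.

Lemma coefE f n : coef f n = cintegral I01 (fun x => f x * expo n x).
Proof. by apply: eq_cintegral => x _; rewrite -expoN opprK. Qed.

Lemma coef_expo (n m : int) : coef (expo (- n)) m = (n == m)%:R.
Proof.
rewrite coefE (eq_cintegral (g := expo (m - n))).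
  by rewrite cintegral_expo subr_eq0 eq_sym.
by move=> x _; rewrite addrC expoD.
Qed.

Lemma partial_zsumE c N : partial_zsum c N = psum c N.
Proof. by []. Qed.

Lemma trig_sum0 c x : trig_sum c 0 x = c 0 * expo (- 0) x.
Proof. exact: psum0. Qed.

Lemma trig_sumS c N x : trig_sum c N.+1 x = trig_sum c N x +
  (c N.+1%:Z * expo (- N.+1%:Z) x + c (- N.+1%:Z) * expo (- - N.+1%:Z) x).
Proof. exact: psumS. Qed.

Lemma in_L2_term c n : in_L2 I01 (fun x => c n * expo (- n) x).
Proof. by apply: in_L2Z => //; exact: in_L2_expo. Qed.

Lemma in_L2_trig_sum c N : in_L2 I01 (trig_sum c N).
Proof.
elim: N => [|N ih].
  by rewrite (funext (trig_sum0 c)); exact: in_L2_term.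
rewrite (funext (trig_sumS c N)).
by do 2 apply: in_L2D => //; exact: in_L2_term.
Qed.

Lemma L2dot_trig_sum c N f : in_L2 I01 f ->
  L2dot I01 (trig_sum c N) f = partial_zsum (fun n => c n * conjc (coef f n)) N.
Proof.
move=> f2.
have tE n : L2dot I01 (fun x => c n * expo (- n) x) f = c n * conjc (coef f n).
  by rewrite L2dotZl -?L2dot_conj//; exact: in_L2_expo.
elim: N => [|N ih].
  by rewrite (funext (trig_sum0 c)) tE partial_zsumE psum0.
rewrite (funext (trig_sumS c N)) partial_zsumE psumS.
rewrite L2dotDl// ?ih ?partial_zsumE; last 2 first.
- exact: in_L2_trig_sum.
- by apply: in_L2D => //; exact: in_L2_term.
by congr (_ + _); rewrite L2dotDl ?tE//; exact: in_L2_term.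
Qed.

Lemma psum_delta (V : pzRingType) (d : int -> V) m N :
  psum (fun n => d n * (n == m)%:R) N = if (`|m| <= N)%N then d m else 0.
Proof.
elim: N => [|N ih].
  rewrite psum0 leqn0 absz_eq0 eq_sym.
  by case: eqP => [->|_]; rewrite ?mulr1 ?mulr0.
rewrite psumS {}ih.
case: (absz_case m N) => [[h1 h2 /eqP/negPf h3 /eqP/negPf h4]|h|h|[h1 /eqP/negPf h3 /eqP/negPf h4]].
- by rewrite h1 h2 h3 h4 !mulr0 !addr0.
- have h1 : (`|m| <= N)%N = false by rewrite -h /= ltnn.
  have h2 : (`|m| <= N.+1)%N by rewrite -h.
  have h4 : (- N.+1%:Z == m) = false by rewrite -h.
  by rewrite h1 h2 h4 h eqxx mulr1 mulr0 addr0 add0r.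
- have h1 : (`|m| <= N)%N = false by rewrite -h abszN /= ltnn.
  have h2 : (`|m| <= N.+1)%N by rewrite -h abszN.
  have h4 : (N.+1%:Z == m) = false by rewrite -h.
  by rewrite h1 h2 h4 h eqxx mulr1 mulr0 !add0r.
- have h2 : (`|m| <= N)%N = false by apply/negbTE; rewrite -ltnNge ltnW.
  have h5 : (`|m| <= N.+1)%N = false by apply/negbTE; rewrite -ltnNge.
  by rewrite h2 h3 h4 h5 !mulr0 !addr0.
Qed.

Lemma eq_psum_in (V : zmodType) (d e : int -> V) N :
  (forall n, (`|n| <= N)%N -> d n = e n) -> psum d N = psum e N.
Proof.
move=> de; apply: eq_bigr => i _; apply: de; have := ltn_ord i; lia.
Qed.

Lemma psum_trunc (V : zmodType) (d : int -> V) N M : (N <= M)%N ->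
  psum (fun n => if (`|n| <= N)%N then d n else 0) M = psum d N.
Proof.
elim: M => [|M ih].
  by rewrite leqn0 => /eqP ->; rewrite !psum0.
rewrite leq_eqVlt => /orP[/eqP ->|NM]; first by apply: eq_psum_in => n ->.
have e1 : (`|M.+1%:Z| <= N)%N = false by apply/negbTE; rewrite -ltnNge.
have e2 : (`|(- M.+1%:Z)%R| <= N)%N = false by apply/negbTE; rewrite abszN -ltnNge.
by rewrite psumS ih// e1 ?e2 !addr0.
Qed.

Lemma coef_trig_sum c N m : coef (trig_sum c N) m = if (`|m| <= N)%N then c m else 0.
Proof.
rewrite /coef L2dot_trig_sum; last exact: in_L2_expo.
rewrite -psum_delta; apply: eq_bigr => i _; congr (_ * _).
by rewrite coef_expo eq_sym; case: eqP => _; rewrite ?conjc1 ?conjc0.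
Qed.

Lemma nrm2_trig_sum c N : nrm2 I01 (trig_sum c N) = psum (fun n => cabs (c n) ^+ 2) N.
Proof.
have h := L2dot_trig_sum c N (in_L2_trig_sum c N).
rewrite (L2dotxx mI) in h.
have -> : nrm2 I01 (trig_sum c N) = Re (real_complex R (nrm2 I01 (trig_sum c N))) by [].
rewrite h Re_partial_zsum; apply: eq_psum_in => n nN.
by rewrite coef_trig_sum nN mulc_conj.
Qed.

Lemma trig_sumB c N M x : (N <= M)%N -> trig_sum c M x - trig_sum c N x =
  trig_sum (fun n => if (`|n| <= N)%N then 0 else c n) M x.
Proof.
move=> NM; apply/eqP; rewrite subr_eq; apply/eqP.
rewrite /trig_sum !partial_zsumE.
rewrite -(psum_trunc _ NM) -psumD; apply: eq_psum => n.
by case: ifP => _; rewrite ?mul0r ?add0r ?addr0.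
Qed.

Lemma nrm2_trig_sumB c N M : (N <= M)%N ->
  nrm2 I01 (fun x => trig_sum c M x - trig_sum c N x) =
  psum (fun n => cabs (c n) ^+ 2) M - psum (fun n => cabs (c n) ^+ 2) N.
Proof.
move=> NM; rewrite (funext (fun x => trig_sumB c x NM)) nrm2_trig_sum.
apply/eqP; rewrite eq_sym subr_eq; apply/eqP.
rewrite -[X in _ = _ + X](psum_trunc _ NM) -psumD; apply: eq_psum => n.
by case: ifP => _; rewrite ?cabs0 ?expr0n ?add0r ?addr0.
Qed.

Lemma nrm2_sym (A : set R) f g :
  nrm2 A (fun x => f x - g x) = nrm2 A (fun x => g x - f x).
Proof.
congr fine; apply: eq_integral => x _; congr (_ ^+ 2)%:E.
by rewrite -opprB /cabs normcN.
Qed.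

(** By orthonormality the squared distance between two partial sums is a difference of partial sums
    of |c_n|^2. These are monotone and bounded, so the trigonometric sums are Cauchy. *)
Theorem riesz_fischer c : in_l2 c ->
  exists g, [/\ in_L2 I01 g, L2cvg I01 (trig_sum c) g & coef g = c].
Proof.
move=> /in_l2P[M cM]; pose s := psum (fun n => cabs (c n) ^+ 2).
have sc : cvgn s.
  apply: nondecreasing_is_cvgn; first by apply: psum_nondecreasing => n; exact: sqr_ge0.
  by exists M => _ [n _ <-]; exact: cM.
have smon : nondecreasing_seq s by apply: psum_nondecreasing => n; exact: sqr_ge0.
have [g g2 cg] : exists2 g, in_L2 I01 g & L2cvg I01 (trig_sum c) g.
  apply: L2_complete => // [n|e e0]; first exact: in_L2_trig_sum.
  have [K _ hK] := ((cvgrPdist_lt _ _).1 sc) e e0.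
  exists K.
  have H m n : (K <= n)%N -> (n <= m)%N ->
      nrm2 I01 (fun x => trig_sum c m x - trig_sum c n x) < e.
    move=> Kn nm; rewrite nrm2_trig_sumB//.
    have := hK n Kn; rewrite /= ltr_norml => /andP[_].
    have := nondecreasing_cvgn_le smon sc m; rewrite -/s; lra.
  move=> m n Km Kn; have [mn|/ltnW nm] := leqP m n.
    by rewrite nrm2_sym H.
  exact: H.
exists g; split => //; apply/funext => m.
(* Tested against a single exponential, the partial sums have the constant coefficient c m from rank
   |m| on. *)
have := L2dot_cvg mI (in_L2_trig_sum c) g2 (in_L2_expo (- m)) cg.
move=> /ccvg_unique; apply; apply: ccvg_near_eq.
by exists `|m|%N => // N /= mN; rewrite -[LHS]/(coef _ m) coef_trig_sum mN.
Qed.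

Lemma ae_eq_of_coef f g : cintegrable I01 f -> cintegrable I01 g ->
  coef f = coef g -> {ae mu, forall x, I01 x -> f x = g x}.
Proof.
move=> i1 i2 fg.
have ie h n : cintegrable I01 h -> cintegrable I01 (fun x => h x * expo n x).
  move=> ih; apply: (@cintegrableMr _ _ _ 1) => // [|x]; first exact: cmeasurable_expo.
  by rewrite cabs_expo.
have : coef_free (fun x => f x - g x).
  split; first exact: cintegrableB.
  move=> n; rewrite (eq_cintegral (g := fun x => f x * expo n x - g x * expo n x)).
    rewrite (cintegralB mI (ie f n i1) (ie g n i2)) -(coefE f n) -(coefE g n) fg subrr//.
  by move=> x _; rewrite mulrBl.
move=> /coef_free_ae0; apply: ae_mono => x h Ix; apply/eqP.
by rewrite -subr_eq0 h.
Qed.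

Lemma in_L2_I01_cintegrable f : in_L2 I01 f -> cintegrable I01 f.
Proof.
apply: in_L2_cintegrable => //.
by rewrite lebesgue_measure_I01 ltry.
Qed.

(** Expansion of ||f - S_N||^2 >= 0, with S_N the partial sum of the Fourier series of f: the cross
    term is -2 ||S_N||^2. *)
Theorem bessel f : in_L2 I01 f -> in_l2 (coef f).
Proof.
move=> f2; apply/in_l2P; exists (nrm2 I01 f) => N.
have S2 := in_L2_trig_sum (coef f) N; have mS2 := in_L2Z mI (-1) S2.
have := nrm2_ge0 I01 (fun x => f x + (-1) * trig_sum (coef f) N x).
rewrite nrm2D// nrm2Z// nrm2_trig_sum L2dotZr// (L2dot_conj mI S2 f2) L2dot_trig_sum//.
set z := partial_zsum _ _; have -> : cabs (-1 : R[i]) ^+ 2 = 1.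
  by rewrite cabs_sqr /= sqrrN expr1n oppr0 expr0n addr0.
have -> : Re (conjc (-1) * conjc z) = - psum (fun n => cabs (coef f n) ^+ 2) N.
  have -> : Re (conjc (-1) * conjc z) = - Re z by case: (z) => a b /=; ring.
  by rewrite Re_partial_zsum; congr (- _); apply: eq_psum => n; rewrite mulc_conj.
lra.
Qed.

Theorem in_L2_of_coef f : cintegrable I01 f -> in_l2 (coef f) -> in_L2 I01 f.
Proof.
move=> i1 /riesz_fischer[g [g2 _ gE]].
apply: (@ae_eq_in_L2 _ _ mI f g) => //; first exact: cintegrable_cmeasurable i1.
by apply: ae_eq_of_coef => //; exact: in_L2_I01_cintegrable.
Qed.

(** Completeness of the exponentials: the Riesz-Fischer limit has the coefficients of f, hence is f
    by uniqueness in L^1. *)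
Theorem trig_sum_cvg f g : in_L2 I01 f -> in_L2 I01 g ->
  L2cvg I01 (trig_sum (coef f)) g <-> {ae mu, forall x, I01 x -> f x = g x}.
Proof.
move=> f2 g2; split=> [cg|fg].
  apply: ae_eq_of_coef; try exact: in_L2_I01_cintegrable.
  apply/funext => m.
  have := L2dot_cvg mI (in_L2_trig_sum (coef f)) g2 (in_L2_expo (- m)) cg.
  move=> /ccvg_unique h; apply/esym/h; apply: ccvg_near_eq.
  by exists `|m|%N => // N /= mN; rewrite -[LHS]/(coef _ m) coef_trig_sum mN.
have [h [h2 hc hE]] := riesz_fischer (bessel f2).
have hf : {ae mu, forall x, I01 x -> h x = g x}.
  have := ae_eq_of_coef (in_L2_I01_cintegrable h2) (in_L2_I01_cintegrable f2) hE.
  by apply: ae_mono2 fg => x e1 e2 Ix; rewrite e2// e1.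
rewrite /L2cvg (_ : (fun _ => _) =
  (fun k => sqnorm I01 (fun x => trig_sum (coef f) k x - h x))%R)//.
apply/funext => k; have mS := (in_L2_trig_sum (coef f) k).1.
apply: ae_eq_sqnorm => //.
- by apply: cmeasurableB => //; case: g2.
- by apply: cmeasurableB => //; case: h2.
- by apply: ae_mono hf => x e Ix; rewrite e.
Qed.

Theorem parseval f g : in_L2 I01 f -> in_L2 I01 g ->
  ccvg (partial_zsum (fun n => coef f n * conjc (coef g n))) (L2dot I01 f g).
Proof.
move=> f2 g2.
have cf : L2cvg I01 (trig_sum (coef f)) f by apply/trig_sum_cvg => //; exact: aeW.
have := L2dot_cvg mI (in_L2_trig_sum (coef f)) f2 g2 cf.
by congr ccvg; apply/funext => N; rewrite L2dot_trig_sum.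
Qed.

Lemma parseval_nrm2 f : in_L2 I01 f ->
  psum (fun n => cabs (coef f n) ^+ 2) @ \oo --> nrm2 I01 f.
Proof.
move=> f2; have [+ _] := parseval f2 f2; rewrite (L2dotxx mI) /=.
rewrite (_ : _ \o _ = psum (fun n => cabs (coef f n) ^+ 2))//.
apply/funext => N; rewrite /comp Re_partial_zsum.
by apply: eq_psum => n; rewrite mulc_conj.
Qed.

End Fourier_series.

(** * The Fourier transform on L^2 *)

Section Fourier_transform_L1.
Variable R : realType.
Notation I0 := (`[0%R, 1%R[%classic : set R).
Notation mu := (@lebesgue_measure R).
Notation I01 := (`]0%R, 1%R[%classic : set R).
Implicit Types (f g : R -> R[i]).
Let mI := @measurable_I01 R.

Lemma measurable_fourier_phase A (y : R) : measurable_fun A (fun x : R => - (2 * pi * x * y)).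
Proof.
rewrite (_ : (fun _ => _) = (fun x : R => - (2 * pi * y) * x)).
  by apply: measurable_funM => //; exact: measurable_cst.
by apply/funext => x; ring.
Qed.

Lemma cabs_cis_le (t : R) : cabs (cis t) <= 1.
Proof. by rewrite cabs_cis. Qed.

Lemma cintegrable_fourier f (y : R) : cintegrable setT f ->
  cintegrable setT (fun x => f x * cis (- (2 * pi * x * y))).
Proof.
move=> i; have := @cintegrableM_bounded _ setT measurableT
  (fun x => cis (- (2 * pi * x * y))) 1 f _ _ i.
move=> /(_ (cmeasurable_cis (measurable_fourier_phase _)) (fun x _ => cabs_cis_le _)).
by apply: eq_cintegrable => // x _; rewrite mulrC.
Qed.

Lemma fourier1D f g : cintegrable setT f -> cintegrable setT g ->
  fourier1 (fun x => f x + g x) = (fun y => fourier1 f y + fourier1 g y).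
Proof.
move=> i j; apply/funext => y; rewrite /fourier1 -cintegralD//; try exact: cintegrable_fourier.
by apply: eq_cintegral => x _; rewrite mulrDl.
Qed.

Lemma fourier1Z (k : R[i]) f : cintegrable setT f ->
  fourier1 (fun x => k * f x) = (fun y => k * fourier1 f y).
Proof.
move=> i; apply/funext => y; rewrite /fourier1 -cintegralZ//; last exact: cintegrable_fourier.
by apply: eq_cintegral => x _; rewrite mulrA.
Qed.

Lemma fourier1B f g : cintegrable setT f -> cintegrable setT g ->
  fourier1 (fun x => f x - g x) = (fun y => fourier1 f y - fourier1 g y).
Proof.
move=> i j; rewrite (_ : (fun x => f x - g x) = (fun x => f x + (-1) * g x)); last first.
  by apply/funext => x; rewrite mulN1r.
rewrite fourier1D//; last exact: cintegrableZ.
by rewrite fourier1Z//; apply/funext => y; rewrite mulN1r.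
Qed.

Lemma ccvg_cis (t : nat -> R) (l : R) : t @ \oo --> l ->
  ccvg (fun n => cis (t n)) (cis l).
Proof.
move=> tl; split => /=; apply: continuous_cvg tl;
  [exact: continuous_cos|exact: continuous_sin].
Qed.

(** Sequential continuity of the transform, by dominated convergence; it is the source of the
    measurability of [fourier1 f]. *)
Lemma fourier1_cvg f (t : nat -> R) (y : R) : cintegrable setT f -> t @ \oo --> y ->
  ccvg (fun n => fourier1 f (t n)) (fourier1 f y).
Proof.
move=> i ty; have mf := cintegrable_cmeasurable i.
have mm y' : cmeasurable setT (fun x => f x * cis (- (2 * pi * x * y'))).
  exact: cintegrable_cmeasurable (cintegrable_fourier _ i).
have [] := @cdominated_convergence _ setT measurableT
  (fun n x => f x * cis (- (2 * pi * x * t n)))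
  (fun x => f x * cis (- (2 * pi * x * y))) (EFin \o (fun x => cabs (f x))) => //.
- apply: aeW => x _; apply: ccvgM; first exact: ccvg_cst.
  apply: ccvg_cis; apply: cvgN; apply: cvgM => //; exact: cvg_cst.
- exact: integrable_cabs.
- by apply: aeW => x n _; rewrite cabsM cabs_cis mulr1.
Qed.

Lemma cmeasurable_fourier1 A f : cintegrable setT f -> cmeasurable A (fourier1 f).
Proof.
move=> i; suff : cmeasurable setT (fourier1 f) by apply: cmeasurableS.
split; apply: continuous_measurable_fun => y; apply/(@cvg_nbhsP _ R^o) => t ty;
  by have [] := fourier1_cvg i ty.
Qed.

(* With [x = L u - L/2], the samples of the transform at the points
   [(s - n) / L] are, up to a phase, Fourier coefficients on [0, 1]. *)
Lemma fourier1_sample f (L s : R) (n : int) : 0 < L -> cintegrable setT f ->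
  (forall x, ~ (- (L / 2) < x < L / 2) -> f x = 0) ->
  fourier1 f ((s - n%:~R) / L) =
  real_complex R L * cis (pi * (s - n%:~R)) *
  coef (fun u => f (L * u - L / 2) * cis (- (2 * pi * u * s))) n.
Proof.
move=> L0 i supp; have Ln0 : L != 0 by rewrite gt_eqF.
pose H x := f x * cis (- (2 * pi * x * ((s - n%:~R) / L))).
have iH : cintegrable setT H := cintegrable_fourier _ i.
pose G u := f (L * u - L / 2) * cis (- (2 * pi * u * s)) * expo n u.
have [iA eA] := cintegral_affine (- (L / 2)) L0 iH.
have HG u : H (L * u - L / 2) = cis (pi * (s - n%:~R)) * G u.
  rewrite /H /G /expo (_ : - (2 * pi * (L * u - L / 2) * ((s - n%:~R) / L)) =
    pi * (s - n%:~R) + (- (2 * pi * u * s) + 2 * pi * n%:~R * u)); last by field.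
  by rewrite !cisD; ring.
rewrite -[LHS]/(cintegral setT H).
have -> : cintegral setT H = real_complex R L * (real_complex R L^-1 * cintegral setT H).
  by rewrite mulrA -rmorphM divff// mul1r.
rewrite -eA -mulrA; congr (_ * _).
rewrite (eq_cintegral (g := fun u => cis (pi * (s - n%:~R)) * G u)); last by move=> u _; exact: HG.
have iG : cintegrable setT G.
  have := cintegrableZ measurableT (cis (- (pi * (s - n%:~R)))) iA.
  apply: eq_cintegrable => // u _.
  by rewrite HG mulrA -cisD addNr cis0 mul1r.
rewrite cintegralZ//; congr (_ * _).
rewrite coefE -[RHS]cintegral_cut; apply: eq_cintegral => u _.
have [uI|uI] := pselect (I01 u); first by rewrite cutE.
rewrite cutN// /G supp ?mul0r// => /andP[h1 h2]; apply: uI.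
rewrite /= in_itv/=; apply/andP; split.
  by rewrite -(@pmulr_rgt0 _ L)//; lra.
by rewrite -(@ltr_pM2l _ L)// mulr1; lra.
Qed.

Lemma plancherel_compact f (L : R) : 0 < L -> in_L2 setT f -> cintegrable setT f ->
  (forall x, ~ (- (L / 2) < x < L / 2) -> f x = 0) ->
  sqnorm setT (fourier1 f) = sqnorm setT f.
Proof.
move=> L0 f2 i supp; have Ln0 : L != 0 by rewrite gt_eqF.
have f2' := in_L2_affine (- (L / 2)) L0 f2.
have f2I : in_L2 I01 (fun u => f (L * u - L / 2)) by apply: in_L2S f2'.
have nI : sqnorm I01 (fun u => f (L * u - L / 2)) = (L^-1 * nrm2 setT f)%:E.
  rewrite EFinM -nrm2E// -(@sqnorm_affine _ L (- (L / 2)) setT)//; last by case: f2.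
  rewrite preimage_affine_setT -sqnorm_cut; apply: eq_sqnorm => u _.
  have [uI|uI] := pselect (I01 u); first by rewrite cutE.
  rewrite cutN// supp// => /andP[h1 h2]; apply: uI.
  rewrite /= in_itv/=; apply/andP; split.
    by rewrite -(@pmulr_rgt0 _ L)//; lra.
  by rewrite -(@ltr_pM2l _ L)// mulr1; lra.
pose g s u := f (L * u - L / 2) * cis (- (2 * pi * u * s)).
have mcis s : cmeasurable I01 (fun u => cis (- (2 * pi * u * s))).
  exact: (cmeasurable_cis (measurable_fourier_phase s)).
have g2 s : in_L2 I01 (g s).
  have := in_L2M_bounded mI (mcis s) (fun x _ => cabs_cis_le _) f2I.
  by congr (in_L2 _ _); apply/funext => u; rewrite /g mulrC.
have gn s : nrm2 I01 (g s) = L^-1 * nrm2 setT f.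
  rewrite /nrm2 -[RHS]/(fine (L^-1 * nrm2 setT f)%:E) -nI; congr fine; apply: eq_integral => u _.
  by rewrite cabsM cabs_cis mulr1.
pose G s := cabs (fourier1 f (s / L)) ^+ 2.
have mF := cmeasurable_fourier1 setT i.
have mdiv : measurable_fun setT (fun s : R => s / L).
  by apply: measurable_funM => //; exact: measurable_cst.
have mG : measurable_fun setT G.
  apply: measurable_cabs_sqr; exact: cmeasurable_comp mdiv mF.
have G0 s : 0 <= G s by exact: sqr_ge0.
have GE s (n : int) : G (s - n%:~R) = L ^+ 2 * cabs (coef (g s) n) ^+ 2.
  have e : cabs (real_complex R L) ^+ 2 = L ^+ 2 by rewrite cabs_sqr /= expr0n addr0.
  by rewrite /G fourier1_sample// !cabsM cabs_cis mulr1 exprMn e.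
(* The phases of the samples have modulus 1, so the sum over all samples does not depend on s. Its
   constant is L^2, from [fourier1_sample], times 1/L, from the dilation of f. *)
have Glim s : psum (fun n => G (s - n%:~R)) @ \oo --> L * nrm2 setT f.
  have -> : L * nrm2 setT f = L ^+ 2 * nrm2 I01 (g s) by rewrite gn; field.
  rewrite (_ : psum _ = (fun N => L ^+ 2 * psum (fun n => cabs (coef (g s) n) ^+ 2) N)).
    by apply: cvgM; [exact: cvg_cst|exact: parseval_nrm2].
  by apply/funext => N; rewrite -psumZ; apply: eq_psum => n; exact: GE.
have mJ : measurable I0 by exact: measurable_itv.
have h1 := ge0_integral_unfold mG G0.
have ms N : measurable_fun I0 (fun s => (psum (fun n => G (s - n%:~R)) N)%:E).
  apply/measurable_EFinP; apply: measurable_sum => k.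
  apply: measurable_funTS; apply: (measurableT_comp mG).
  by apply: measurable_funB => //; exact: measurable_cst.
have s0 N s : I0 s -> (0 <= (psum (fun n => G (s - n%:~R)) N)%:E)%E.
  by move=> _; rewrite lee_fin psum_ge0.
have sm s : I0 s -> nondecreasing_seq (fun N => (psum (fun n => G (s - n%:~R)) N)%:E).
  by move=> _ N M NM; rewrite lee_fin; apply: psum_nondecreasing.
have := etrans (@monotone_convergence _ _ _ mu _ mJ _ ms s0 sm)
  (cvg_lim (@ereal_hausdorff R) h1).
rewrite (_ : integral _ _ _ = (L * nrm2 setT f)%:E); last first.
  rewrite -[RHS]mule1 (_ : 1%E = mu I0); last first.
    by rewrite lebesgue_measure_itv/= lte_fin ltr01 oppr0 adde0.
  rewrite -(@integral_cst _ _ _ mu _ mJ); apply: eq_integral => s _.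
  by apply/cvg_lim => //; apply/fine_cvgP; split; [exact: nearW|exact: Glim].
have mF2 : measurable_fun setT (fun y => (cabs (fourier1 f y) ^+ 2)%:E).
  by apply/measurable_EFinP; exact: measurable_cabs_sqr.
have Li0 : 0 < L^-1 by rewrite invr_gt0.
have := @ge0_integralT_affine _ L^-1 0 (fun y => (cabs (fourier1 f y) ^+ 2)%:E) Li0 mF2.
rewrite invrK => aff.
rewrite (_ : (\int[mu]_x (G x)%:E)%E = (L%:E * sqnorm setT (fourier1 f))%E); last first.
  rewrite -aff; last by move=> x; rewrite lee_fin sqr_ge0.
  by apply: eq_integral => s _; rewrite addr0 mulrC.
move=> h; rewrite (nrm2E f2).
have -> : sqnorm setT (fourier1 f) = (L^-1%:E * (L%:E * sqnorm setT (fourier1 f)))%E.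
  by rewrite muleA -EFinM mulVf// mul1e.
by rewrite -h -EFinM mulKf.
Qed.

End Fourier_transform_L1.

(** * Plancherel's identity for functions in L^1 and L^2 *)

Section Plancherel.
Variable R : realType.
Implicit Types (f g h : R -> R[i]).
Let mT := @measurableT _ (measurableTypeR R).

(** The successor gives each window positive length, as [plancherel_compact] requires. *)
Definition window (k : nat) : set R := `]- k.+1%:R, k.+1%:R[%classic.

Lemma measurable_window k : measurable (window k).
Proof. exact: measurable_itv. Qed.

Lemma window_exhaust (x : R) : \forall k \near \oo, window k x.
Proof.
exists (Num.truncn `|x|).+1 => // k /= hk.
rewrite /window /= in_itv/= -ltr_norml; apply: lt_trans (truncnS_gt _) _.
by rewrite ltr_nat ltnS.
Qed.

Lemma window_le k j : (k <= j)%N -> window k `<=` window j.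
Proof.
move=> kj x; rewrite /window /= !in_itv/= -!ltr_norml => /lt_le_trans; apply.
by rewrite ler_nat ltnS.
Qed.

Lemma ccvg_cut_window f (x : R) : ccvg (fun k => cut (window k) f x) (f x).
Proof.
apply: ccvg_near_eq; apply: filterS (window_exhaust x) => k; exact: cutE.
Qed.

Lemma cabs_cut_le (A : set R) f x : cabs (cut A f x) <= cabs (f x).
Proof. by rewrite /cut; case: ifP => // _; rewrite cabs0 cabs_ge0. Qed.

Lemma in_L2T_cut (A : set R) f : measurable A -> in_L2 setT f -> in_L2 setT (cut A f).
Proof. by move=> mA f2; apply: in_L2_cut => //; apply: in_L2S f2. Qed.

Lemma cintegrableT_cut (A : set R) f : measurable A -> cintegrable setT f ->
  cintegrable setT (cut A f).
Proof. by move=> mA i; apply/cintegrable_cut => //; apply: cintegrableS i. Qed.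

Lemma cintegrable_cut_window k f : in_L2 setT f -> cintegrable setT (cut (window k) f).
Proof.
move=> f2; apply/cintegrable_cut; first exact: measurable_window.
apply: in_L2_cintegrable; first exact: measurable_window.
  rewrite lebesgue_measure_itv/=; case: ifP => _; last exact: ltry.
  by rewrite -EFinB ltry.
by apply: in_L2S f2 => //; exact: measurable_window.
Qed.

Lemma L2cvg_cut_window f : in_L2 setT f -> L2cvg setT (fun k => cut (window k) f) f.
Proof.
move=> f2; apply: L2cvg_dominated => //.
- move=> k; have [] // := in_L2T_cut (measurable_window k) f2.
- by move=> x _; exact: ccvg_cut_window.
- by move=> k x _; exact: cabs_cut_le.
Qed.

Lemma plancherel_window f k : in_L2 setT f -> cintegrable setT f ->
  (forall x, ~ window k x -> f x = 0) -> sqnorm setT (fourier1 f) = sqnorm setT f.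
Proof.
move=> f2 i supp; apply: (@plancherel_compact _ _ (2 * k.+1%:R)) => //.
have -> : 2 * k.+1%:R / 2 = k.+1%:R :> R by field.
by move=> x hx; apply: supp; rewrite /window /= in_itv.
Qed.

(** For f in L^1 the transforms of the truncations u_j converge pointwise. Fatou's lemma, applied in
    j to the transforms of u_k - u_j, bounds the distance from the k-th transform to the limit by
    ||u_k - f||, before the limit is known to be in L^2. *)
Theorem plancherel_L1L2 f : in_L2 setT f -> cintegrable setT f ->
  [/\ in_L2 setT (fourier1 f) , sqnorm setT (fourier1 f) = sqnorm setT f &
      L2cvg setT (fun k => fourier1 (cut (window k) f)) (fourier1 f)].
Proof.
move=> f2 i.
have mW := measurable_window.
pose u k := cut (window k) f.
have u2 k : in_L2 setT (u k) by exact: in_L2T_cut.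
have iu k : cintegrable setT (u k) by exact: cintegrableT_cut.
have isou k : sqnorm setT (fourier1 (u k)) = sqnorm setT (u k).
  by apply: (@plancherel_window _ k) => // x; exact: cutN.
have mF := cmeasurable_fourier1 setT i.
have mFu k := cmeasurable_fourier1 setT (iu k).
have Fu2 k : in_L2 setT (fourier1 (u k)).
  by split; [exact: mFu|rewrite isou; case: (u2 k)].
have bound k : (sqnorm setT (fun y => fourier1 (u k) y - fourier1 f y)%R <=
    sqnorm setT (fun x => u k x - f x)%R)%E.
  apply: (@fatou_sqnorm _ _ mT (fun j y => fourier1 (u k) y - fourier1 (u j) y)).
  - by move=> j; exact: cmeasurableB.
  - exact: cmeasurableB.
  - apply: aeW => y _.
    suff cf : ccvg (fun j => fourier1 (u j) y) (fourier1 f y).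
      have := ccvgD (ccvg_cst (fourier1 (u k) y)) (ccvgM (ccvg_cst (-1)) cf).
      rewrite mulN1r; congr (ccvg _ _).
      by apply/funext => j; rewrite mulN1r.
    have [] // := @cdominated_convergence _ setT mT
      (fun j x => u j x * cis (- (2 * pi * x * y)))
      (fun x => f x * cis (- (2 * pi * x * y))) (EFin \o (fun x => cabs (f x))).
    + by move=> j; exact: cintegrable_cmeasurable (cintegrable_fourier y (iu j)).
    + exact: cintegrable_cmeasurable (cintegrable_fourier y i).
    + apply: aeW => x _; apply: ccvgM; last exact: ccvg_cst.
      exact: ccvg_cut_window.
    + exact: integrable_cabs.
    + apply: aeW => x j _; rewrite lee_fin cabsM cabs_cis mulr1.
      exact: cabs_cut_le.
  (* For j >= k the difference u_k - u_j lives in [window j], where Plancherel is known, and is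
     dominated by u_k - f. *)
  - exists k => // j /= kj.
    rewrite -(fourier1B (iu k) (iu j)) (@plancherel_window _ j); last 3 first.
    + exact: in_L2B.
    + exact: cintegrableB.
    + move=> x jx; rewrite /u !cutN ?subrr// => kx; apply: jx; exact: window_le kx.
    apply: ge0_sqnorm_le => //.
    + by apply: cmeasurableB; [case: (u2 k)|case: (u2 j)].
    + by apply: cmeasurableB; [case: (u2 k)|case: f2].
    move=> x _; rewrite /u /cut; case: ifPn => hk.
      rewrite ifT ?subrr ?cabs0 ?cabs_ge0//.
      by apply/mem_set; apply: window_le kj _ _; exact: set_mem.
    case: ifPn => hj //; rewrite subrr cabs0; exact: cabs_ge0.
have uf : L2cvg setT u f := L2cvg_cut_window f2.
have cF : L2cvg setT (fun k => fourier1 (u k)) (fourier1 f).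
  apply: (@squeeze_cvge _ _ _ _ (fun=> 0%E) _ _ _ _ _ uf); last exact: cvg_cst.
  by apply: nearW => k; rewrite sqnorm_ge0 bound.
have F2 : in_L2 setT (fourier1 f).
  split=> //.
  have d2 : in_L2 setT (fun y => fourier1 (u 0%N) y - fourier1 f y).
    split; first exact: cmeasurableB.
    apply: le_lt_trans (bound 0%N) _.
    by have [] := in_L2B mT (u2 0%N) f2.
  have [_] := in_L2B mT (Fu2 0%N) d2.
  by rewrite (_ : (fun _ => _) = fourier1 f)//; apply/funext => y; rewrite subKr.
split => //.
have c1 := nrm2_cvg mT Fu2 F2 cF; have c2 := nrm2_cvg mT u2 f2 uf.
rewrite !nrm2E//; congr EFin; apply: cvg_unique c1 _ => //.
rewrite (_ : (fun k => _) = (fun k => nrm2 setT (u k)))//.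
by apply/funext => k; rewrite /nrm2 isou.
Qed.

Lemma L2cvg_comb (k : R[i]) (u v : nat -> R -> R[i]) f g :
  (forall n, in_L2 setT (u n)) -> (forall n, in_L2 setT (v n)) ->
  in_L2 setT f -> in_L2 setT g -> L2cvg setT u f -> L2cvg setT v g ->
  L2cvg setT (fun n x => k * u n x + v n x) (fun x => k * f x + g x).
Proof.
move=> u2 v2 f2 g2 uf vg.
have w2 n : in_L2 setT (fun x => k * u n x + v n x) by apply: in_L2D => //; exact: in_L2Z.
have h2 : in_L2 setT (fun x => k * f x + g x) by apply: in_L2D => //; exact: in_L2Z.
apply/(L2cvgP mT w2 h2).
have uf' := (L2cvgP mT u2 f2).1 uf; have vg' := (L2cvgP mT v2 g2).1 vg.
have bnd n : nrm2 setT (fun x => (k * u n x + v n x) - (k * f x + g x)) <=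
    2 * (cabs k ^+ 2 * nrm2 setT (fun x => u n x - f x)) + 2 * nrm2 setT (fun x => v n x - g x).
  have a2 := in_L2Z mT k (in_L2B mT (u2 n) f2); have b2 := in_L2B mT (v2 n) g2.
  rewrite -nrm2Z//; last exact: in_L2B.
  rewrite -lee_fin EFinD !EFinM -!nrm2E//; last exact: in_L2B.
  rewrite -!ge0_integralZl//; try (by move=> x _; rewrite lee_fin sqr_ge0);
    try (by rewrite lee_fin); try (by apply/measurable_EFinP; apply: measurable_cabs_sqr; case: a2);
    try (by apply/measurable_EFinP; apply: measurable_cabs_sqr; case: b2).
  have ma : measurable_fun setT (fun x => (2%:E * (cabs (k * (u n x - f x)) ^+ 2)%:E)%E).
    apply: measurable_funeM; apply/measurable_EFinP; apply: measurable_cabs_sqr; by case: a2.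
  have mb : measurable_fun setT (fun x => (2%:E * (cabs (v n x - g x) ^+ 2)%:E)%E).
    apply: measurable_funeM; apply/measurable_EFinP; apply: measurable_cabs_sqr; by case: b2.
  rewrite -ge0_integralD//; try (by move=> x _; rewrite -EFinM lee_fin mulr_ge0 ?sqr_ge0).
  apply: ge0_le_integral => //.
  - by move=> x _; rewrite lee_fin sqr_ge0.
  - apply/measurable_EFinP; apply: measurable_cabs_sqr.
    by apply: cmeasurableB; [case: (w2 n)|case: h2].
  - exact: emeasurable_funD.
  - move=> x _; rewrite -!EFinM -EFinD lee_fin.
    rewrite (_ : k * u n x + v n x - _ = k * (u n x - f x) + (v n x - g x)); last by ring.
    exact: cabsD_sqr.
apply: (@squeeze_cvgr _ _ _ _ (fun=> 0) (fun n => 2 * (cabs k ^+ 2 * nrm2 setT (fun x => u n x - f x)) +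
   2 * nrm2 setT (fun x => v n x - g x))); last 2 first.
- exact: cvg_cst.
- rewrite -[X in _ --> X]addr0 -{1}(mulr0 2) -{1}(mulr0 (cabs k ^+ 2)) -[X in _ --> _ + X](mulr0 2).
  by apply: cvgD; apply: cvgM => //; try exact: cvg_cst; apply: cvgM => //; exact: cvg_cst.
- by apply: nearW => n; rewrite nrm2_ge0 bnd.
Qed.

End Plancherel.

(** * Extension of the transform to L^2 *)

Section Fourier_graph.
Variable R : realType.
Notation mu := (@lebesgue_measure R).
Implicit Types (f g h w : R -> R[i]).
Let mT : measurable (setT : set R) := measurableT.

Lemma is_fourier_nrm2 f g : is_fourier f g -> nrm2 setT f = nrm2 setT g.
Proof.
move=> [f2 g2 [u [u12 uf ug]]].
have u2 k : in_L2 setT (u k) := (u12 k).2.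
have iu k : cintegrable setT (u k) by apply/(in_L1P mT); case: (u12 k).
have F2 k : in_L2 setT (fourier1 (u k)) by have [] := plancherel_L1L2 (u2 k) (iu k).
apply: cvg_unique (nrm2_cvg mT u2 f2 uf) _ => //.
rewrite (_ : (fun k => _) = (fun k => nrm2 setT (fourier1 (u k)))).
  exact: nrm2_cvg.
apply/funext => k; rewrite /nrm2.
by have [_ -> _] := plancherel_L1L2 (u2 k) (iu k).
Qed.

Lemma is_fourier_comb (k : R[i]) f g f' g' : is_fourier f g -> is_fourier f' g' ->
  is_fourier (fun x => k * f x + f' x) (fun y => k * g y + g' y).
Proof.
move=> [f2 g2 [u [u12 uf ug]]] [f'2 g'2 [v [v12 vf vg]]].
have u2 n : in_L2 setT (u n) := (u12 n).2.
have v2 n : in_L2 setT (v n) := (v12 n).2.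
have iu n : cintegrable setT (u n) by apply/(in_L1P mT); case: (u12 n).
have iv n : cintegrable setT (v n) by apply/(in_L1P mT); case: (v12 n).
have Fu2 n : in_L2 setT (fourier1 (u n)) by have [] := plancherel_L1L2 (u2 n) (iu n).
have Fv2 n : in_L2 setT (fourier1 (v n)) by have [] := plancherel_L1L2 (v2 n) (iv n).
split; try by apply: in_L2D => //; exact: in_L2Z.
exists (fun n x => k * u n x + v n x); split.
- move=> n; split; last by apply: in_L2D => //; exact: in_L2Z.
  by apply/(in_L1P mT); apply: cintegrableD => //; exact: cintegrableZ.
- exact: (L2cvg_comb k u2 v2 f2 f'2 uf vf).
- rewrite (_ : (fun n => _) = (fun n y => k * fourier1 (u n) y + fourier1 (v n) y)).
    exact: (L2cvg_comb k Fu2 Fv2 g2 g'2 ug vg).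
  apply/funext => n.
  by rewrite (fourier1D (cintegrableZ mT k (iu n)) (iv n)) (fourier1Z k (iu n)).
Qed.

Lemma nrm2_eq0 f : in_L2 setT f -> nrm2 setT f = 0 -> {ae mu, forall x, f x = 0}.
Proof.
move=> f2 f0; have := @sqnorm_eq0 _ _ mT f f2.1.
by rewrite nrm2E// f0 => /(_ erefl); apply: ae_mono => x; apply.
Qed.

Lemma L2cvg_ae (u : nat -> R -> R[i]) f g : (forall n, in_L2 setT (u n)) ->
  in_L2 setT f -> in_L2 setT g -> {ae mu, forall x, f x = g x} ->
  L2cvg setT u f -> L2cvg setT u g.
Proof.
move=> u2 f2 g2 fg; rewrite /L2cvg (_ : (fun _ => _) =
  (fun k => sqnorm setT (fun x => u k x - g x)%R))//.
apply/funext => k; apply: ae_eq_sqnorm => //.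
- by apply: cmeasurableB; [case: (u2 k)|case: f2].
- by apply: cmeasurableB; [case: (u2 k)|case: g2].
- by apply: ae_mono fg => x ->.
Qed.

(** The graph respects almost everywhere equality on both sides, so representatives may be replaced,
    for instance by pointwise bounded ones. *)
Lemma is_fourier_ae f g f' g' : is_fourier f g -> in_L2 setT f' -> in_L2 setT g' ->
  {ae mu, forall x, f x = f' x} -> {ae mu, forall y, g y = g' y} -> is_fourier f' g'.
Proof.
move=> [f2 g2 [u [u12 uf ug]]] f'2 g'2 ff' gg'; split => //.
have u2 n : in_L2 setT (u n) := (u12 n).2.
have iu n : cintegrable setT (u n) by apply/(in_L1P mT); case: (u12 n).
have Fu2 n : in_L2 setT (fourier1 (u n)) by have [] := plancherel_L1L2 (u2 n) (iu n).
by exists u; split => //; [apply: L2cvg_ae uf|apply: L2cvg_ae ug].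
Qed.

Lemma nrm2D_le f g : in_L2 setT f -> in_L2 setT g ->
  nrm2 setT (fun x => f x + g x) <= 2 * nrm2 setT f + 2 * nrm2 setT g.
Proof.
move=> f2 g2; rewrite nrm2D//.
have := nrm2_ge0 setT (fun x => f x + -1 * g x).
have g2' := in_L2Z mT (-1) g2.
rewrite nrm2D// nrm2Z// L2dotZr//.
have -> : cabs (-1 : R[i]) ^+ 2 = 1.
  by rewrite cabs_sqr /= sqrrN expr1n oppr0 expr0n addr0.
have -> : Re (conjc (-1) * L2dot setT f g) = - Re (L2dot setT f g).
  by case: (L2dot setT f g) => a b /=; ring.
lra.
Qed.

(** Truncations to windows lie in both L^1 and L^2, and Plancherel applied to their differences
    makes the transforms Cauchy. *)
Theorem is_fourier_exists f : in_L2 setT f -> exists g, is_fourier f g.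
Proof.
move=> f2; pose u k := cut (window k) f.
have u2 k : in_L2 setT (u k) by apply: in_L2T_cut => //; exact: measurable_window.
have iu k : cintegrable setT (u k) by exact: cintegrable_cut_window.
have Fu2 n : in_L2 setT (fourier1 (u n)) by have [] := plancherel_L1L2 (u2 n) (iu n).
have uf : L2cvg setT u f := L2cvg_cut_window f2.
have uf' := (L2cvgP mT u2 f2).1 uf.
have [g g2 ug] : exists2 g, in_L2 setT g & L2cvg setT (fun k => fourier1 (u k)) g.
  apply: L2_complete => // e e0.
  (* [nrm2D_le] doubles each of two squared norms below e/8, for a total below e/2. *)
  have e4 : 0 < e / 8 by rewrite divr_gt0.
  have [K _ hK] := ((cvgrPdist_lt _ _).1 uf') _ e4.
  exists K => m n Km Kn.
  have := hK m Km; have := hK n Kn; rewrite /= !sub0r !normrN !ger0_norm ?nrm2_ge0// => h1 h2.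
  rewrite -(fourier1B (iu m) (iu n)).
  have [_ e1 _] := plancherel_L1L2 (in_L2B mT (u2 m) (u2 n)) (cintegrableB mT (iu m) (iu n)).
  rewrite /nrm2 e1 -/(nrm2 setT _).
  rewrite (_ : (fun x => u m x - u n x) = (fun x => (u m x - f x) + (f x - u n x))); last first.
    by apply/funext => x; rewrite addrA subrK.
  apply: le_lt_trans (nrm2D_le (in_L2B mT (u2 m) f2) (in_L2B mT f2 (u2 n))) _.
  by rewrite (nrm2_sym _ f); lra.
exists g; split => //; exists u; split => // k; split => //.
exact/(in_L1P mT).
Qed.

Lemma fourierP f : in_L2 setT f -> is_fourier f (fourier f).
Proof. by move=> /is_fourier_exists[g fg]; rewrite /fourier; exact: xgetI fg. Qed.

Lemma in_L2_fourier f : in_L2 setT f -> in_L2 setT (fourier f).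
Proof. by move=> /fourierP[]. Qed.

(** Polarization; the factor 1 gives the sum the shape of [is_fourier_comb]. *)
Lemma Re_L2dotE f g : in_L2 setT f -> in_L2 setT g ->
  Re (L2dot setT f g) = (nrm2 setT (fun x => 1 * f x + g x) - nrm2 setT f - nrm2 setT g) / 2.
Proof.
move=> f2 g2; rewrite (_ : (fun x => 1 * f x + g x) = (fun x => f x + g x)).
  by rewrite nrm2D//; field.
by apply/funext => x; rewrite mul1r.
Qed.

Theorem is_fourier_dot f g f' g' : is_fourier f g -> is_fourier f' g' ->
  L2dot setT f f' = L2dot setT g g'.
Proof.
have key (a b a' b' : R -> R[i]) : is_fourier a b -> is_fourier a' b' ->
    Re (L2dot setT a a') = Re (L2dot setT b b').
  move=> ab a'b'; have [a2 b2 _] := ab; have [a'2 b'2 _] := a'b'.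
  rewrite (Re_L2dotE a2 a'2) (Re_L2dotE b2 b'2) (is_fourier_nrm2 ab) (is_fourier_nrm2 a'b').
  by rewrite (is_fourier_nrm2 (is_fourier_comb 1 ab a'b')).
move=> fg f'g'; have [f2 g2 _] := fg; have [f'2 g'2 _] := f'g'.
(* The zero pair makes multiplication by i an instance of [is_fourier_comb]; this multiplication
   reaches the imaginary part. *)
have s0 : is_fourier (fun=> 0 : R[i]) (fun=> 0).
  have := is_fourier_comb (-1) fg fg; congr is_fourier; apply/funext => x;
  by rewrite mulN1r addNr.
have i1 : is_fourier (fun x => Complex 0 1 * f' x) (fun x => Complex 0 1 * g' x).
  have := is_fourier_comb (Complex 0 1) f'g' s0.
  by congr is_fourier; apply/funext => x; rewrite addr0.
apply/eqP; rewrite eq_complex (key _ _ _ _ fg f'g') eqxx andTb.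
by rewrite (Im_L2dot mT f2 f'2) (Im_L2dot mT g2 g'2) (key _ _ _ _ fg i1).
Qed.

End Fourier_graph.

(** * The multiplication formula, by Fubini's theorem *)

Section Multiplication_formula.
Variable R : realType.
Notation mu := (@lebesgue_measure R).
Implicit Types (f g w : R -> R[i]) (p r : R -> R).
Let mT : measurable (setT : set R) := measurableT.

Lemma integrableR_bounded p (k : R -> R) : measurable_fun setT k -> (forall x, `|k x| <= 1) ->
  mu.-integrable setT (EFin \o p) -> mu.-integrable setT (EFin \o (fun x => p x * k x)).
Proof.
move=> mk k1 ip.
have mp : measurable_fun setT p by apply/measurable_EFinP; exact: (measurable_int mu ip).
apply: le_integrable ip => //.
  by apply/measurable_EFinP; exact: measurable_funM.
by move=> x _ /=; rewrite lee_fin normrM -[leRHS]mulr1 ler_wpM2l.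
Qed.

(** Fubini's theorem applies because the kernel is bounded by 1 and |p(x)| |r(y)| is integrable over
    the plane. *)
Lemma Rintegral_kernel_swap p r (K : R -> R -> R) :
  measurable_fun setT (fun z : measurableTypeR R * measurableTypeR R => K z.1 z.2) ->
  (forall x y, `|K x y| <= 1) ->
  (forall x, measurable_fun setT (K x)) -> (forall y, measurable_fun setT (K ^~ y)) ->
  mu.-integrable setT (EFin \o p) -> mu.-integrable setT (EFin \o r) ->
  \int[mu]_y ((\int[mu]_x (p x * K x y)) * r y) =
  \int[mu]_x (p x * (\int[mu]_y (r y * K x y))).
Proof.
move=> mK K1 mK1 mK2 ip ir.
have mp : measurable_fun setT p by apply/measurable_EFinP; exact: (measurable_int mu ip).
have mr : measurable_fun setT r by apply/measurable_EFinP; exact: (measurable_int mu ir).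
pose F (z : measurableTypeR R * measurableTypeR R) : \bar R := (p z.1 * K z.1 z.2 * r z.2)%:E.
have mF : measurable_fun setT F.
  apply/measurable_EFinP; apply: measurable_funM; first apply: measurable_funM => //.
  - exact: (measurableT_comp mp (@measurable_fst _ _ _ _)).
  - exact: (measurableT_comp mr (@measurable_snd _ _ _ _)).
have iF : (mu \x mu)%E.-integrable setT F.
  apply/integrable12ltyP => //.
  pose I := (\int[mu]_y `|(r y)%:E|)%E.
  have I0 : (0 <= I)%E by apply: integral_ge0.
  have Ioo : (I < +oo)%E by case/integrableP: ir.
  have mabsr : measurable_fun setT (fun y => `|(r y)%:E|)%E.
    by apply: measurableT_comp => //; exact/measurable_EFinP.
  have mabsp : measurable_fun setT (fun y => `|(p y)%:E|)%E.
    by apply: measurableT_comp => //; exact/measurable_EFinP.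
  have inner x : (\int[mu]_y `|F (x, y)| <= `|(p x)%:E| * I)%E.
    rewrite -ge0_integralZl//; apply: ge0_le_integral => //.
    - apply: measurableT_comp => //; apply/measurable_EFinP => /=.
      by apply: measurable_funM => //; apply: measurable_funM => //; exact: mK1.
    - by apply: emeasurable_funM => //; exact: measurable_cst.
    - move=> y _; rewrite /F /= lee_fin !normrM ler_wpM2r//.
      by rewrite -[leRHS]mulr1 ler_wpM2l.
  apply: le_lt_trans (_ : (\int[mu]_x (`|(p x)%:E| * I) < +oo)%E).
    apply: ge0_le_integral => //.
    - by move=> x _; apply: integral_ge0.
    - have := @measurable_fun_fubini_tonelli_F _ _ (measurableTypeR R) (measurableTypeR R) R mu
        (fun z => `|F z|)%E.
      by apply => //; exact: measurableT_comp.
    - by apply: emeasurable_funM => //; exact: measurable_cst.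
  rewrite ge0_integralZr//; case/integrableP: ip => _ poo.
  by rewrite lte_mul_pinfty// ?integral_ge0// ge0_fin_numE ?integral_ge0.
have iX y : mu.-integrable setT (EFin \o (fun x => p x * K x y)) by exact: (integrableR_bounded (mK2 y) (K1^~ y) ip).
have iY x : mu.-integrable setT (EFin \o (fun y => r y * K x y)) by exact: (integrableR_bounded (mK1 x) (K1 x) ir).
have fX y : (\int[mu]_x (p x * K x y)%:E)%E \is a fin_num.
  exact: (@integrable_fin_num _ _ _ mu setT mT _ (iX y)).
have fY x : (\int[mu]_y (r y * K x y)%:E)%E \is a fin_num.
  exact: (@integrable_fin_num _ _ _ mu setT mT _ (iY x)).
have EX y : ((\int[mu]_x (p x * K x y)) * r y)%:E = (\int[mu]_x F (x, y))%E.
  rewrite EFinM /Rintegral fineK//.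
  by rewrite -(@integralZr _ _ _ mu setT mT _ (iX y) (r y)).
have EY x : (p x * (\int[mu]_y (r y * K x y)))%:E = (\int[mu]_y F (x, y))%E.
  rewrite EFinM /Rintegral fineK//.
  rewrite -(@integralZl _ _ _ mu setT mT _ (iY x) (p x)).
  by apply: eq_integral => y _; rewrite /F -EFinM /=; congr (_%:E); ring.
rewrite /Rintegral; congr fine.
under eq_integral do rewrite EX.
under [in RHS]eq_integral do rewrite EY.
by apply/esym; exact: Fubini iF.
Qed.

End Multiplication_formula.

Section Surjectivity.
Variable R : realType.
Notation mu := (@lebesgue_measure R).
Implicit Types (f g u v w : R -> R[i]) (p r : R -> R).
Let mT : measurable (setT : set R) := measurableT.

Lemma fourier1_bounded u : cintegrable setT u ->
  exists M : R, forall y, cabs (fourier1 u y) <= M.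
Proof.
(* The factor 2 comes from bounding real and imaginary parts separately. *)
move=> iu; exists (2 * \int[mu]_x cabs (u x)) => y.
have [i1 i2] := cintegrable_fourier y iu.
have ic := integrable_cabs mT iu.
apply: le_trans (cabs_le_ReIm _) _; rewrite mulr2n mulrDl mul1r; apply: lerD.
  apply: le_trans (@le_normr_Rintegral _ _ _ mu setT _ mT i1) _; apply: le_Rintegral => //.
    exact: (@integrable_norm _ _ _ mu setT _ i1).
  by move=> x _; apply: le_trans (normr_Re_le _) _; rewrite cabsM cabs_cis mulr1.
apply: le_trans (@le_normr_Rintegral _ _ _ mu setT _ mT i2) _; apply: le_Rintegral => //.
  exact: (@integrable_norm _ _ _ mu setT _ i2).
by move=> x _; apply: le_trans (normr_Im_le _) _; rewrite cabsM cabs_cis mulr1.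
Qed.

Lemma cintegrable_fourier1M u v : cintegrable setT u -> cintegrable setT v ->
  cintegrable setT (fun y => fourier1 u y * v y).
Proof.
move=> iu iv; have [M hM] := fourier1_bounded iu.
by apply: (@cintegrableM_bounded _ _ mT _ M) => //; exact: cmeasurable_fourier1.
Qed.

Lemma cintegrable_Mfourier1 u v : cintegrable setT u -> cintegrable setT v ->
  cintegrable setT (fun y => u y * fourier1 v y).
Proof.
move=> iu iv; have := cintegrable_fourier1M iv iu.
by apply: eq_cintegrable => // x _; rewrite mulrC.
Qed.

(** Isolated as a relation because it is symmetric and linear in each argument. It then suffices to
    treat real functions, for which Fubini's theorem is used with the cosine and the sine
    kernels. *)
Definition fourier1_transposes u v : Prop :=
  cintegral setT (fun y => fourier1 u y * v y) = cintegral setT (fun x => u x * fourier1 v x).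

Lemma fourier1_transposes_real p r :
  mu.-integrable setT (EFin \o p) -> mu.-integrable setT (EFin \o r) ->
  fourier1_transposes (fun x => real_complex R (p x)) (fun x => real_complex R (r x)).
Proof.
move=> ip ir.
have mphase : measurable_fun setT
    (fun z : measurableTypeR R * measurableTypeR R => - (2 * pi * z.1 * z.2) : R).
  rewrite (_ : (fun _ => _) =
    (fun z : measurableTypeR R * measurableTypeR R => (- (2 * pi) : R) * (z.1 : R) * (z.2 : R))).
    apply: measurable_funM; last exact: measurable_snd.
    by apply: measurable_funM; [exact: measurable_cst|exact: measurable_fst].
  by apply/funext => z; ring.
have mphase1 (x : R) : measurable_fun setT (fun y : R => - (2 * pi * x * y)).
  have := @measurable_fourier_phase R setT x; congr measurable_fun.
  by apply/funext => y; ring.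
have mphase2 (y : R) : measurable_fun setT (fun x : R => - (2 * pi * x * y)) := measurable_fourier_phase y.
have mcos : measurable_fun setT (@cos R) := continuous_measurable_fun (@continuous_cos R).
have msin : measurable_fun setT (@sin R) := continuous_measurable_fun (@continuous_sin R).
have c1 := @Rintegral_kernel_swap R p r (fun x y => cos (- (2 * pi * x * y)))
  (measurableT_comp mcos mphase) (fun x y => cos_max _)
  (fun x => measurableT_comp mcos (mphase1 x)) (fun y => measurableT_comp mcos (mphase2 y)) ip ir.
have c2 := @Rintegral_kernel_swap R p r (fun x y => sin (- (2 * pi * x * y)))
  (measurableT_comp msin mphase) (fun x y => sin_max _)
  (fun x => measurableT_comp msin (mphase1 x)) (fun y => measurableT_comp msin (mphase2 y)) ip ir.
have FE (q : R -> R) y : fourier1 (fun x => real_complex R (q x)) y =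
    Complex (\int[mu]_x (q x * cos (- (2 * pi * x * y)))) (\int[mu]_x (q x * sin (- (2 * pi * x * y)))).
  rewrite /fourier1 /cintegral /cis; congr Complex; apply: eq_Rintegral => x _ /=.
    by rewrite mul0r subr0.
  by rewrite mul0r addr0.
have sym (x y : R) : 2 * pi * x * y = 2 * pi * y * x by ring.
rewrite /fourier1_transposes /cintegral; congr Complex.
- apply: etrans (etrans _ c1) _.
    by apply: eq_Rintegral => y _; rewrite FE /= mulr0 subr0.
  apply: eq_Rintegral => x _; rewrite FE /= mul0r subr0.
  by congr (_ * _); apply: eq_Rintegral => y _; rewrite sym.
- apply: etrans (etrans _ c2) _.
    by apply: eq_Rintegral => y _; rewrite FE /= mulr0 add0r.
  apply: eq_Rintegral => x _; rewrite FE /= mul0r addr0.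
  by congr (_ * _); apply: eq_Rintegral => y _; rewrite sym.
Qed.

Lemma fourier1_transposes_combl (k : R[i]) u u' v : cintegrable setT u ->
  cintegrable setT u' -> cintegrable setT v -> fourier1_transposes u v ->
  fourier1_transposes u' v -> fourier1_transposes (fun x => k * u x + u' x) v.
Proof.
move=> iu iu' iv h h'; rewrite /fourier1_transposes.
have iku := cintegrableZ mT k iu.
rewrite (fourier1D iku iu') (fourier1Z k iu).
rewrite (eq_cintegral (g := fun y => k * (fourier1 u y * v y) + fourier1 u' y * v y)); last first.
  by move=> y _; ring.
rewrite [RHS](eq_cintegral (g := fun x => k * (u x * fourier1 v x) + u' x * fourier1 v x)); last first.
  by move=> y _; ring.
have i1 := cintegrable_fourier1M iu iv; have i2 := cintegrable_fourier1M iu' iv.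
have i3 := cintegrable_Mfourier1 iu iv; have i4 := cintegrable_Mfourier1 iu' iv.
rewrite (cintegralD mT (cintegrableZ mT k i1) i2) (cintegralD mT (cintegrableZ mT k i3) i4).
by rewrite (cintegralZ mT k i1) (cintegralZ mT k i3) h h'.
Qed.

Lemma fourier1_transposes_sym u v : fourier1_transposes u v -> fourier1_transposes v u.
Proof.
rewrite /fourier1_transposes => h; apply/esym.
rewrite (eq_cintegral (g := fun y => fourier1 u y * v y)); last by move=> y _; rewrite mulrC.
by rewrite h; apply: eq_cintegral => x _; rewrite mulrC.
Qed.

Theorem multiplication_formula u v : cintegrable setT u -> cintegrable setT v ->
  fourier1_transposes u v.
Proof.
have rc (q : R -> R) : mu.-integrable setT (EFin \o q) ->
    cintegrable setT (fun x => real_complex R (q x)).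
  by move=> iq; split => //=; exact: integrable0.
have dec w : w = (fun x => Complex 0 1 * real_complex R (Im (w x)) + real_complex R (Re (w x))).
  apply/funext => x; case: (w x) => a b /=; apply/eqP; rewrite eq_complex /=.
  by apply/andP; split; apply/eqP; ring.
have step (q : R -> R) w : mu.-integrable setT (EFin \o q) -> cintegrable setT w ->
    fourier1_transposes (fun x => real_complex R (q x)) w.
  move=> iq [w1 w2]; apply: fourier1_transposes_sym; rewrite (dec w).
  exact: (fourier1_transposes_combl _ (rc _ w2) (rc _ w1) (rc _ iq)
    (fourier1_transposes_real w2 iq) (fourier1_transposes_real w1 iq)).
move=> [u1 u2] iv; rewrite (dec u).
exact: (fourier1_transposes_combl _ (rc _ u2) (rc _ u1) iv (step _ _ u2 iv) (step _ _ u1 iv)).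
Qed.

End Surjectivity.

(** * Surjectivity of the transform and its action on translations *)

Section Inversion.
Variable R : realType.
Implicit Types (f g u v w : R -> R[i]).
Let mT : measurable (setT : set R) := measurableT.

Lemma L2dot_conjr f g : L2dot setT f (fun x => conjc (g x)) = cintegral setT (fun x => f x * g x).
Proof. by apply: eq_cintegral => x _; rewrite conjcK. Qed.

Lemma L2dot_conjrC f g :
  L2dot setT f (fun x => conjc (g x)) = L2dot setT g (fun x => conjc (f x)).
Proof. by rewrite !L2dot_conjr; apply: eq_cintegral => x _; rewrite mulrC. Qed.

(** The bilinear pairing is written as an inner product with a conjugate, so that continuity of
    inner products applies; the limit is taken in one argument, then in the other. *)
Theorem is_fourier_transpose f g f' g' : is_fourier f g -> is_fourier f' g' ->
  L2dot setT g (fun x => conjc (f' x)) = L2dot setT f (fun x => conjc (g' x)).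
Proof.
move=> [f2 g2 [u [u12 uf ug]]] [f'2 g'2 [v [v12 vf vg]]].
have u2 n : in_L2 setT (u n) := (u12 n).2.
have v2 n : in_L2 setT (v n) := (v12 n).2.
have iu n : cintegrable setT (u n) by apply/(in_L1P mT); case: (u12 n).
have iv n : cintegrable setT (v n) by apply/(in_L1P mT); case: (v12 n).
have Fu2 n : in_L2 setT (fourier1 (u n)) by have [] := plancherel_L1L2 (u2 n) (iu n).
have Fv2 n : in_L2 setT (fourier1 (v n)) by have [] := plancherel_L1L2 (v2 n) (iv n).
have step j : L2dot setT g (fun x => conjc (v j x)) = L2dot setT f (fun x => conjc (fourier1 (v j) x)).
  have c1 := L2dot_cvg mT Fu2 g2 (in_L2_conj mT (v2 j)) ug.
  have c2 := L2dot_cvg mT u2 f2 (in_L2_conj mT (Fv2 j)) uf.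
  apply: ccvg_unique c1 _; rewrite (_ : (fun k => _) =
    (fun k => L2dot setT (u k) (fun x => conjc (fourier1 (v j) x))))//.
  by apply/funext => k; rewrite !L2dot_conjr; exact: multiplication_formula.
rewrite L2dot_conjrC [RHS]L2dot_conjrC.
have c1 := L2dot_cvg mT v2 f'2 (in_L2_conj mT g2) vf.
have c2 := L2dot_cvg mT Fv2 g'2 (in_L2_conj mT f2) vg.
apply: ccvg_unique c1 _; rewrite (_ : (fun k => _) =
  (fun k => L2dot setT (fourier1 (v k)) (fun x => conjc (f x))))//.
by apply/funext => k; rewrite L2dot_conjrC step L2dot_conjrC.
Qed.

Lemma nrm2_conj f : nrm2 setT (fun x => conjc (f x)) = nrm2 setT f.
Proof. by congr fine; apply: eq_integral => x _; rewrite cabs_conj. Qed.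

(* The adjoint of the transform F is [w |-> conj (F (conj w))], which is an
   isometry along with F; hence [F F^* w = w]. *)
Theorem fourier_surjective w : in_L2 setT w -> exists f, is_fourier f w.
Proof.
move=> w2; have w2' := in_L2_conj mT w2.
pose v := fourier (fun x => conjc (w x)).
have Fv : is_fourier (fun x => conjc (w x)) v := fourierP w2'.
have v2 : in_L2 setT v by case: Fv.
have f2 := in_L2_conj mT v2.
pose g := fourier (fun x => conjc (v x)).
have Fg : is_fourier (fun x => conjc (v x)) g := fourierP f2.
have g2 : in_L2 setT g by case: Fg.
exists (fun x => conjc (v x)); apply: (is_fourier_ae Fg f2 w2); first exact: aeW.
(* Transposing the transform turns <g, w> into <conj v, conj v>, whose value is ||v||^2 = ||w||^2 by
   isometry. *)
have gw : L2dot setT g w = real_complex R (nrm2 setT w).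
  have := is_fourier_transpose Fg Fv.
  rewrite (_ : (fun x => conjc (conjc (w x))) = w); last by apply/funext => x; rewrite conjcK.
  move=> ->; rewrite (L2dotxx mT) nrm2_conj -(is_fourier_nrm2 Fv).
  by rewrite nrm2_conj.
have ng : nrm2 setT g = nrm2 setT w.
  by rewrite -(is_fourier_nrm2 Fg) nrm2_conj -(is_fourier_nrm2 Fv) nrm2_conj.
have mw2 := in_L2Z mT (-1) w2.
have d2 : in_L2 setT (fun x => g x + -1 * w x) by exact: in_L2D.
(* Equality case of Cauchy-Schwarz: <g, w> and both squared norms equal ||w||^2. *)
have : nrm2 setT (fun x => g x + -1 * w x) = 0.
  rewrite nrm2D// nrm2Z// L2dotZr// gw ng.
  have -> : cabs (-1 : R[i]) ^+ 2 = 1.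
    by rewrite cabs_sqr /= sqrrN expr1n oppr0 expr0n addr0.
  by rewrite /=; ring.
move=> /(nrm2_eq0 d2); apply: ae_mono => x.
by rewrite mulN1r => /eqP; rewrite subr_eq0 => /eqP.
Qed.

Lemma L2cvg_nrm2_le (u v : nat -> R -> R[i]) f g :
  (forall n, in_L2 setT (u n)) -> in_L2 setT f ->
  (forall n, in_L2 setT (v n)) -> in_L2 setT g ->
  (forall n, nrm2 setT (fun x => v n x - g x) = nrm2 setT (fun x => u n x - f x)) ->
  L2cvg setT u f -> L2cvg setT v g.
Proof.
move=> u2 f2 v2 g2 e /(L2cvgP mT u2 f2) h; apply/(L2cvgP mT v2 g2).
by rewrite (_ : (fun k => _) = (fun k => nrm2 setT (fun x => u k x - f x)))//; apply/funext.
Qed.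

Lemma nrm2_shift f (b : R) : in_L2 setT f -> nrm2 setT (fun x => f (x - b)) = nrm2 setT f.
Proof.
move=> f2; rewrite /nrm2 -[in RHS](mul1e (sqnorm setT f)) -[1%E]/(1%:E) -(invr1 R).
rewrite -(@sqnorm_affine _ 1 (- b) setT f ltr01)//; last by case: f2.
by rewrite preimage_affine_setT; congr fine; apply: eq_sqnorm => x _; rewrite mul1r.
Qed.

Lemma in_L2_shift f (b : R) : in_L2 setT f -> in_L2 setT (fun x => f (x - b)).
Proof.
move=> f2; have := in_L2_affine (- b) ltr01 f2.
by congr (in_L2 _ _); apply/funext => x; rewrite mul1r.
Qed.

Definition modulation (b : R) (y : R) : R[i] := cis (- (2 * pi * b * y)).

Lemma in_L2_modulation b g : in_L2 setT g -> in_L2 setT (fun y => modulation b y * g y).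
Proof.
apply: (@in_L2M_bounded _ _ mT _ 1) => [|x _]; last by rewrite cabs_cis.
apply: cmeasurable_cis; have := @measurable_fourier_phase R setT b.
by congr measurable_fun; apply/funext => y; ring.
Qed.

Lemma fourier1_shift f (b y : R) : cintegrable setT f ->
  fourier1 (fun x => f (x - b)) y = modulation b y * fourier1 f y.
Proof.
move=> i; have iF := cintegrable_fourier y i.
have [iA] := cintegral_affine (- b) ltr01 iF.
rewrite /fourier1 invr1 mul1r => <-.
rewrite /modulation -(cintegralZ mT _ iA); apply: eq_cintegral => x _.
rewrite mulrCA mul1r -cisD; congr (_ * cis _); ring.
Qed.

Theorem is_fourier_shift f g (b : R) : is_fourier f g ->
  is_fourier (fun x => f (x - b)) (fun y => modulation b y * g y).
Proof.
move=> [f2 g2 [u [u12 uf ug]]].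
have u2 n : in_L2 setT (u n) := (u12 n).2.
have iu n : cintegrable setT (u n) by apply/(in_L1P mT); case: (u12 n).
have Fu2 n : in_L2 setT (fourier1 (u n)) by have [] := plancherel_L1L2 (u2 n) (iu n).
split; [exact: in_L2_shift|exact: in_L2_modulation|].
exists (fun n x => u n (x - b)); split.
- move=> n; split; last exact: in_L2_shift.
  apply/(in_L1P mT); have [iA _] := cintegral_affine (- b) ltr01 (iu n).
  by apply: eq_cintegrable iA => // x _; rewrite mul1r.
- apply: L2cvg_nrm2_le uf => // [n| |n].
  + exact: in_L2_shift.
  + exact: in_L2_shift.
  + by rewrite -(nrm2_shift b (in_L2B mT (u2 n) f2)).
- rewrite (_ : (fun n => _) = (fun n y => modulation b y * fourier1 (u n) y)); last first.
    by apply/funext => n; apply/funext => y; rewrite fourier1_shift.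
  apply: L2cvg_nrm2_le ug => // [n| |n].
  + exact: in_L2_modulation.
  + exact: in_L2_modulation.
  + congr fine; apply: eq_integral => y _.
    by rewrite -mulrBr cabsM cabs_cis mul1r.
Qed.

End Inversion.

(** * Bracket product and analysis operator *)

Section Bracket.
Variables (R : realType) (a : R).
Hypothesis a0 : 0 < a.
Notation mu := (@lebesgue_measure R).
Notation I01 := (`]0%R, 1%R[%classic : set R).
Implicit Types (f g F m phi : R -> R[i]).
Let mT : measurable (setT : set R) := measurableT.
Let mI := @measurable_I01 R.

(** The bracket product depends only on f conj(g). As an operation on this single L^1 function it is
    linear, and other transforms or translates can be inserted. *)
Definition scaled_periodize F (x : R) : R[i] :=
  real_complex R a^-1 * periodize (fun x => F (x / a)) x.

Lemma bracketE f g :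
  bracket a f g = scaled_periodize (fun y => f y * conjc (g y)).
Proof. by []. Qed.

Lemma cmeasurable_scaled_periodize A F : measurable A -> cmeasurable setT F ->
  cmeasurable A (scaled_periodize F).
Proof.
move=> mA mF; apply: cmeasurableM; first exact: cmeasurable_cst.
apply: cmeasurable_periodize => //.
rewrite (_ : (fun x => F (x / a)) = (fun x => F (a^-1 * x + 0))); first exact: cmeasurable_affine.
by apply/funext => x; rewrite addr0 mulrC.
Qed.

(** The substitution x = a y; its Jacobian cancels the factor 1/a of the bracket product. *)
Lemma scaled_periodize_unfold F m : cintegrable setT F -> cmeasurable setT m ->
  (forall x (n : int), m (x - n%:~R) = m x) -> cintegrable setT (fun y => F y * m (a * y)) ->
  cintegrable I01 (fun x => scaled_periodize F x * m x) /\
  cintegral I01 (fun x => scaled_periodize F x * m x) = cintegral setT (fun y => F y * m (a * y)).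
Proof.
move=> iF mm mper iFm.
have ai : 0 < a^-1 by rewrite invr_gt0.
have iG : cintegrable setT (fun x => F (x / a)).
  have [h _] := cintegral_affine 0 ai iF.
  by apply: (eq_cintegrable mT _ h) => x _; rewrite addr0 mulrC.
have GE (x : R) : setT x ->
    F (a^-1 * x + 0) * m (a * (a^-1 * x + 0)) = F (x / a) * m x.
  by move=> _; rewrite addr0 mulrA divff ?gt_eqF// mul1r mulrC [a^-1 * x]mulrC mulrC.
have [iGm eGm] := cintegral_affine 0 ai iFm.
have {}iGm := eq_cintegrable mT GE iGm.
have {}eGm := etrans (esym (eq_cintegral GE)) eGm.
have [i1 e1] := cintegral_unfold iG mm mper iGm.
have E (x : R) : I01 x -> real_complex R a^-1 * (periodize (fun x => F (x / a)) x * m x) =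
  scaled_periodize F x * m x by rewrite mulrA.
split; first exact: (eq_cintegrable mI E (cintegrableZ mI _ i1)).
rewrite -(eq_cintegral E) (cintegralZ mI _ i1) e1 eGm mulrA -rmorphM invrK mulVf ?gt_eqF//.
by rewrite rmorph1 mul1r.
Qed.

Lemma cintegrable_scaled_periodize F : cintegrable setT F ->
  cintegrable I01 (scaled_periodize F).
Proof.
move=> iF.
have E (x : R) : setT x -> F x = F x * 1 by rewrite mulr1.
have := @scaled_periodize_unfold F (fun=> 1) iF (cmeasurable_cst _ _) (fun _ _ => erefl)
  (eq_cintegrable mT E iF).
by case=> h _; apply: (eq_cintegrable mI _ h) => x _; rewrite mulr1.
Qed.

Lemma cintegrable_expoM F (n : int) : cintegrable setT F ->
  cintegrable setT (fun y => F y * expo n (a * y)).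
Proof.
move=> iF.
have m1 : cmeasurable setT (fun y => expo n (a * y)).
  apply: cmeasurable_comp; last exact: cmeasurable_expo.
  by apply: measurable_funM => //; exact: measurable_cst.
apply: (eq_cintegrable mT _ (@cintegrableM_bounded R setT mT _ 1 F m1 _ iF)).
  by move=> x _; rewrite mulrC.
by move=> x _; rewrite cabs_expo.
Qed.

Lemma coef_scaled_periodize F (n : int) : cintegrable setT F ->
  coef (scaled_periodize F) n = cintegral setT (fun y => F y * expo n (a * y)).
Proof.
move=> iF; rewrite coefE.
have := @scaled_periodize_unfold F (expo n) iF (cmeasurable_expo _ _) _ (cintegrable_expoM n iF).
by case=> // x k; exact: expo_int_shift.
Qed.

Lemma translate_fourier phi (n : int) : in_L2 setT phi ->
  is_fourier (translate phi a n) (fun y => conjc (expo n (a * y)) * fourier phi y).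
Proof.
move=> hp; have := is_fourier_shift (n%:~R * a) (fourierP hp).
congr is_fourier; apply/funext => y; congr (_ * _).
by rewrite /modulation /expo cisN; congr (conjc (cis _)); ring.
Qed.

Lemma conjcMK (z w : R[i]) : conjc (conjc z * w) = z * conjc w.
Proof. by rewrite rmorphM /= conjcK. Qed.

(** Stated for any w in the graph over f, and not only for [fourier f], so that test functions can
    be given with an exactly prescribed transform. *)
Lemma analysis_coef phi f w : in_L2 setT phi -> is_fourier f w ->
  analysis phi a f = coef (scaled_periodize (fun y => w y * conjc (fourier phi y))).
Proof.
move=> hp fw; have [_ w2 _] := fw; apply/funext => n; rewrite coef_scaled_periodize; last first.
  exact: (cintegrable_dot mT w2 (in_L2_fourier hp)).
rewrite /analysis (is_fourier_dot fw (translate_fourier n hp)).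
by apply: eq_cintegral => y _; rewrite conjcMK mulrA mulrAC.
Qed.

Lemma coef_bracket phi f : in_L2 setT phi -> in_L2 setT f ->
  coef (bracket a (fourier f) (fourier phi)) = analysis phi a f.
Proof. by move=> hp hf; rewrite (analysis_coef hp (fourierP hf)). Qed.

Lemma cintegrable_bracket phi f : in_L2 setT phi -> in_L2 setT f ->
  cintegrable I01 (bracket a (fourier f) (fourier phi)).
Proof.
move=> hp hf; rewrite bracketE; apply: cintegrable_scaled_periodize.
exact: (cintegrable_dot mT (in_L2_fourier hf) (in_L2_fourier hp)).
Qed.

Theorem dom_analysisE phi : in_L2 setT phi ->
  dom_analysis phi a =
  [set f | in_L2 setT f /\ in_L2 I01 (bracket a (fourier f) (fourier phi))].
Proof.
move=> hp; apply/seteqP; split=> f [hf h]; split => //.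
  apply: in_L2_of_coef; first exact: cintegrable_bracket.
  by rewrite coef_bracket.
by rewrite -(coef_bracket hp hf); exact: bessel.
Qed.

(* A bounded F supported in a window has only finitely many non-zero translates over the period. *)
Lemma in_L2_scaled_periodize F (k : nat) : in_L2 setT F ->
  (forall y, ~ window k y -> F y = 0) -> in_L2 I01 (scaled_periodize F).
Proof.
move=> F2 F0; apply: in_L2Z => //.
pose G x := F (x / a).
have G2 : in_L2 setT G.
  have := in_L2_affine 0 (_ : 0 < a^-1) F2; rewrite invr_gt0 => /(_ a0).
  by congr (in_L2 _ _); apply/funext => x; rewrite addr0 mulrC.
(* A nonzero term needs |x - n| < a (k + 1), hence |n| < a (k + 1) + 1 for x in (0, 1). *)
pose N := (Num.truncn (a * k.+1%:R + 1)).+1.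
have GN x (n : int) : I01 x -> (N < `|n|)%N -> G (x - n%:~R) = 0.
  move=> Ix nN; apply: F0; rewrite /window /= in_itv/= => /andP[h1 h2].
  move: h1 h2; rewrite ltr_pdivlMr// ltr_pdivrMr// => h1 h2.
  move: Ix => /=; rewrite in_itv/= => /andP[x0 x1].
  have := truncnS_gt (a * k.+1%:R + 1); rewrite -/N => h3.
  have h4 : (N%:R : R) < `|n%:~R| by rewrite -intr_norm -abszE ltr_nat.
  have h5 : (`|n%:~R| : R) < a * k.+1%:R + 1 by rewrite ltr_norml; lra.
  lra.
have E x : I01 x -> partial_zsum (fun n => G (x - n%:~R)) N = periodize G x.
  move=> Ix; apply/esym/zsum_ccvg/ccvg_near_eq; exists N => // M /= NM.
  rewrite !partial_zsumE -[RHS](psum_trunc _ NM); apply: eq_psum => n.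
  by case: leqP => // h; exact: GN.
have P2 K : in_L2 setT (fun x => partial_zsum (fun n => G (x - n%:~R)) K).
  elim: K => [|K ih].
    have -> : (fun x => partial_zsum (fun n => G (x - n%:~R)) 0) = (fun x => G (x - 0%:~R)).
      by apply/funext => x; exact: psum0.
    exact: in_L2_shift.
  have -> : (fun x => partial_zsum (fun n => G (x - n%:~R)) K.+1) =
      (fun x => partial_zsum (fun n => G (x - n%:~R)) K +
        (G (x - K.+1%:~R) + G (x - (- K.+1%:Z)%:~R))).
    by apply/funext => x; exact: psumS.
  by apply: in_L2D => //; apply: in_L2D => //; exact: in_L2_shift.
apply: (@ae_eq_in_L2 R I01 mI _ (fun x => partial_zsum (fun n => G (x - n%:~R)) N)).
- by apply: cmeasurable_periodize => //; case: G2.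
- by apply: aeW => x Ix; exact: E.
- by apply: in_L2S (P2 N).
Qed.

Lemma dom_analysis_bounded phi f w (M : R) (k : nat) : in_L2 setT phi -> is_fourier f w ->
  (forall y, cabs (w y) <= M) -> (forall y, ~ window k y -> w y = 0) ->
  dom_analysis phi a f.
Proof.
move=> hp fw wM w0; have [f2 w2 _] := fw; split => //.
have p2 := in_L2_fourier hp.
pose F y := w y * conjc (fourier phi y).
have F2 : in_L2 setT F.
  by apply: (@in_L2M_bounded _ _ mT _ M) => //; [case: w2|exact: in_L2_conj].
rewrite (analysis_coef hp fw).
apply: bessel; apply: (@in_L2_scaled_periodize _ k) => // y wy.
by rewrite /F w0// mul0r.
Qed.

Lemma compact_window (K : set R) : compact K -> exists k, K `<=` window k.
Proof.
move=> /compact_bounded [M [_ hM]].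
exists (Num.truncn (`|M| + 1)) => x Kx.
have /= := hM (`|M| + 1) _ x Kx.
have -> : M < `|M| + 1 by rewrite (le_lt_trans (ler_norm M))// ltrDl.
move=> /(_ isT) h; rewrite /window /= in_itv/= -ltr_norml (le_lt_trans h)//.
exact: truncnS_gt.
Qed.

Lemma measurable_cabs_le w (M : R) : cmeasurable setT w ->
  measurable [set y | cabs (w y) <= M].
Proof.
move=> mw; rewrite (_ : [set _ | _] = setT `&` (fun y => cabs (w y)) @^-1` `]-oo, M]%classic).
  by apply: (measurable_cabs mw mT); exact: measurable_itv.
by rewrite setTI; apply/seteqP; split => y /=; rewrite in_itv.
Qed.

Theorem dom_analysis_compact phi f : in_L2 setT phi -> in_L2 setT f ->
  (exists M : R, {ae mu, forall y, cabs (fourier f y) <= M}) ->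
  (exists2 K : set R, compact K & {ae mu, forall y, ~ K y -> fourier f y = 0}) ->
  dom_analysis phi a f.
Proof.
move=> hp hf [M hM] [K /compact_window[k Kk] hK].
have f2 := in_L2_fourier hf.
(* Cutting to S changes the transform on a null set and makes both bounds hold everywhere; the
   absolute value keeps the bound valid where the cut function is 0. *)
pose S : set R := window k `&` [set y | cabs (fourier f y) <= `|M|].
have mS : measurable S.
  apply: measurableI; first exact: measurable_window.
  exact: measurable_cabs_le f2.1.
apply: (@dom_analysis_bounded phi f (cut S (fourier f)) `|M| k) => //.
- apply: (is_fourier_ae (fourierP hf)) => //; first exact: in_L2T_cut.
    exact: aeW.
  apply: ae_mono2 hM hK => y h1 h2.
  have [wy|wy] := pselect (window k y).
    by rewrite cutE//; split => //=; exact: le_trans h1 (ler_norm _).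
  by rewrite cutN; [apply: h2 => /Kk|case].
- move=> y; have [Sy|Sy] := pselect (S y); first by rewrite cutE//; case: Sy.
  by rewrite cutN// cabs0.
- by move=> y wy; rewrite cutN// => -[].
Qed.

Definition bounded_part (w : R -> R[i]) (k : nat) : set R :=
  window k `&` [set y | cabs (w y) <= k%:R].

Lemma measurable_bounded_part w k : cmeasurable setT w -> measurable (bounded_part w k).
Proof.
move=> mw; apply: measurableI; first exact: measurable_window.
exact: measurable_cabs_le.
Qed.

Lemma bounded_part_exhaust w y : \forall k \near \oo, bounded_part w k y.
Proof.
have [k0 _ h] := window_exhaust y; exists (maxn k0 (Num.truncn (cabs (w y))).+1) => // k.
rewrite /= geq_max => /andP[h1 h2]; split; first exact: h.
by apply: ltW; apply: lt_le_trans (truncnS_gt _) _; rewrite ler_nat.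
Qed.

Lemma in_L2_cut_bounded (S : set R) w (M : R) (k : nat) : measurable S -> cmeasurable setT w ->
  S `<=` window k -> (forall y, S y -> cabs (w y) <= M) -> in_L2 setT (cut S w).
Proof.
move=> mS mw Sk wM; apply: in_L2_cut => //.
have Mm (y : R) : S y -> cabs (w y) ^+ 2 <= M ^+ 2.
  by move=> Sy; rewrite ler_pXn2r ?nnegrE ?cabs_ge0 ?wM// (le_trans (cabs_ge0 (w y)))// wM.
apply: (in_L2_le mS _ Mm); first exact: cmeasurableS mw.
apply: (@integrableS _ _ _ mu (window k)) => //; first exact: measurable_window.
have h : (@lebesgue_measure R (window k) < +oo)%E.
  rewrite lebesgue_measure_itv/=; case: ifP => _; last exact: ltry.
  by rewrite -EFinB ltry.
apply/integrableP; split; first exact: measurable_cst.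
rewrite /= (@integral_cst _ _ _ mu _ (measurable_window k)) lte_mul_pinfty//.
Qed.

(** Surjectivity of the transform turns a prescribed bounded truncation into an element of the
    domain. These are the test functions for density and for the adjoint. *)
Lemma dom_analysis_test phi (S : set R) w (M : R) (k : nat) : in_L2 setT phi ->
  measurable S -> cmeasurable setT w -> S `<=` window k ->
  (forall y, S y -> cabs (w y) <= M) ->
  exists2 f, is_fourier f (cut S w) & dom_analysis phi a f.
Proof.
move=> hp mS mw Sk wM.
have [f hf] := fourier_surjective (in_L2_cut_bounded mS mw Sk wM); exists f => //.
apply: (@dom_analysis_bounded phi f _ `|M| k hp hf) => y.
  have [Sy|Sy] := pselect (S y); first by rewrite cutE// (le_trans (wM y Sy)) ?ler_norm.
  by rewrite cutN// cabs0.
by move=> wy; rewrite cutN// => /Sk.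
Qed.

Lemma L2cvg_bounded_part w : in_L2 setT w ->
  L2cvg setT (fun k => cut (bounded_part w k) w) w.
Proof.
move=> w2; apply: L2cvg_dominated => //.
- by move=> k; case: (in_L2T_cut (measurable_bounded_part k w2.1) w2).
- move=> y _; apply: ccvg_near_eq; apply: filterS (bounded_part_exhaust w y) => k h.
  exact: cutE.
- by move=> k y _; exact: cabs_cut_le.
Qed.

(** The truncation is made on the transform side, and isometry carries the distance back. *)
Theorem dom_analysis_dense phi : in_L2 setT phi ->
  L2closure (dom_analysis phi a) = [set f | in_L2 setT f].
Proof.
move=> hp; apply/seteqP; split => [f []//|f /= hf]; split => // e e0.
have w2 := in_L2_fourier hf; set w := fourier f in w2.
have cw2 k := in_L2T_cut (measurable_bounded_part k w2.1) w2.
have /(L2cvgP mT cw2 w2) := L2cvg_bounded_part w2.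
move=> /cvgrPdist_lt /(_ e e0) [k _ /(_ k (leqnn k)) /=].
rewrite sub0r normrN ger0_norm ?nrm2_ge0// => hk.
have [g gw dg] := @dom_analysis_test phi (bounded_part w k) w k%:R k hp
  (measurable_bounded_part k w2.1) w2.1 (@subIsetl _ _ _) (fun y => @proj2 _ _).
exists g => //.
have g2 := dg.1.
rewrite (nrm2E (in_L2B mT hf g2)) lte_fin; apply: le_lt_trans hk.
rewrite nrm2_sym.
have := is_fourier_nrm2 (is_fourier_comb (-1) (fourierP hf) gw).
rewrite (_ : (fun x => -1 * f x + g x) = (fun x => g x - f x)); last first.
  by apply/funext => x; rewrite mulN1r addrC.
move=> ->; rewrite (_ : (fun y => -1 * _ y + _) = (fun x => cut (bounded_part w k) w x - w x))//.
by apply/funext => x; rewrite mulN1r addrC.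
Qed.

End Bracket.

(** * The adjoint of the analysis operator *)

Section Periodic_extension.
Variable R : realType.
Notation I01 := (`]0%R, 1%R[%classic : set R).
Implicit Types (f g h G : R -> R[i]).

Definition periodic_extension h (x : R) : R[i] := h (x - (Num.floor x)%:~R).

Lemma periodic_extension_shift h (x : R) (n : int) :
  periodic_extension h (x - n%:~R) = periodic_extension h x.
Proof.
rewrite /periodic_extension -rmorphN floorDrz ?intr_int// intrKfloor rmorphD rmorphN.
by congr h; ring.
Qed.

Lemma floor_I01 (x : R) : 0 <= x < 1 -> Num.floor x = 0.
Proof. by move=> hx; apply: floor_def; rewrite add0r. Qed.

Lemma periodic_extension_itv h (x : R) : 0 <= x < 1 -> periodic_extension h x = h x.
Proof. by move=> hx; rewrite /periodic_extension floor_I01// subr0. Qed.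

(** Exactly one translate of x falls in [0, 1). Seen as a periodization, the extension inherits
    measurability from [cmeasurable_periodize]. *)
Lemma periodic_extensionE h : periodic_extension h = periodize (cut `[0%R, 1%R[ h).
Proof.
apply/funext => x; apply/esym/zsum_ccvg/ccvg_near_eq.
exists `|Num.floor x|%N => // N /= hN; rewrite partial_zsumE.
pose d (n : int) := cut `[0%R, 1%R[ h (x - n%:~R).
rewrite (@eq_psum _ _ (fun n => d n * (n == Num.floor x)%:R)).
  rewrite psum_delta hN /d cutE//= in_itv/= subr_ge0 ltrBlDr.
  by rewrite floor_le addrC -intrD1 floorD1_gt.
move=> n; rewrite /d; case: eqP => [->|nx]; rewrite ?mulr1// mulr0 cutN//= in_itv/=.
move=> /andP[h1 h2]; apply: nx; apply/esym; apply: floor_def.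
by rewrite -subr_ge0 h1/= intrD1 -ltrBlDl.
Qed.

Lemma cmeasurable_periodic_extension h : cmeasurable `[0%R, 1%R[ h ->
  cmeasurable setT (periodic_extension h).
Proof.
move=> mh; rewrite periodic_extensionE; apply: cmeasurable_periodize => //.
by apply: cmeasurable_cut.
Qed.

Lemma periodic_extension_id G : (forall x (n : int), G (x - n%:~R) = G x) ->
  periodic_extension G = G.
Proof. by move=> Gn; apply/funext => x; exact: Gn. Qed.

End Periodic_extension.

(** * Periodic multipliers and identification of the adjoint *)

Section Fourier_series_line.
Variables (R : realType) (a : R).
Hypothesis a0 : 0 < a.
Notation mu := (@lebesgue_measure R).
Notation I01 := (`]0%R, 1%R[%classic : set R).
Implicit Types (f g h G phi : R -> R[i]) (c : int -> R[i]).
Let mT : measurable (setT : set R) := measurableT.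
Let mI := @measurable_I01 R.

Lemma sqnorm_period G : cmeasurable setT G ->
  sqnorm `[0%R, a^-1] (fun y => G (a * y)) = (a^-1%:E * sqnorm I01 G)%E.
Proof.
move=> mG.
have E : affine a 0 @^-1` `[0, 1] = `[0, a^-1]%classic.
  apply/seteqP; split => x /=; rewrite !in_itv/= /affine addr0 => /andP[h1 h2].
    by rewrite -(pmulr_rge0 _ a0) h1 -div1r ler_pdivlMr// mulrC.
  by rewrite mulr_ge0 ?(ltW a0)//= mulrC -ler_pdivlMr// div1r.
have mc : measurable (`[0%R, 1%R]%classic : set R) by exact: measurable_itv.
have := @sqnorm_affine R a 0 `[0, 1] G a0 mc (cmeasurableS mT (@subsetT _ _) mG).
rewrite E (eq_sqnorm (g := fun y => G (a * y))); last by move=> x _; rewrite addr0.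
move=> ->; congr (_ * _)%E.
rewrite /sqnorm; apply/esym.
have ms (A : set R) : measurable A -> measurable_fun A (fun x => (cabs (G x) ^+ 2)%:E).
  move=> mA; apply/measurable_EFinP; apply: measurable_cabs_sqr.
  exact: cmeasurableS mG.
rewrite integral_itv_obnd_cbnd; last by apply: ms; exact: measurable_itv.
by rewrite integral_itv_bndo_bndc//; apply: ms; exact: measurable_itv.
Qed.

Lemma cmeasurable_trig_sum A c N : measurable A -> cmeasurable A (trig_sum c N).
Proof.
move=> mA.
have mt n : cmeasurable A (fun x => c n * expo (- n) x).
  by apply: cmeasurableM; [exact: cmeasurable_cst|exact: cmeasurable_expo].
elim: N => [|N ih]; first by rewrite (funext (trig_sum0 c)).
by rewrite (funext (trig_sumS c N)); do 2 apply: cmeasurableD => //.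
Qed.

Lemma L2cvg_period c G : cmeasurable setT G ->
  L2cvg `[0%R, a^-1] (fun N x => partial_zsum (fun n => c n * expo (- n) (a * x)) N)
    (fun y => G (a * y)) <-> L2cvg I01 (trig_sum c) G.
Proof.
move=> mG; rewrite /L2cvg.
have E N : sqnorm `[0, a^-1] (fun x =>
     partial_zsum (fun n => c n * expo (- n) (a * x)) N - G (a * x))
   = (a^-1%:E * sqnorm I01 (fun x => trig_sum c N x - G x)%R)%E.
  by apply: (@sqnorm_period (fun x => trig_sum c N x - G x));
    apply: cmeasurableB => //; exact: cmeasurable_trig_sum.
rewrite (funext E); split=> h.
  rewrite (_ : (fun _ => _) = fun N => (a%:E * (a^-1%:E * sqnorm I01 (fun x => trig_sum c N x - G x)%R))%E).
    by rewrite -(mule0 a%:E); apply: cvgeZl h.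
  by apply/funext => N; rewrite muleA -EFinM divff ?gt_eqF// mul1e.
by rewrite -(mule0 a^-1%:E); apply: cvgeZl h.
Qed.

Lemma cmeasurable_scale G : cmeasurable setT G -> cmeasurable setT (fun y => G (a * y)).
Proof.
move=> mG; rewrite (_ : (fun _ => _) = fun y => G (a * y + 0)); first exact: cmeasurable_affine.
by apply/funext => y; rewrite addr0.
Qed.

(** The function m_c of the overview in the variable x = a y, with exact periodicity at every point;
    c determines it up to a null set. *)
Definition fourier_multiplier c G : Prop :=
  [/\ cmeasurable setT G, forall x (n : int), G (x - n%:~R) = G x,
      in_L2 I01 G & coef G = c].

Lemma fourier_multiplier_exists c : in_l2 c -> exists G, fourier_multiplier c G.
Proof.
(* The limit g is controlled on (0, 1) only. Setting it to 0 elsewhere makes it measurable on the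
   line before one period is repeated. *)
move=> /riesz_fischer[g [g2 _ gc]]; pose h := cut I01 g; exists (periodic_extension h).
have mh : cmeasurable setT h by apply: cmeasurable_cut => //; case: g2.
have E (x : R) : I01 x -> periodic_extension h x = g x.
  move=> Ix; rewrite periodic_extension_itv /h ?cutE//.
  by move: Ix => /=; rewrite in_itv/= => /andP[/ltW -> ->].
have mP : cmeasurable setT (periodic_extension h).
  by apply: cmeasurable_periodic_extension; apply: cmeasurableS mh.
split => //.
- by move=> x n; exact: periodic_extension_shift.
- apply: (ae_eq_in_L2 mI _ _ g2); first exact: cmeasurableS mP.
  by apply: aeW => x Ix; rewrite E.
- rewrite -gc; apply/funext => n; rewrite !coefE; apply: eq_cintegral => x Ix.
  by rewrite E.
Qed.

(** [fourier_series] is a choice among periodic L^2 limits. Multipliers show that there is something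
    to choose, and any choice, read in the variable x = a y, is itself a multiplier. *)
Theorem fourier_seriesP c : in_l2 c ->
  exists2 G, fourier_multiplier c G & forall y, fourier_series a c y = G (a * y).
Proof.
move=> c2; set g := fourier_series a c.
have [gp g2 gc] : [/\ periodic g a^-1, in_L2 `[0, a^-1] g &
    L2cvg `[0, a^-1] (fun N x => partial_zsum (fun n => c n * expo (- n) (a * x)) N) g].
  apply: (@xgetPex _ (fun=> 0) [set g : R -> R[i] | [/\ periodic g a^-1, in_L2 `[0, a^-1] g &
    L2cvg `[0, a^-1] (fun N x => partial_zsum (fun n => c n * expo (- n) (a * x)) N) g]]).
  have [G [mG Gp G2 Gc]] := fourier_multiplier_exists c2; exists (fun y => G (a * y)); split.
  - move=> y; rewrite mulrDr divff ?gt_eqF//.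
    by have := Gp (a * y) (-1); rewrite opprK.
  - split; last by rewrite sqnorm_period// (nrm2E G2) -EFinM ltry.
    exact: (cmeasurableS mT _ (cmeasurable_scale mG)).
  - apply/L2cvg_period => //; rewrite -Gc; apply/trig_sum_cvg => //; exact: aeW.
pose G x := g (x / a).
have gG y : g y = G (a * y) by rewrite /G mulrAC divff ?mul1r// gt_eqF.
exists G => //.
have Gp (x : R) (n : int) : G (x - n%:~R) = G x.
  have gz y : g (y + n%:~R * a^-1) = g y.
    case: n => k; first by rewrite -[(Posz k)%:~R]/(k%:R) mulr_natl periodicn.
    by rewrite -[LHS](periodicn gp k.+1) NegzE mulrNz -pmulrn -[a^-1 *+ _]mulr_natl mulNr subrK.
  by rewrite /G -[LHS]gz mulrBl subrK.
(* The choice comes with measurability on one period. Being its own periodic extension, G inherits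
   it on the whole line. *)
have mG : cmeasurable setT G.
  rewrite -(periodic_extension_id Gp); apply: cmeasurable_periodic_extension.
  pose h := cut `[0%R, a^-1] g.
  have mh : cmeasurable setT (fun x => h (a^-1 * x + 0)).
    by apply: cmeasurable_affine; apply: cmeasurable_cut => //; case: g2.
  have hG (x : R) : (`[0%R, 1%R[%classic : set R) x -> h (a^-1 * x + 0) = G x.
    rewrite /= in_itv/= => /andP[h1 h2]; rewrite addr0 /h /G mulrC cutE//= in_itv/=.
    by rewrite divr_ge0 ?(ltW a0)//= -[leRHS]mul1r ler_pM2r ?invr_gt0// ltW.
  case: (cmeasurableS mT (@subsetT _ `[0%R, 1%R[) mh) => m1 m2; split.
    by apply: eq_measurable_fun m1 => x /set_mem Ix; rewrite hG.
  by apply: eq_measurable_fun m2 => x /set_mem Ix; rewrite hG.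
have G2 : in_L2 I01 G.
  split; first exact: cmeasurableS mG.
  have [_] := g2; rewrite (funext gG) sqnorm_period//.
  by move=> h; rewrite ltNge leye_eq; apply/negP => /eqP e; move: h;
    rewrite e gt0_muley ?ltxx// lte_fin invr_gt0.
split => //.
have [g' [g'2 _ g'c]] := riesz_fischer c2.
rewrite (funext gG) in gc; have {}gc := (L2cvg_period c mG).1 gc.
rewrite -g'c in gc; have h := (trig_sum_cvg g'2 G2).1 gc.
rewrite -g'c; apply/funext => n; rewrite !coefE; apply/esym.
have mE (f : R -> R[i]) : in_L2 I01 f -> cmeasurable I01 (fun x => f x * expo n x).
  by move=> [mf _]; apply: cmeasurableM => //; exact: cmeasurable_expo.
apply: (ae_eq_cintegral mI (mE _ g'2) (mE _ G2)).
by apply: ae_mono h => x e Ix; rewrite e.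
Qed.

(** The hypothesis is integrability of the product and not square integrability of G(a y) fourier
    phi(y): the latter is a conclusion in [adjoint_multiplier], where truncating w secures the
    former. *)
Lemma pairing phi f w c G : in_L2 setT phi -> is_fourier f w -> dom_analysis phi a f ->
  fourier_multiplier c G ->
  cintegrable setT (fun y => w y * conjc (G (a * y) * fourier phi y)) ->
  ccvg (partial_zsum (fun n => analysis phi a f n * conjc (c n)))
    (L2dot setT w (fun y => G (a * y) * fourier phi y)).
Proof.
move=> hp fw [f2 df] [mG Gp G2 Gc] iwG; have [_ w2 _] := fw.
pose F y := w y * conjc (fourier phi y).
have iF : cintegrable setT F by exact: (cintegrable_dot mT w2 (in_L2_fourier hp)).
rewrite (analysis_coef a0 hp fw) in df *; rewrite -/F in df *.
have B2 : in_L2 I01 (scaled_periodize a F).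
  apply: in_L2_of_coef df; exact: (cintegrable_scaled_periodize a0 iF).
have E (y : R) : setT y -> w y * conjc (G (a * y) * fourier phi y) = F y * conjc (G (a * y)).
  by move=> _; rewrite rmorphM /= [conjc (G _) * _]mulrC mulrA.
have [_ e] := @scaled_periodize_unfold R a a0 F (fun x => conjc (G x)) iF
  (cmeasurable_conj mG) (fun x n => congr1 conjc (Gp x n)) (eq_cintegrable mT E iwG).
have := parseval B2 G2; rewrite Gc; congr ccvg.
by rewrite {1}/L2dot e; apply/esym; exact: eq_cintegral E.
Qed.

Lemma multiplier_adjoint phi c G h : in_L2 setT phi -> in_l2 c -> fourier_multiplier c G ->
  is_fourier h (fun y => G (a * y) * fourier phi y) -> is_analysis_adjoint phi a c h.
Proof.
move=> hp c2 GP hG; have [h2 m2 _] := hG; split => // f df; have [f2 _] := df.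
have ff := fourierP f2.
rewrite (is_fourier_dot ff hG); apply: zsum_ccvg; apply: pairing => //.
exact: (cintegrable_dot mT (in_L2_fourier f2) m2).
Qed.

(* Testing against functions whose transform is a truncation of the difference of the two sides. *)
Lemma adjoint_multiplier phi c G h : in_L2 setT phi -> fourier_multiplier c G ->
  is_analysis_adjoint phi a c h ->
  {ae mu, forall y, fourier h y = G (a * y) * fourier phi y}.
Proof.
move=> hp GP [c2 h2 adj]; have [mG _ _ _] := GP.
pose m y := G (a * y) * fourier phi y; pose D y := fourier h y - m y.
have hh2 := in_L2_fourier h2; have ph2 := in_L2_fourier hp.
have mm : cmeasurable setT m.
  by apply: cmeasurableM; [exact: cmeasurable_scale|case: ph2].
have mD : cmeasurable setT D by apply: cmeasurableB => //; case: hh2.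
(* A bounded D makes the truncation an admissible test transform; a bounded m makes its product with
   this truncation integrable. *)
pose S k := bounded_part D k `&` bounded_part m k.
have mS k : measurable (S k) by apply: measurableI; exact: measurable_bounded_part.
have Sk k : S k `<=` window k by move=> y [[]].
have SD k y : S k y -> cabs (D y) <= k%:R by case=> -[].
have Sm k y : S k y -> cabs (m y) <= k%:R by case=> _ [].
have D0 k : {ae mu, forall y, cut (S k) D y = 0}.
  set w := cut (S k) D.
  have w2 : in_L2 setT w := in_L2_cut_bounded (mS k) mD (@Sk k) (@SD k).
  have m2 := in_L2_cut_bounded (mS k) mm (@Sk k) (@Sm k).
  have [f fw df] := dom_analysis_test a0 hp (mS k) mD (@Sk k) (@SD k); rewrite -/w in fw.
  have E (y : R) : setT y -> w y * conjc (cut (S k) m y) = w y * conjc (m y).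
    move=> _; have [Sy|Sy] := pselect (S k y); first by rewrite !cutE.
    by rewrite /w !cutN// !mul0r.
  have iwm := eq_cintegrable mT E (cintegrable_dot mT w2 m2).
  have iwh := cintegrable_dot mT w2 hh2.
  have e : L2dot setT w (fourier h) = L2dot setT w m.
    rewrite -(is_fourier_dot fw (fourierP h2)) -(adj f df).
    exact: zsum_ccvg (pairing hp fw df GP iwm).
  apply: nrm2_eq0 => //.
  (* Since w is D on S k and 0 elsewhere, <w, w> = <w, D>, and [e] says that this is 0. *)
  have : L2dot setT w w = 0.
    rewrite -(subrr (L2dot setT w m)) -{1}e /L2dot -(cintegralB mT iwh iwm).
    apply: eq_cintegral => y _; rewrite -mulrBr -rmorphB /= -/(D y) /w.
    have [Sy|Sy] := pselect (S k y); first by rewrite cutE.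
    by rewrite cutN// !mul0r.
  by rewrite (L2dotxx mT) => /eqP; rewrite fmorph_eq0 => /eqP.
have {}D0 : {ae mu, forall y k, cut (S k) D y = 0} by exact: ae_foralln.
apply: ae_mono D0 => y h0.
have [k _ hk] : \forall k \near \oo, S k y.
  by apply: filterS2 (bounded_part_exhaust D y) (bounded_part_exhaust m y).
have := h0 k; rewrite cutE; last by apply: hk => /=.
by move=> /eqP; rewrite subr_eq0 => /eqP.
Qed.

Theorem dom_analysis_adjointE phi : in_L2 setT phi ->
  dom_analysis_adjoint phi a =
     [set c : int -> R[i] | in_l2 c /\
        (\int[mu]_y (cabs (fourier_series a c y * fourier phi y) ^+ 2)%:E < +oo)%E].
Proof.
move=> hp; apply/seteqP; split => c.
  move=> [h hc]; have [c2 h2 _] := hc; split => //.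
  have [G GP GE] := fourier_seriesP c2.
  have e := adjoint_multiplier hp GP hc; have [mG _ _ _] := GP.
  have [_] : in_L2 setT (fun y => fourier_series a c y * fourier phi y); last by [].
  have := in_L2_fourier h2; apply: (ae_eq_in_L2 mT).
    rewrite (funext GE); apply: cmeasurableM; first exact: cmeasurable_scale.
    by case: (in_L2_fourier hp).
  by apply: ae_mono e => y -> _; rewrite GE.
move=> [c2 hfin]; have [G GP GE] := fourier_seriesP c2; have [mG _ _ _] := GP.
have m2 : in_L2 setT (fun y => G (a * y) * fourier phi y).
  split; last by move: hfin; rewrite (funext GE).
  apply: cmeasurableM; first exact: cmeasurable_scale.
  by case: (in_L2_fourier hp).
have [h hG] := fourier_surjective m2; exists h; exact: multiplier_adjoint hG.
Qed.

Theorem fourier_adjoint phi c h : in_L2 setT phi -> is_analysis_adjoint phi a c h ->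
  {ae mu, forall y, fourier h y = fourier_series a c y * fourier phi y}.
Proof.
move=> hp hc; have [c2 _ _] := hc; have [G GP GE] := fourier_seriesP c2.
by apply: ae_mono (adjoint_multiplier hp GP hc) => y ->; rewrite GE.
Qed.

End Fourier_series_line.

(** * The generalized frame operator *)

Section L2_sequences.
Variable R : realType.
Implicit Types c d : int -> R[i].

(** Sequences are realized as Fourier coefficients by Riesz-Fischer, so convergence of their inner
    product is Parseval's identity. *)
Lemma l2dot_ccvg c d : in_l2 c -> in_l2 d ->
  ccvg (partial_zsum (fun n => c n * conjc (d n))) (l2dot c d).
Proof.
move=> /riesz_fischer[f [f2 _ <-]] /riesz_fischer[g [g2 _ <-]].
by have h := parseval f2 g2; rewrite /l2dot (zsum_ccvg h).
Qed.

Lemma l2dot_conj c d : in_l2 c -> in_l2 d -> l2dot d c = conjc (l2dot c d).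
Proof.
move=> /riesz_fischer[f [f2 _ <-]] /riesz_fischer[g [g2 _ <-]].
rewrite /l2dot (zsum_ccvg (parseval f2 g2)) (zsum_ccvg (parseval g2 f2)).
exact: L2dot_conj.
Qed.

Lemma in_l2_comb (k : R[i]) c d : in_l2 c -> in_l2 d -> in_l2 (fun n => k * c n + d n).
Proof.
move=> /in_l2P[M hM] /in_l2P[M' hM']; apply/in_l2P.
exists (2 * (cabs k ^+ 2 * M) + 2 * M') => N.
apply: (@le_trans _ _ (2 * (cabs k ^+ 2 * psum (fun n => cabs (c n) ^+ 2) N) +
   2 * psum (fun n => cabs (d n) ^+ 2) N)).
  rewrite -!psumZ -psumD; apply: ler_sum => i _.
  by apply: le_trans (cabsD_sqr _ _) _; rewrite cabsM exprMn.
apply: lerD; rewrite ler_pM2l ?ltr0n//.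
by apply: ler_wpM2l => //; exact: sqr_ge0.
Qed.

Lemma l2dot_combr (k : R[i]) c d e : in_l2 c -> in_l2 d -> in_l2 e ->
  l2dot e (fun n => k * c n + d n) = conjc k * l2dot e c + l2dot e d.
Proof.
move=> c2 d2 e2; apply: zsum_ccvg.
have := ccvgD (ccvgM (ccvg_cst (conjc k)) (l2dot_ccvg e2 c2)) (l2dot_ccvg e2 d2).
rewrite (_ : (fun n => conjc k * _ + _) =
  partial_zsum (fun n => e n * conjc (k * c n + d n)))//.
apply/funext => N; rewrite !partial_zsumE -psumZ -psumD; apply: eq_psum => n.
by rewrite rmorphD rmorphM /= mulrDr mulrCA.
Qed.

End L2_sequences.

(** * Factorization of the frame operator through the adjoint *)

Section Frame.
Variables (R : realType) (phi : R -> R[i]) (a : R).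
Hypothesis a0 : 0 < a.
Hypothesis hp : in_L2 setT phi.
Notation mu := (@lebesgue_measure R).
Notation I01 := (`]0%R, 1%R[%classic : set R).
Implicit Types (f g h F G : R -> R[i]).
Let mT : measurable (setT : set R) := measurableT.

Lemma in_L2_translate (n : int) : in_L2 setT (translate phi a n).
Proof. exact: in_L2_shift. Qed.

(** The series defining the frame operator is <C f, C g>, the conjugate of the product in the
    adjoint relation, and density of the domain supplies the closure condition on h. *)
Lemma is_frame_operatorE f h : is_frame_operator phi a f h <->
  dom_analysis phi a f /\ is_analysis_adjoint phi a (analysis phi a f) h.
Proof.
have E g : dom_analysis phi a g ->
    zsum (fun n => L2dot setT f (translate phi a n) * L2dot setT (translate phi a n) g) =
    l2dot (analysis phi a f) (analysis phi a g).
  move=> [g2 _]; congr zsum; apply/funext => n; congr (_ * _).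
  by rewrite -(L2dot_conj mT g2 (in_L2_translate n)).
split => [[df ch fh]|[df [_ h2 fh]]].
  have [f2 cf] := df.
  have h2 : in_L2 setT h by case: ch.
  split=> //; split => // g dg; have [g2 cg] := dg.
  by rewrite (l2dot_conj cf cg) -E// fh// -(L2dot_conj mT h2 g2).
have [f2 cf] := df.
split => //; first by rewrite (dom_analysis_dense a0 hp).
move=> g dg; have [g2 cg] := dg.
by rewrite E// (l2dot_conj cg cf) fh// -(L2dot_conj mT g2 h2).
Qed.

Lemma analysis_comb (k : R[i]) f g : in_L2 setT f -> in_L2 setT g ->
  analysis phi a (fun x => k * f x + g x) =
  (fun n => k * analysis phi a f n + analysis phi a g n).
Proof.
move=> f2 g2; apply/funext => n; have tn := in_L2_translate n.
by rewrite /analysis (L2dotDl mT (in_L2Z mT k f2) g2 tn) (L2dotZl mT k f2 tn).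
Qed.

Lemma cintegral0 (A : set R) : measurable A -> cintegral A (fun=> 0) = 0.
Proof. by move=> mA; rewrite /cintegral !(@Rintegral_cst _ _ _ mu A mA) mul0r. Qed.

Lemma dom_frame_operator0 : dom_frame_operator phi a (fun=> 0).
Proof.
have z2 : in_L2 setT (fun=> 0 : R[i]) by exact: in_L20.
have an : analysis phi a (fun=> 0) = fun=> 0.
  apply/funext => n; rewrite -[RHS](cintegral0 mT); apply: eq_cintegral => x _.
  by rewrite mul0r.
have l20 : in_l2 (fun _ : int => 0 : R[i]).
  apply/in_l2P; exists 0 => N; rewrite /psum big1// => i _.
  by rewrite cabs0 expr0n.
exists (fun=> 0); apply/is_frame_operatorE; rewrite an; split.
  by split => //; rewrite an.
split => // f [f2 df].
rewrite /L2dot (eq_cintegral (g := fun=> 0)); last by move=> x _; rewrite conjc0 mulr0.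
rewrite cintegral0//; apply/zsum_ccvg/ccvg_near_eq; apply: nearW => N.
by rewrite partial_zsumE /psum big1// => i _; rewrite conjc0 mulr0.
Qed.

Lemma is_analysis_adjoint_comb (k : R[i]) c d h h' :
  is_analysis_adjoint phi a c h -> is_analysis_adjoint phi a d h' ->
  is_analysis_adjoint phi a (fun n => k * c n + d n) (fun x => k * h x + h' x).
Proof.
move=> [c2 h2 hc] [d2 h'2 hd]; split; first exact: in_l2_comb.
  by apply: in_L2D => //; exact: in_L2Z.
move=> f df; have [f2 f2'] := df.
by rewrite l2dot_combr// hc// hd// (L2dotDr mT (in_L2Z mT k h2) h'2 f2) (L2dotZr mT k h2 f2).
Qed.

Theorem dom_frame_operator_subspace : is_subspace (dom_frame_operator phi a).
Proof.
split; first exact: dom_frame_operator0.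
move=> k f g [h /is_frame_operatorE[df hh]] [h' /is_frame_operatorE[dg hh']].
exists (fun x => k * h x + h' x); apply/is_frame_operatorE.
have [[f2 f2'] [g2 g2']] := (df, dg).
rewrite (analysis_comb k f2 g2); split; last exact: is_analysis_adjoint_comb.
split; first by apply: in_L2D => //; exact: in_L2Z.
by rewrite (analysis_comb k f2 g2); exact: in_l2_comb.
Qed.

Lemma scaled_periodize_shift F (n : int) x :
  scaled_periodize a F (x - n%:~R) = scaled_periodize a (fun y => F (y - n%:~R / a)) x.
Proof.
congr (_ * zsum _); apply/funext => m; congr F.
by rewrite -mulrBl addrAC.
Qed.

Lemma cintegrable_translate F (b : R) : cintegrable setT F -> cintegrable setT (fun y => F (y - b)).
Proof.
move=> iF; have [h _] := cintegral_affine (- b) ltr01 iF.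
by apply: (eq_cintegrable mT _ h) => y _; rewrite mul1r.
Qed.

(** After unfolding, a translation of F by n/a moves the argument a y of the exponential by the
    integer n, which has no effect. *)
Lemma coef_scaled_periodize_shift F (n : int) : cintegrable setT F ->
  coef (scaled_periodize a (fun y => F (y - n%:~R / a))) = coef (scaled_periodize a F).
Proof.
move=> iF; apply/funext => k.
rewrite !(coef_scaled_periodize a0)//; last exact: cintegrable_translate.
have [_] := cintegral_affine (- (n%:~R / a)) ltr01 (cintegrable_expoM a k iF).
rewrite invr1 mul1r => <-; apply: eq_cintegral => y _; rewrite mul1r; congr (_ * _).
by rewrite mulrBr mulrCA divff ?gt_eqF// mulr1 expo_int_shift.
Qed.

(* The translates of the bracket product have the same Fourier coefficients, so the bracket
   product, a priori controlled on one period only, agrees with G on the whole line. *)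
Lemma multiplier_eq_scaled_periodize F G : cintegrable setT F ->
  fourier_multiplier (coef (scaled_periodize a F)) G ->
  {ae mu, forall y, G (a * y) = scaled_periodize a F (a * y)}.
Proof.
move=> iF [mG Gp G2 Gc].
pose D x := G x - scaled_periodize a F x.
have mB : cmeasurable setT (scaled_periodize a F).
  by apply: cmeasurable_scaled_periodize => //; exact: cintegrable_cmeasurable iF.
have mD : cmeasurable setT D by exact: cmeasurableB.
have D0 (n : int) : {ae mu, forall x, `[0%R, 1%R[%classic x -> D (x - n%:~R) = 0}.
  have iFn := cintegrable_translate (n%:~R / a) iF.
  have := ae_eq_of_coef (in_L2_I01_cintegrable G2) (cintegrable_scaled_periodize a0 iFn).
  rewrite coef_scaled_periodize_shift// Gc => /(_ erefl).
  apply: ae_mono2 (ae_neq 0) => x x0 e.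
  rewrite /= in_itv/= => /andP[x1 x2]; rewrite /D Gp scaled_periodize_shift e ?subrr//=.
  by rewrite in_itv/= x2 lt_neqAle x1 eq_sym !andbT; apply/eqP.
(* The null sets of the translates are glued by unfolding |D|^2: on [0, 1) every partial sum of its
   translates is 0 almost everywhere. *)
have sD : sqnorm setT D = 0%E.
  have mS := measurable_cabs_sqr mD.
  have := ge0_integral_unfold mS (fun x => sqr_ge0 (cabs (D x))).
  move=> /(cvg_unique (@ereal_hausdorff R)); apply; apply: cvg_near_cst.
  apply: nearW => N.
  have mI0 : measurable (`[0%R, 1%R[%classic : set R) by exact: measurable_itv.
  have m0 : measurable_fun (`[0%R, 1%R[ : set R) (fun _ : R => 0%E : \bar R) by exact: measurable_cst.
  have mp : measurable_fun (`[0%R, 1%R[ : set R)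
      (fun x => (psum (fun n => cabs (D (x - n%:~R)) ^+ 2) N)%:E).
    apply/measurable_EFinP; apply: measurable_sum => i.
    apply: measurable_funTS; apply: (measurableT_comp mS).
    by apply: measurable_funB => //; exact: measurable_cst.
  rewrite -[RHS](@integral0 _ _ _ mu `[0%R, 1%R[).
  apply: ae_eq_integral => //.
  have h (i : nat) : {ae mu, forall x, `[0%R, 1%R[%classic x ->
      cabs (D (x - (i%:Z - N%:Z)%:~R)) ^+ 2 = 0}.
    by apply: ae_mono (D0 (i%:Z - N%:Z)) => x e Ix; rewrite e// cabs0 expr0n.
  have {}h := ae_foralln h.
  apply: ae_mono h => x e Ix; rewrite /psum big1// => i _; exact: e.
have : sqnorm setT (fun y => D (a * y + 0)) = 0%E.
  have := @sqnorm_affine R a 0 setT D a0 mT mD.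
  by rewrite preimage_affine_setT sD mule0.
move=> /(sqnorm_eq0 mT (cmeasurable_affine a 0 mD)); apply: ae_mono => y.
by move=> /(_ I); rewrite addr0 /D => /eqP; rewrite subr_eq0 => /eqP.
Qed.

Lemma scaled_periodize_scale F y :
  scaled_periodize a F (a * y) = real_complex R a^-1 * zsum (fun n => F (y - n%:~R / a)).
Proof.
congr (_ * zsum _); apply/funext => n; congr F.
by rewrite mulrBl mulrAC divff ?mul1r// gt_eqF.
Qed.

Notation fold f := (fun y => zsum (fun n : int => fourier f (y - n%:~R / a) *
                           conjc (fourier phi (y - n%:~R / a)))).

Lemma cmeasurable_fold f : in_L2 setT f -> cmeasurable setT (fold f).
Proof.
move=> f2; pose F y := fourier f y * conjc (fourier phi y).
have iF : cintegrable setT F := cintegrable_dot mT (in_L2_fourier f2) (in_L2_fourier hp).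
have mB : cmeasurable setT (scaled_periodize a F).
  by apply: cmeasurable_scaled_periodize => //; exact: cintegrable_cmeasurable iF.
rewrite (_ : (fun _ => _) = fun y => real_complex R a * scaled_periodize a F (a * y)).
  by apply: cmeasurableM; [exact: cmeasurable_cst|exact: cmeasurable_scale].
apply/funext => y; rewrite scaled_periodize_scale mulrA -rmorphM divff ?gt_eqF//.
by rewrite rmorph1 mul1r.
Qed.

Lemma fourier_series_fold f : dom_analysis phi a f ->
  {ae mu, forall y, fourier_series a (analysis phi a f) y = real_complex R a^-1 * fold f y}.
Proof.
move=> [f2 df]; have [G GP GE] := fourier_seriesP a0 df.
pose F y := fourier f y * conjc (fourier phi y).
have iF : cintegrable setT F := cintegrable_dot mT (in_L2_fourier f2) (in_L2_fourier hp).
rewrite -(coef_bracket a0 hp f2) in GP.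
apply: ae_mono (multiplier_eq_scaled_periodize iF GP) => y e.
by rewrite GE e scaled_periodize_scale.
Qed.

Theorem fourier_frame_operator f h : is_frame_operator phi a f h ->
  {ae mu, forall y, fourier h y = real_complex R a^-1 * fourier phi y * fold f y}.
Proof.
move=> /is_frame_operatorE[df hh].
apply: ae_mono2 (fourier_adjoint a0 hp hh) (fourier_series_fold df) => y -> ->.
by rewrite mulrAC.
Qed.

(** The bracket condition places f in the domain of C. The other condition then places C f in the
    domain of the adjoint, since its Fourier series is the folding up to the factor 1/a. *)
Theorem dom_frame_operatorE :
  dom_frame_operator phi a =
        [set f | [/\ in_L2 setT f,
          in_L2 `]0, 1[ (bracket a (fourier f) (fourier phi)) &
          in_L2 setT (fun y => fourier phi y * fold f y)]].
Proof.
have p2 := in_L2_fourier hp.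
have mpf f : in_L2 setT f -> cmeasurable setT (fun y => fourier phi y * fold f y).
  by move=> f2; apply: cmeasurableM; [case: p2|exact: cmeasurable_fold].
have domE := dom_analysisE a0 hp.
apply/seteqP; split => f.
  move=> [h fh]; have [df [_ h2 _]] := (is_frame_operatorE f h).1 fh.
  have [f2 B2] : in_L2 setT f /\ in_L2 `]0, 1[ (bracket a (fourier f) (fourier phi)).
    by have := df; rewrite domE.
  split; [exact: f2|exact: B2|].
  apply: (ae_eq_in_L2 mT _ _ (in_L2Z mT (real_complex R a) (in_L2_fourier h2))); first exact: mpf.
  apply: ae_mono (fourier_frame_operator fh) => y -> _.
  by rewrite -mulrA mulrA -rmorphM divff ?gt_eqF// rmorph1 mul1r.
move=> [f2 B2 m2].
have df : dom_analysis phi a f by rewrite domE.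
have : dom_analysis_adjoint phi a (analysis phi a f).
  rewrite (dom_analysis_adjointE a0 hp); split; first by case: df.
  have [G [mG _ _ _] GE] := fourier_seriesP a0 df.2.
  have [_] : in_L2 setT (fun y => fourier_series a (analysis phi a f) y * fourier phi y); last by [].
  apply: (ae_eq_in_L2 mT _ _ (in_L2Z mT (real_complex R a^-1) m2)).
    by rewrite (funext GE); apply: cmeasurableM; [exact: cmeasurable_scale|case: p2].
  apply: ae_mono (fourier_series_fold df) => y -> _.
  by rewrite mulrCA mulrC.
by move=> [h hh]; exists h; apply/is_frame_operatorE.
Qed.

End Frame.

Theorem theorem6p2 (R : realType) (phi : R -> R[i]) (a : R)
    (hphi : in_L2 setT phi) (ha : 0 < a) :
  (* (i) *)
  [/\ dom_analysis phi a =
        [set f | in_L2 setT f /\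
                 in_L2 `]0, 1[ (bracket a (fourier f) (fourier phi))],
      (forall f, dom_analysis phi a f -> forall n : int,
         analysis phi a f n =
         L2dot `]0, 1[ (bracket a (fourier f) (fourier phi)) (expo (- n))),
      (forall f, in_L2 setT f ->
         (exists M : R, {ae @lebesgue_measure R, forall y,
            cabs (fourier f y) <= M}) ->
         (exists2 K : set R, compact K &
            {ae @lebesgue_measure R, forall y, ~ K y -> fourier f y = 0}) ->
         dom_analysis phi a f)
    & L2closure (dom_analysis phi a) = [set f | in_L2 setT f]]
  /\
  (* (ii) *)
  (dom_analysis_adjoint phi a =
     [set c | in_l2 c /\
        (\int[@lebesgue_measure R]_y
           (cabs (fourier_series a c y * fourier phi y) ^+ 2)%:E < +oo)%E]
   /\
   (forall c h, is_analysis_adjoint phi a c h ->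
      {ae @lebesgue_measure R, forall y,
         fourier h y = fourier_series a c y * fourier phi y}))
  /\
  (* (iii) *)
  [/\ is_subspace (dom_frame_operator phi a),
      dom_frame_operator phi a =
        [set f | [/\ in_L2 setT f,
          in_L2 `]0, 1[ (bracket a (fourier f) (fourier phi)) &
          in_L2 setT (fun y => fourier phi y *
            zsum (fun n => fourier f (y - n%:~R / a) *
                           conjc (fourier phi (y - n%:~R / a))))]]
    & forall f h, is_frame_operator phi a f h ->
        {ae @lebesgue_measure R, forall y,
          fourier h y = real_complex R a^-1 * fourier phi y *
            zsum (fun n => fourier f (y - n%:~R / a) *
                           conjc (fourier phi (y - n%:~R / a)))}].
Proof.
split; first split.
- exact: dom_analysisE.
- by move=> f [f2 _] n; rewrite -[RHS]/(coef _ n) coef_bracket.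
- by move=> f; exact: dom_analysis_compact.
- exact: dom_analysis_dense.
split; first split.
- exact: dom_analysis_adjointE.
- by move=> c h; exact: fourier_adjoint.
split.
- exact: dom_frame_operator_subspace.
- exact: dom_frame_operatorE.
- by move=> f h; exact: fourier_frame_operator.
Qed.
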